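(* Let $(\Omega,\Sigma,P)$ be a probability space and $N=\{N_t\}_{t\ge 0}$ a counting process on it with interarrival process $W=\{W_n\}_{n\in\mathbb N}$. Consider the assertions: (i) there exists a real-valued random variable $\check\Theta$ on $\Omega$ such that $N$ is a $P$-MPP$(\check\Theta)$; (ii) there exist a family $\{P_{\tilde y}\}_{\tilde y\in\tilde\Upsilon}$ of probability measures on $\Sigma$ and a probability measure $\nu$ on $B(\Sigma)$ such that $N$ is a $P$-MPP$(\{P_{\tilde y}\}_{\tilde y\in\tilde\Upsilon},\nu)$; (iii) there exist a real-valued random variable $\check\Theta$ on $\Omega$ and a disintegration $\{Q_{\check\theta}\}_{\check\theta\in\mathbb R}$ of $P$ over $P_{\check\Theta}$ consistent with $\check\Theta$ such that $N$ is a $Q_{\check\theta}$-PP$(\check\theta)$ for $P_{\check\Theta}$-almost all $\check\theta\in\mathbb R$; (iv) there exists a probability distribution $U$ on $\mathfrak B(\mathbb R)$ with $U((0,\infty))=1$ such that $N$ is a $P$-MPP$(U)$. Then (iii) $\Rightarrow$ (i) $\Rightarrow$ (iv). If moreover $P$ is perfect and $\Sigma$ is countably generated, then (i) $\Leftrightarrow$ (iii) and (i) $\Rightarrow$ (ii). If in addition the Standing Assumption B holds for $N$, then all of (i)–(iv) are equivalent.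
   Context: Counting process: a family $N=\{N_t\}_{t\in[0,\infty)}$ of $\Sigma$-$\mathfrak B(\overline{\mathbb R})$-measurable maps such that (after discarding a $P$-null set, which we assume empty) each path $t\mapsto N_t(\omega)$ takes values in $\mathbb N_0\cup\{\infty\}$, is right-continuous, has jumps of size at most one, satisfies $N_0=0$ and increases to $\infty$. Its arrival process is $T_0=0$, $T_n=\inf\{t:N_t\ge n\}$, and its interarrival process is $W_n=T_n-T_{n-1}$, $n\in\mathbb N$. For a real random variable $\Theta$, $P(E\mid\sigma(\Theta))$ denotes conditional probability; a family $\{X_i\}$ of real random variables is $P$-conditionally independent given $\Theta$ if $P(\bigcap_{j=1}^n\{X_{i_j}\le x_j\}\mid\sigma(\Theta))=\prod_{j=1}^nP(\{X_{i_j}\le x_j\}\mid\sigma(\Theta))$ a.s. for all distinct $i_1,\dots,i_n$ and reals $x_j$. $P_{X|\Theta}$ denotes a conditional distribution of $X$ given $\Theta$ (a kernel $\mathfrak B\times\Omega\to[0,1]$, $\sigma(\Theta)$-measurable in $\omega$, equal to $P(X^{-1}(B)\mid\sigma(\Theta))$ a.s. for each Borel $B$). $\mathbf P(\lambda)$ is the Poisson law and $\mathbf{Exp}(\lambda)$ the exponential law with density $\lambda e^{-\lambda t}$ on $(0,\infty)$. For a probability measure $Q$, $Q$-PP$(\theta)$ means a Poisson process with rate $\theta>0$ under $Q$. $P$-MPP$(\Theta)$: for a real random variable $\Theta$ with $P_\Theta((0,\infty))=1$, $N$ has $P$-conditionally (given $\Theta$) independent increments, $P$-conditionally stationary increments (for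 all $0\le t_0<\dots<t_m$ and $h\ge0$, the increment vectors $(N_{t_j}-N_{t_{j-1}})_{j\le m}$ and $(N_{t_j+h}-N_{t_{j-1}+h})_{j\le m}$ have the same conditional distribution given $\sigma(\Theta)$), and for every $t>0$, $P_{N_t|\Theta}=\mathbf P(\Theta t)$ $P|\sigma(\Theta)$-a.s. $P$-MPP$(\{P_{\tilde y}\}_{\tilde y\in\tilde\Upsilon},\nu)$ (Huang): $\{P_{\tilde y}\}$ is a family of probability measures on $\Sigma$ indexed by a set $\tilde\Upsilon$, $B(\Sigma)$ is the $\sigma$-algebra on $\tilde\Upsilon$ generated by the maps $\tilde y\mapsto P_{\tilde y}(E)$, $E\in\Sigma$, $\nu$ is a probability measure on $B(\Sigma)$, there is a positive measurable function $\alpha$ such that for $\nu$-a.a. $\tilde y$ the sequence $W$ is $P_{\tilde y}$-independent with $(P_{\tilde y})_{W_n}=\mathbf{Exp}(\alpha(\tilde y))$ for all $n$, and for all $r\in\mathbb N$, $w_1,\dots,w_r>0$: $P(\bigcap_{k=1}^r\{W_k\le w_k\})=\int\prod_{k=1}^rP_{\tilde y}(\{W_k\le w_k\})\,\nu(d\tilde y)$. $P$-MPP$(U)$: for all $m\in\mathbb N$, $0=t_0<t_1<\dots<t_m$, $\kappa_1,\dots,\kappa_m\in\mathbb N_0$: $P(\bigcap_{j=1}^m\{N_{t_j}-N_{t_{j-1}}=\kappa_j\})=\int_{(0,\infty)}\prod_{j=1}^m e^{-\theta(t_j-t_{j-1})}\frac{(\theta(t_j-t_{j-1}))^{\kappa_j}}{\kappa_j!}U(d\theta)$.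 Disintegration: for a probability measure $Q$ on $\mathfrak B(\mathbb R^d)$ (or on $\mathfrak B(D)$), a family $\{P_\theta\}$ of probability measures on $\Sigma$ with $\theta\mapsto P_\theta(E)$ Borel measurable and $\int P_\theta(E)Q(d\theta)=P(E)$ for all $E\in\Sigma$. If $\Theta$ is a random vector with $P_\Theta=Q$, the disintegration is consistent with $\Theta$ if for each Borel $B$, $P_\theta(\Theta^{-1}(B))=1$ for $Q$-a.e. $\theta\in B$. $P$ perfect: for every $\Sigma$-measurable $f:\Omega\to\mathbb R$ there is a Borel set $B\subseteq f(\Omega)$ with $P(f^{-1}(B))=1$. $\Sigma$ countably generated: generated by a countable family of sets. Extended mixed renewal process: for $D\in\mathfrak B(\mathbb R)$ with $\Theta(\Omega)\subseteq D$, a Borel function $h:D\to\mathbb R$ and a family $\{\mathbf K(s)\}$ of probability distributions on $\mathfrak B(\mathbb R)$ (measurable in the parameter), $N$ is a $P$-eMRP$(\mathbf K(h(\Theta)))$ if $W$ is $P$-conditionally independent given $\Theta$ and $P_{W_n|\Theta}=\mathbf K(h(\Theta))$ for all $n$ (taken to hold everywhere, not only a.s.). Standing Assumption A (for $N$, $h$, $\{P_\theta\}_{\theta\in D}$): $\Theta$ is a positive real random variable, $N$ is a $P$-eMRP$(\mathbf K(h(\Theta)))$, $\{P_\theta\}_{\theta\in D}$ is a disintegration of $P$ over $P_\Theta$ consistent with $\Theta$ (then $(P_\theta)_{W_n}=\mathbf K(h(\theta))$ for all $n$ and $\theta\in D$), and with $F_{h(\theta)}(t):=P_\theta(\{W_n\le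 t\})$ there exists a $P_\Theta$-null set $L_h\in\mathfrak B(D)$ such that for every $\theta\in D\setminus L_h$: $F_{h(\theta)}$ is continuously differentiable on $(0,\infty)$, $0<F'_{h(\theta)}(t)<C(h(\theta))$ for all $t>0$ for some fixed $C\in\mathcal L^1(P_{h(\Theta)})$, and the function $p_h:D\setminus L_h\to\mathbb R$, $p_h(\theta):=\lim_{t\to0}F'_{h(\theta)}(t)$, is positive and injective. Standing Assumption B (for $N$): there exist a positive real random variable $\Theta$, a set $D$, a Borel $h:D\to\mathbb R$ and a disintegration $\{P_\theta\}_{\theta\in D}$ of $P$ over $P_\Theta$ consistent with $\Theta$ such that $N$, $h$, $\{P_\theta\}_{\theta\in D}$ satisfy Standing Assumption A. *)

(* Defs.v *)
From HB Require Import structures.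
From mathcomp Require Import all_boot all_order all_algebra.
From mathcomp Require Import all_classical all_reals all_analysis.
From mathcomp Require Import measurable_realfun.
Import Order.TTheory GRing.Theory Num.Def Num.Theory.
Import numFieldTopology.Exports numFieldNormedType.Exports.

Set Implicit Arguments.
Unset Strict Implicit.
Unset Printing Implicit Defensive.

Local Open Scope classical_set_scope.
Local Open Scope ring_scope.

Section Defs.
Context {R : realType} {d : measure_display} {Omega : measurableType d}.
Implicit Types (P Q : probability Omega R) (N : R -> Omega -> \bar R).

Definition posR : set R := `]0, +oo[%classic.

(* N t is only relevant for t >= 0.                                    *)
Definition counting_process N : Prop :=
  (forall t, 0 <= t -> measurable_fun setT (N t)) /\
  forall w : Omega,
    (forall t, 0 <= t -> (exists k : nat, N t w = (k%:R)%:E) \/ N t w = +oo%E) /\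
    N 0 w = 0%E /\
    (forall s t, 0 <= s -> s <= t -> (N s w <= N t w)%E) /\
    (forall t, 0 <= t -> (fun s => N s w) @ t^'+ --> N t w) /\
    (* jumps of size at most one: N_t <= N_{t-} + 1, with N_{t-} = sup_{s<t} N_s *)
    (forall t, 0 < t ->
       (N t w <= ereal_sup [set N s w | s in [set s : R | (0 <= s < t)%R]] + 1)%E) /\
    ((fun s => N s w) @ +oo --> +oo%E).

Definition arrival N (n : nat) (w : Omega) : \bar R :=
  ereal_inf [set t%:E | t in [set t : R | 0 <= t /\ ((n%:R)%:E <= N t w)%E]].

(* interarrival times: [interarrival N n] is the paper's W_{n+1}
   = T_{n+1} - T_n  (n : nat, starting at 0). *)
Definition interarrival N (n : nat) (w : Omega) : R :=
  fine (arrival N n.+1 w) - fine (arrival N n w).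

Definition sigma_measurable (Th : Omega -> R) (g : Omega -> R) : Prop :=
  forall B : set R, measurable B ->
    preimage_set_system setT Th measurable (g @^-1` B).

Definition is_cond_prob P (Th : Omega -> R) (E : set Omega) (g : Omega -> R)
  : Prop :=
  sigma_measurable Th g /\ P.-integrable setT (EFin \o g) /\
  forall C : set R, measurable C ->
    (\int[P]_(x in Th @^-1` C) (g x)%:E = P (E `&` Th @^-1` C))%E.

Definition cond_indep P (Th : Omega -> R) (I : eqType)
    (X : I -> Omega -> \bar R) : Prop :=
  forall (s : seq I) (x : I -> R) (g : Omega -> R) (gs : I -> Omega -> R),
    uniq s ->
    is_cond_prob P Th [set w | forall i, i \in s -> (X i w <= (x i)%:E)%E] g ->
    (forall i, i \in s -> is_cond_prob P Th [set w | (X i w <= (x i)%:E)%E] (gs i)) ->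
    {ae P, forall w, g w = \prod_(i <- s) gs i w}.

Definition indep Q (I : eqType) (X : I -> Omega -> \bar R) : Prop :=
  forall (s : seq I) (x : I -> R), uniq s ->
    Q [set w | forall i, i \in s -> (X i w <= (x i)%:E)%E] =
    (\prod_(i <- s) Q [set w | (X i w <= (x i)%:E)%E])%E.

Definition vec_event (m : nat) (X : 'I_m -> Omega -> \bar R)
    (B : set (m.-tuple R)) : set Omega :=
  [set w | exists v : m.-tuple R, B v /\ forall j, X j w = (tnth v j)%:E].

Definition cond_same_dist P (Th : Omega -> R) (m : nat)
    (X Y : 'I_m -> Omega -> \bar R) : Prop :=
  forall (B : set (m.-tuple R)) (g g' : Omega -> R), measurable B ->
    is_cond_prob P Th (vec_event X B) g ->
    is_cond_prob P Th (vec_event Y B) g' ->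
    {ae P, forall w, g w = g' w}.

Definition same_dist Q (m : nat) (X Y : 'I_m -> Omega -> \bar R) : Prop :=
  forall B : set (m.-tuple R), measurable B ->
    Q (vec_event X B) = Q (vec_event Y B).

Definition time_grid (m : nat) (t : nat -> R) : Prop :=
  0 <= t 0%N /\ forall j, (j < m)%N -> t j < t j.+1.

Definition increments N (m : nat) (t : nat -> R) : 'I_m -> Omega -> \bar R :=
  fun j w => (N (t j.+1) w - N (t j) w)%E.
Arguments increments N m t : clear implicits.

Definition value_event N (t : R) (B : set R) : set Omega :=
  [set w | exists r, B r /\ N t w = r%:E].

Definition poissonR (lambda : R) (B : set R) : \bar R :=
  poisson_prob lambda 0%N [set k : nat | B (k%:R)].

Definition MPP P N (Th : {RV P >-> R}) : Prop :=
  distribution P Th `]0, +oo[%classic = 1%E /\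
  (forall m t, time_grid m t -> cond_indep P Th (increments N m t)) /\
  (forall m t h, time_grid m t -> 0 <= h ->
     cond_same_dist P Th (increments N m t) (increments N m (fun j => t j + h))) /\
  (forall t, 0 < t -> forall (B : set R) (g : Omega -> R), measurable B ->
     is_cond_prob P Th (value_event N t B) g ->
     {ae P, forall w, (g w)%:E = poissonR (Th w * t) B}).

Definition PP Q (theta : R) N : Prop :=
  0 < theta /\
  (forall m t, time_grid m t -> indep Q (increments N m t)) /\
  (forall m t h, time_grid m t -> 0 <= h ->
     same_dist Q (increments N m t) (increments N m (fun j => t j + h))) /\
  (forall t, 0 < t -> forall B : set R, measurable B ->
     Q (value_event N t B) = poissonR (theta * t) B).

Definition MPP_U P N (U : probability R R) : Prop :=
  forall (m : nat) (t : nat -> R) (kappa : nat -> nat),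
    (0 < m)%N -> t 0%N = 0 -> (forall j, (j < m)%N -> t j < t j.+1) ->
    P [set w | forall j, (j < m)%N ->
                 (N (t j.+1) w - N (t j) w)%E = ((kappa j)%:R)%:E] =
    (\int[U]_(theta in posR)
       (\prod_(j < m)
          (expR (- (theta * (t j.+1 - t j))) *
           (theta * (t j.+1 - t j)) ^+ kappa j / ((kappa j)`!)%:R))%:E)%E.

Definition disintegration P (Qd : probability R R) (D : set R)
    (Pt : R -> probability Omega R) : Prop :=
  (forall E : set Omega, measurable E -> measurable_fun D (fun th => Pt th E)) /\
  (forall E : set Omega, measurable E ->
     (\int[Qd]_(th in D) Pt th E)%E = P E).

Definition consistent (Qd : probability R R) (D : set R)
    (Pt : R -> probability Omega R) (Th : Omega -> R) : Prop :=
  forall B : set R, measurable B -> B `<=` D ->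
    {ae Qd, forall th, B th -> Pt th (Th @^-1` B) = 1%E}.

Definition perfect P : Prop :=
  forall f : Omega -> R, measurable_fun setT f ->
    exists B : set R, measurable B /\ B `<=` range f /\ P (f @^-1` B) = 1%E.

Definition countably_generated : Prop :=
  exists G : set (set Omega), countable G /\
    (@measurable d Omega) = <<s G >>.

Definition kernel_family (K : R -> probability R R) : Prop :=
  forall B : set R, measurable B -> measurable_fun setT (fun s => K s B).

Definition eMRP P N (Th : Omega -> R) (h : R -> R) (K : R -> probability R R)
  : Prop :=
  kernel_family K /\
  cond_indep P Th (fun n w => (interarrival N n w)%:E) /\
  forall (n : nat) (B : set R), measurable B ->
    is_cond_prob P Th (interarrival N n @^-1` B) (fun w => fine (K (h (Th w)) B)).

Definition Fh N (Pt : R -> probability Omega R) (th : R) (t : R) : R :=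
  fine (Pt th [set w | interarrival N 0 w <= t]).

Definition standing_A P N (Th : {RV P >-> R}) (D : set R) (h : R -> R)
    (K : R -> probability R R) (Pt : R -> probability Omega R) : Prop :=
  (forall w, 0 < Th w) /\
  measurable D /\ range Th `<=` D /\ measurable_fun D h /\
  eMRP P N Th h K /\
  disintegration P (distribution P Th) D Pt /\
  consistent (distribution P Th) D Pt Th /\
  exists L : set R, measurable L /\ L `<=` D /\ distribution P Th L = 0%E /\
  exists C : R -> R,
    (exists Z : {mfun Omega >-> R}, (forall w, Z w = h (Th w)) /\
       (distribution P Z).-integrable setT (EFin \o C)) /\
    (forall th, D th -> ~ L th ->
       (forall t, 0 < t -> derivable (Fh N Pt th) t 1) /\
       {in `]0, +oo[%R, continuous (derive1 (Fh N Pt th) : R -> R)} /\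
       (forall t, 0 < t -> 0 < (derive1 (Fh N Pt th)) t < C (h th))) /\
    exists p : R -> R,
      (forall th, D th -> ~ L th ->
         (derive1 (Fh N Pt th)) t @[t --> 0^'+] --> p th /\ 0 < p th) /\
      {in [set th | D th /\ ~ L th] &, injective p}.

Definition standing_B P N : Prop :=
  exists (Th : {RV P >-> R}) (D : set R) (h : R -> R)
         (K : R -> probability R R) (Pt : R -> probability Omega R),
    standing_A N Th D h K Pt.

Definition assertion_i P N : Prop :=
  exists Th : {RV P >-> R}, MPP N Th.

Definition assertion_ii P N : Prop :=
  exists (dY : measure_display) (Y : measurableType dY)
         (Py : Y -> probability Omega R) (nu : probability Y R) (alpha : Y -> R),
    (@measurable dY Y =
       <<s [set A | exists (E : set Omega) (B : set (\bar R)),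
                      measurable E /\ measurable B /\
                      A = (fun y => Py y E) @^-1` B] >>) /\
    measurable_fun setT alpha /\ (forall y, 0 < alpha y) /\
    {ae nu, forall y,
       indep (Py y) (fun n w => (interarrival N n w)%:E) /\
       forall (n : nat) (B : set R), measurable B ->
         Py y (interarrival N n @^-1` B) = exponential_prob (alpha y) B} /\
    forall (r : nat) (wk : nat -> R), (0 < r)%N ->
      (forall k, (k < r)%N -> 0 < wk k) ->
      P [set w | forall k, (k < r)%N -> interarrival N k w <= wk k] =
      (\int[nu]_y \prod_(k < r) Py y [set w | (interarrival N k w <= wk k)%R])%E.

Definition assertion_iii P N : Prop :=
  exists (Th : {RV P >-> R}) (Qt : R -> probability Omega R),
    disintegration P (distribution P Th) setT Qt /\
    consistent (distribution P Th) setT Qt Th /\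
    {ae distribution P Th, forall th, PP (Qt th) th N}.

Definition assertion_iv P N : Prop :=
  exists U : probability R R, U `]0, +oo[%classic = 1%E /\ MPP_U P N U.

End Defs.

(* Main.v *)
Require Import Defs.
From HB Require Import structures.
From mathcomp Require Import all_boot all_order all_algebra.
From mathcomp Require Import all_classical all_reals all_analysis.
From mathcomp Require Import measurable_realfun.
From mathcomp Require Import ring lra.
Import Order.TTheory GRing.Theory Num.Def Num.Theory.
Import numFieldTopology.Exports numFieldNormedType.Exports.

Set Implicit Arguments.
Unset Strict Implicit.
Unset Printing Implicit Defensive.

Local Open Scope classical_set_scope.
Local Open Scope ring_scope.

(** The increments of N over the cells of a grid of mesh 1/(n+1) trap each
    interarrival time W_i between two grid times; letting n tend to infinity, the
    mixed Poisson formula yields P(W_i > w_i, i < r) = E exp(-X (w_0 + ... + w_{r-1})),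
    X being a constant under a member of a disintegration.  Hence W is i.i.d.
    exponential under almost every member of a disintegration over the parameter;
    conversely, i.i.d. exponential interarrival times make N a Poisson process, as
    one sees by splitting off the first of them.

    On a perfect space with a countably generated sigma-algebra, a disintegration is
    obtained by coding the sigma-algebra by one real function f, taking conditional
    quantiles of f, and coming back through a measurable section of f.

    Under (ii) or (iv) the probability P(W_i > w_i, i < r) only depends on the sum of
    the w_i.  If W is moreover conditionally i.i.d. with tail function G, then
    E (G_u G_v - G_{u+v})^2 = 0, so that almost surely G is exponential, and its rate
    - ln G_1 is the structural parameter required by (i). *)

(** * Paths of counting processes *)

(** A disintegration turns an identity of conditional probabilities into one for almost every member
    only event by event, whereas independence and Poisson laws involve uncountably many grids and
    Borel sets. Hence almost sure statements are first made for countably many events, cells of the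
    grids of mesh 1/(n+1) or rational rectangles for W, and then extended for a fixed member by a
    limit or by uniqueness of measures. Clauses on conditional probabilities speak of every version,
    so they are exploited by first producing one by Radon-Nikodym. Since N may be infinite, with +oo
    - +oo = -oo, exact values of increments and inequalities between them must be reconciled on null
    sets. In the return to (i), the conditional probability of a rectangle given the old parameter
    depends on the rate only, and the rate is a function of that parameter; so it is also the
    conditional probability given the rate. Disintegrating anew, over the rate, gives (iii) and
    thereby (i). *)

Section counting_process_paths.
Context {R : realType} {d : measure_display} {Omega : measurableType d}.
Variable N : R -> Omega -> \bar R.
Hypothesis cN : counting_process N.

Definition atime n w : R := fine (arrival N n w).

Lemma N_nat_or_pinfty t w : 0 <= t ->
  (exists k : nat, N t w = (k%:R)%:E) \/ N t w = +oo%E.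
Proof. by move=> t0; have [+ _] := cN.2 w; exact. Qed.

Lemma N_at0 w : N 0 w = 0%E. Proof. by have [_ []] := cN.2 w. Qed.

Lemma N_nondecreasing s t w : 0 <= s -> s <= t -> (N s w <= N t w)%E.
Proof. by have [_ [_ [+ _]]] := cN.2 w; exact. Qed.

(** Right continuity makes the infimum attained, and divergence of the path makes it finite, so that
    [fine] loses nothing. *)
Lemma ge_N_atime n t w : 0 <= t -> ((n%:R)%:E <= N t w)%E = (atime n w <= t).
Proof.
have [_ [_ [mon [rc [_ oo]]]]] := cN.2 w.
pose S := [set t%:E | t in [set t : R | 0 <= t /\ ((n%:R)%:E <= N t w)%E]].
have [s0 [s00 Ns0]] : exists s, 0 <= s /\ ((n%:R)%:E <= N s w)%E.
  move/cvgeyPge: oo => /(_ n%:R) [M [_ HM]].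
  exists (`|M| + 1); split; first by rewrite addr_ge0.
  by apply: HM; rewrite (le_lt_trans (ler_norm _))// ltrDl.
have lb : (0 <= ereal_inf S)%E.
  by apply: le_ereal_inf_tmp => _ [t' [t'0 _] <-]; rewrite lee_fin.
have fi : ereal_inf S \is a fin_num.
  rewrite ge0_fin_numE// (@le_lt_trans _ _ s0%:E)//; last exact: ltry.
  by apply: ereal_inf_lbound; exists s0.
have aE : ((atime n w)%:E = ereal_inf S)%E by rewrite /atime fineK.
have a0 : 0 <= atime n w by rewrite -lee_fin aE.
have gtS t' : atime n w < t' -> ((n%:R)%:E <= N t' w)%E.
  rewrite -lte_fin aE => /ereal_inf_lt[_ [s [s0' Ns] <-]].
  rewrite lte_fin => st; apply: (le_trans Ns); apply: mon => //; exact: ltW.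
have atS : ((n%:R)%:E <= N (atime n w) w)%E.
  apply: (@cvge_ge _ _ _ _ (fun s => N s w) (N (atime n w) w) (n%:R)%:E _ (rc _ a0)).
  by near=> s; apply: gtS; near: s; exact: nbhs_right_gt.
move=> t0; apply/idP/idP => [Nt|].
  by rewrite -lee_fin aE; apply: ereal_inf_lbound; exists t.
by move=> at_; apply: (le_trans atS); exact: mon.
Unshelve. all: by end_near. Qed.

Lemma atime_ge0 n w : 0 <= atime n w.
Proof.
rewrite /atime fine_ge0//; apply: le_ereal_inf_tmp => _ [t' [t'0 _] <-].
by rewrite lee_fin.
Qed.

Lemma atime0 w : atime 0 w = 0.
Proof.
apply/eqP; rewrite eq_le atime_ge0 andbT -ge_N_atime//.
by rewrite N_at0.
Qed.

Lemma N_eq k t w : 0 <= t ->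
  N t w = (k%:R)%:E <-> atime k w <= t < atime k.+1 w.
Proof.
move=> t0; rewrite ltNge -!ge_N_atime//; split=> [->|].
  by rewrite lexx -ltNge lte_fin ltr_nat ltnS leqnn.
have [[j ->]|->] := N_nat_or_pinfty w t0; last by rewrite !leey andbF.
by rewrite !lee_fin !ler_nat -ltnNge ltnS -eqn_leq => /eqP ->.
Qed.

Lemma N_atime_pred n w t : 0 <= t -> t < atime n.+1 w -> (N t w <= (n%:R)%:E)%E.
Proof.
move=> t0; rewrite ltNge -ge_N_atime//.
have [[j ->]|->] := N_nat_or_pinfty w t0; last by rewrite leey.
by rewrite !lee_fin !ler_nat -ltnNge ltnS.
Qed.

(** Before a positive time [atime n] the path is at most n - 1, so a jump of size at most one cannot
    carry it to n + 1 at that time. *)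
Lemma atime_lt n w : atime n w < atime n.+1 w.
Proof.
have := atime_ge0 n w; rewrite le_eqVlt => /predU1P[a0|an0].
  rewrite ltNge -ge_N_atime ?atime_ge0// -a0 N_at0.
  by rewrite lee_fin -ltNge ltr0n.
have [_ [_ [_ [_ [jump _]]]]] := cN.2 w.
rewrite ltNge -ge_N_atime ?atime_ge0// -ltNge.
apply: (@le_lt_trans _ _ (n%:R)%:E); last by rewrite lte_fin ltr_nat.
apply: (le_trans (jump _ an0)).
case: n an0 => [|n] an0; first by rewrite atime0 ltxx in an0.
rewrite -natr1 EFinD leeD2r//; apply: ge_ereal_sup => _ [s /= /andP[s0 sn] <-].
exact: N_atime_pred.
Qed.

Lemma interarrivalE n w : interarrival N n w = atime n.+1 w - atime n w.
Proof. by []. Qed.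

Lemma interarrival_gt0 n w : 0 < interarrival N n w.
Proof. by rewrite interarrivalE subr_gt0 atime_lt. Qed.

Lemma atimeE n w : atime n w = \sum_(i < n) interarrival N i w.
Proof.
elim: n => [|n IH]; first by rewrite big_ord0 atime0.
by rewrite big_ord_recr/= -IH interarrivalE addrC subrK.
Qed.

Lemma measurable_atime n : measurable_fun setT (atime n).
Proof.
apply: (measurability _ (RGenOInfty.measurableE R)) => //.
move=> _ [_ [x ->] <-]; rewrite setTI.
have [x0|x0] := ltP x 0.
  rewrite (_ : _ @^-1` _ = setT)//; apply/seteqP; split=> // w _ /=.
  by rewrite in_itv/= andbT (lt_le_trans x0)// atime_ge0.
rewrite (_ : _ @^-1` _ = ~` (N x @^-1` [set y | ((n%:R)%:E <= y)%E])).
  apply: measurableC; rewrite -[X in measurable X]setTI; apply: (cN.1 x x0) => //.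
  rewrite (_ : [set y | _] = `[(n%:R)%:E, +oo[%classic); first exact: emeasurable_itv.
  by apply/seteqP; split=> y /=; rewrite in_itv/= andbT.
apply/seteqP; split => w /=; rewrite in_itv/= andbT ge_N_atime//.
  by rewrite leNgt => ->.
by rewrite leNgt => /negP; rewrite negbK.
Qed.

Lemma measurable_interarrival n : measurable_fun setT (interarrival N n).
Proof. by apply: measurable_funB; exact: measurable_atime. Qed.

(** From a finite value, a finite increment excludes +oo at the next time; hence the requirement on
    [N (t 0)]. *)
Lemma increments_cumul (t : nat -> R) (kappa : nat -> nat) m k w :
  N (t 0%N) w = (k%:R)%:E ->
  (forall j, (j < m)%N -> (N (t j.+1) w - N (t j) w)%E = ((kappa j)%:R)%:E) <->
  (forall j, (j < m)%N -> N (t j.+1) w = ((k + \sum_(i < j.+1) kappa i)%:R)%:E).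
Proof.
move=> N0; have Nj j : (forall i, (i < j)%N ->
    N (t i.+1) w = ((k + \sum_(l < i.+1) kappa l)%:R)%:E) ->
    N (t j) w = ((k + \sum_(l < j) kappa l)%:R)%:E.
  by case: j => [|j]; [rewrite big_ord0 addn0|apply].
split=> H j; last first.
  move=> jm; rewrite H// Nj; last by move=> i ij; apply: H; exact: ltn_trans jm.
  rewrite -EFinB big_ord_recr/= addnA natrD; congr (_%:E); ring.
elim/ltn_ind: j => j IH jm.
have NjE := Nj j (fun i ij => IH i ij (ltn_trans ij jm)).
have := H j jm; rewrite NjE big_ord_recr/= addnA.
case: (N (t j.+1) w) => [r||]//= [] rE; congr (_%:E).
by rewrite natrD -rE; ring.
Qed.

Lemma measurable_increment s t : 0 <= s -> 0 <= t ->
  measurable_fun setT (fun w => N t w - N s w)%E.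
Proof. by move=> s0 t0; apply: emeasurable_funB; exact: cN.1. Qed.

End counting_process_paths.

(* If Rel assigns (conditional) probabilities to events, the product formula for
   the events A i, B i passes to the differences A i \ B i. *)
Lemma prod_setD (T Z : Type) (I : eqType) (R : realType)
    (Rel : set T -> (Z -> R) -> Prop) (A B : I -> set T) (a b : I -> Z -> R) :
  (forall X Y x y, Y `<=` X -> Rel X x -> Rel Y y ->
     Rel (X `\` Y) (fun z => x z - y z)) ->
  (forall i, B i `<=` A i) ->
  (forall (f : I -> bool) s, uniq s ->
     Rel [set w | forall i, i \in s -> (if f i then A i else B i) w]
         (fun z => \prod_(i <- s) (if f i then a i z else b i z))) ->
  forall s, uniq s ->
    Rel [set w | forall i, i \in s -> (A i `\` B i) w]
        (fun z => \prod_(i <- s) (a i z - b i z)).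
Proof.
move=> RelD BA H.
(* Generalised for the induction: the indices in [l] already carry differences, those in [s] still
   carry [A] or [B] as [f] chooses. *)
have {}H l : forall f s, uniq (l ++ s) ->
    Rel [set w | (forall i, i \in l -> (A i `\` B i) w) /\
                 (forall i, i \in s -> (if f i then A i else B i) w)]
        (fun z => \prod_(i <- l) (a i z - b i z) *
                  \prod_(i <- s) (if f i then a i z else b i z)).
  elim: l => [|k l IH] f s.
    move=> us; have := H f s us; congr Rel.
      by apply/seteqP; split => w //= -[].
    by apply/funext => z; rewrite big_nil mul1r.
  rewrite cat_cons => ukls.
  have ulks : uniq (l ++ k :: s).
    by rewrite -cat1s uniq_catCA cat1s.
  have ks : k \notin s.
    by move: ukls => /=/andP[]; rewrite mem_cat negb_or => /andP[].
  pose g c i := if i == k then c else f i.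
  have eg c i : i \in s -> g c i = f i.
    by move=> si; rewrite /g; case: eqP => // ik; rewrite -ik si in ks.
  have prodE c z : \prod_(i <- s) (if g c i then a i z else b i z) =
      \prod_(i <- s) (if f i then a i z else b i z).
    by rewrite big_seq [RHS]big_seq; apply: eq_bigr => i si; rewrite eg.
  (* The index [k] passes from [s] to [l] by subtracting the instance with [B k] from the instance
     with [A k]. *)
  have := RelD _ _ _ _ _ (IH (g true) (k :: s) ulks) (IH (g false) (k :: s) ulks).
  have gk c : g c k = c by rewrite /g eqxx.
  match goal with |- (?P -> _) -> _ => have hP : P end.
    move=> w /= [Hl Hs]; split => // i; rewrite inE => /predU1P[->|si].
      by rewrite gk; apply: BA; have := Hs k; rewrite gk inE eqxx; exact.
    by rewrite eg//; have := Hs i; rewrite eg// inE si orbT; exact.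
  move=> /(_ hP); congr Rel.
    apply/seteqP; split => w /=.
      move=> [[Hl Hs] Hn]; split; last first.
        by move=> i si; have := Hs i; rewrite eg// inE si orbT; exact.
      move=> i; rewrite inE => /predU1P[->|]; last exact: Hl.
      split; first by have := Hs k; rewrite gk inE eqxx; exact.
      move=> Bk; apply: Hn; split => // j; rewrite inE => /predU1P[->|sj].
        by rewrite gk.
      by have := Hs j; rewrite !eg// inE sj orbT; exact.
    move=> [Hl Hs]; have [Ak nBk] := Hl k (mem_head _ _).
    split; [split|].
    - by move=> i li; apply: Hl; rewrite inE li orbT.
    - move=> i; rewrite inE => /predU1P[->|si]; first by rewrite gk.
      by rewrite eg//; exact: Hs.
    - by move=> [_ /(_ k)]; rewrite gk inE eqxx => /(_ isT).
  apply/funext => z; rewrite !big_cons !gk !prodE; ring.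
move=> s us; have := H s (fun=> true) [::]; rewrite cats0 => /(_ us).
congr Rel; first by apply/seteqP; split => w /=; [case|].
by apply/funext => z; rewrite big_nil mulr1.
Qed.

(** * Conditional probabilities *)

Section trace_measure.
Context {R : realType} {d : measure_display} {Omega : measurableType d}.
Variables (P : probability Omega R) (Th : {mfun Omega >-> R}).
Variables (E : set Omega) (mE : measurable E).

(** Its density with respect to the law of [Th] is the conditional probability of [E], as a function
    of the value of [Th]. *)
Definition trace_measure (C : set R) : \bar R := P (E `&` Th @^-1` C).

Let trace0 : trace_measure set0 = 0%E.
Proof. by rewrite /trace_measure preimage_set0 setI0 measure0. Qed.

Let trace_ge0 C : (0 <= trace_measure C)%E. Proof. exact: measure_ge0. Qed.

Let trace_sigma_additive : semi_sigma_additive trace_measure.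
Proof.
move=> F mF tF mUF; rewrite /trace_measure preimage_bigcup setI_bigcupr.
apply: (@measure_semi_sigma_additive _ _ _ P (fun n => E `&` Th @^-1` F n)).
- by move=> i; apply: measurableI => //; exact: measurable_funPTI.
- by apply: trivIset_setIl => i j _ _ [w [Fi Fj]]; apply: tF => //; exists (Th w).
- by apply: bigcup_measurable => i _; apply: measurableI => //; exact: measurable_funPTI.
Qed.

HB.instance Definition _ := isMeasure.Build _ _ _ trace_measure
  trace0 trace_ge0 trace_sigma_additive.

Let trace_finite : fin_num_fun trace_measure.
Proof.
by move=> C mC; apply: fin_num_measure; apply: measurableI => //; exact: measurable_funPTI.
Qed.

HB.instance Definition _ := Measure_isFinite.Build _ _ _ trace_measure trace_finite.

Lemma trace_measure_dom : trace_measure `<< distribution P Th.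
Proof.
apply/null_content_dominatesP => C mC C0.
apply/eqP; rewrite -measure_le0 -C0; apply: le_measure; rewrite ?inE.
- by apply: measurableI => //; exact: measurable_funPTI.
- exact: measurable_funPTI.
- exact: subIsetr.
Qed.

Definition trace_fmeasure : {finite_measure set R -> \bar R} := trace_measure.

End trace_measure.

Lemma ae_integrable d (T : measurableType d) (R : realType)
    (mu : {measure set T -> \bar R}) (f g : T -> \bar R) :
  measurable_fun setT g -> ae_eq mu setT f g ->
  mu.-integrable setT f -> mu.-integrable setT g.
Proof.
move=> mg fg /integrableP[mf foo]; apply/integrableP; split => //.
rewrite (le_lt_trans _ foo)// le_eqVlt; apply/orP; left; apply/eqP.
apply: ge0_ae_eq_integral => //; [exact: measurableT_comp..|].
exact/ae_eq_abse/ae_eq_sym.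
Qed.

Section cond_prob.
Context {R : realType} {d : measure_display} {Omega : measurableType d}.
Variables (P : probability Omega R) (Th : {mfun Omega >-> R}).
Implicit Types (E F : set Omega) (g : Omega -> R).

Lemma measurable_preim (C : set R) : measurable C -> measurable (Th @^-1` C).
Proof. by move=> mC; exact: measurable_funPTI. Qed.
Hint Resolve measurable_preim : core.

Lemma sigma_measurableP g :
  sigma_measurable Th g <->
  measurable_fun setT (g : g_sigma_algebra_preimageType Th -> R).
Proof.
split=> H; first by move=> _ B mB; rewrite setTI; exact: H.
by move=> B mB; have := H measurableT B mB; rewrite setTI.
Qed.

Lemma sigma_measurable_fun g : sigma_measurable Th g -> measurable_fun setT g.
Proof.
move=> H _ B mB; have [C mC] := H B mB.
by rewrite !setTI => <-; exact: measurable_preim.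
Qed.

Lemma sigma_measurable_comp (h : R -> R) :
  measurable_fun setT h -> sigma_measurable Th (h \o Th).
Proof.
move=> mh B mB; exists (h @^-1` B); last by rewrite setTI.
by rewrite -[X in measurable X]setTI; exact: mh.
Qed.

Lemma sigma_measurableB g g' : sigma_measurable Th g -> sigma_measurable Th g' ->
  sigma_measurable Th (fun w => g w - g' w).
Proof.
move=> /sigma_measurableP mg /sigma_measurableP mg'; apply/sigma_measurableP.
exact: measurable_funB.
Qed.

Lemma sigma_measurable_prod (I : eqType) (s : seq I) (gs : I -> Omega -> R) :
  (forall i, sigma_measurable Th (gs i)) ->
  sigma_measurable Th (fun w => \prod_(i <- s) gs i w).
Proof.
move=> mgs; apply/sigma_measurableP; apply: measurable_prod => i _.
by apply/sigma_measurableP.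
Qed.

(** Integrals are compared on sets of the sigma-algebra of [Th] only, so uniqueness is applied to
    the image of [P] under the identity onto the space with that coarser sigma-algebra. *)
Lemma cond_prob_unique_gen g g' : sigma_measurable Th g ->
  sigma_measurable Th g' ->
  P.-integrable setT (EFin \o g) -> P.-integrable setT (EFin \o g') ->
  (forall C : set R, measurable C -> (\int[P]_(x in Th @^-1` C) (g x)%:E =
    \int[P]_(x in Th @^-1` C) (g' x)%:E)%E) ->
  {ae P, forall w, g w = g' w}.
Proof.
move=> mg mg' ig ig' H.
pose T' := g_sigma_algebra_preimageType Th.
have mid : measurable_fun setT (id : Omega -> T').
  by move=> _ _ [C mC <-]; rewrite !setTI; exact: measurable_preim.
pose X := mfun_Sub (mem_set mid) : {mfun Omega >-> T'}.
have iS h C : P.-integrable setT h -> measurable C ->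
    P.-integrable (Th @^-1` C) h.
  by move=> ih mC; apply: integrableS ih => //; exact: measurable_preim.
have tr h : sigma_measurable Th h -> P.-integrable setT (EFin \o h) ->
    forall E : set T', measurable E -> (\int[distribution P X]_(x in E) (h x)%:E =
      \int[P]_(x in (E : set Omega)) (h x)%:E)%E.
  move=> mh ih E [C mC CE].
  have mE : measurable (E : set T') by exists C.
  have mh' : measurable_fun setT (EFin \o h : T' -> \bar R).
    by apply/measurable_EFinP/sigma_measurableP.
  have iE : P.-integrable (id @^-1` E) (EFin \o h).
    by rewrite -CE setTI; exact: iS.
  exact: (integral_pushforward mid mh' iE mE).
have : ae_eq (distribution P X) setT (EFin \o (g : T' -> R)) (EFin \o (g' : T' -> R)).
  apply: integral_ae_eq => //.
  - have mg'' : measurable_fun setT (EFin \o g : T' -> \bar R).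
      by apply/measurable_EFinP/sigma_measurableP.
    exact: (integrable_pushforward mid mg'' (ig : P.-integrable (id @^-1` setT) _)).
  - by apply/measurable_EFinP/sigma_measurableP.
  - move=> E _ mE; rewrite !tr//; case: mE => C mC <-; rewrite setTI; exact: H.
move=> [B [mB B0 sB]]; exists B; split => //.
  by case: mB => C mC <-; rewrite setTI; exact: measurable_preim.
move=> w gw; apply: sB => /= /(_ I) [] gE; exact: gw.
Qed.

Lemma cond_prob_unique E g g' :
  is_cond_prob P Th E g -> is_cond_prob P Th E g' -> {ae P, forall w, g w = g' w}.
Proof.
move=> [mg [ig Eg]] [mg' [ig' Eg']]; apply: cond_prob_unique_gen => // C mC.
by rewrite Eg// Eg'.
Qed.

Lemma cond_prob_ae_eq E g g' : is_cond_prob P Th E g -> sigma_measurable Th g' ->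
  {ae P, forall w, g w = g' w} -> is_cond_prob P Th E g'.
Proof.
move=> [mg [ig Eg]] mg' gg'.
have gg'E C : ae_eq P C (EFin \o g) (EFin \o g').
  by apply: filterS gg' => w /= -> _.
have mE : measurable_fun setT (EFin \o g').
  exact/measurable_EFinP/sigma_measurable_fun.
split=> //; split; first exact: ae_integrable ig.
move=> C mC; rewrite -Eg//; apply/esym/ae_eq_integral => //.
- exact: measurable_preim.
- by apply: measurable_funTS; exact/measurable_EFinP/sigma_measurable_fun.
- exact: measurable_funTS.
Qed.

(** Serves to pass between events that differ only where [N] is infinite. *)
Lemma cond_prob_set E F g : is_cond_prob P Th E g ->
  measurable E -> measurable F -> P (E `\` F) = 0%E -> P (F `\` E) = 0%E ->
  is_cond_prob P Th F g.
Proof.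
move=> [mg [ig Eg]] mE mF EF FE; split=> //; split=> // C mC; rewrite Eg//.
have key A B : measurable A -> measurable B -> P (A `\` B) = 0%E ->
    (P (A `&` Th @^-1` C) <= P (B `&` Th @^-1` C))%E.
  move=> mA mB AB; have mC' := measurable_preim mC.
  have mAC : measurable (A `&` Th @^-1` C) by exact: measurableI.
  have D0 : P ((A `&` Th @^-1` C) `\` B) = 0%E.
    apply/eqP; rewrite -measure_le0 -AB; apply: le_measure; rewrite ?inE.
    - exact: measurableD.
    - exact: measurableD.
    - by move=> w [[]].
  rewrite (measureDI P mAC mB) [X in (X + _)%E]D0 add0e.
  apply: le_measure; rewrite ?inE; [exact: measurableI|exact: measurableI|].
  by move=> w [[]].
by apply/eqP; rewrite eq_le !key.
Qed.

Lemma cond_probD E F g g' : measurable E -> measurable F -> F `<=` E ->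
  is_cond_prob P Th E g -> is_cond_prob P Th F g' ->
  is_cond_prob P Th (E `\` F) (fun w => g w - g' w).
Proof.
move=> mE mF FE [mg [ig Eg]] [mg' [ig' Fg']]; split; first exact: sigma_measurableB.
split.
  apply: eq_integrable (integrableB measurableT ig ig') => //.
move=> C mC; have mC' := measurable_preim mC.
have iS h : P.-integrable setT h -> P.-integrable (Th @^-1` C) h.
  by apply: integrableS.
transitivity (\int[P]_(x in Th @^-1` C) ((EFin \o g) x - (EFin \o g') x))%E.
  by apply: eq_integral => w _; rewrite /= EFinB.
rewrite integralB//; [|exact: iS..].
have -> : (E `\` F) `&` Th @^-1` C = (E `&` Th @^-1` C) `\` (F `&` Th @^-1` C).
  apply/seteqP; split=> w /=; first by move=> [[Ew Fw] Cw]; split => // -[].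
  by move=> [[Ew Cw] H]; split => //; split => // Fw; apply: H.
have mEC : measurable (E `&` Th @^-1` C) by exact: measurableI.
have mFC : measurable (F `&` Th @^-1` C) by exact: measurableI.
rewrite Eg// Fg'// [RHS]measureD//.
  by congr (_ - P _)%E; rewrite [RHS]setIidr// => w [Fw Cw]; split => //; exact: FE.
by rewrite -ge0_fin_numE// fin_num_measure.
Qed.

Lemma cond_probP E (h : R -> R) : measurable_fun setT h ->
  (distribution P Th).-integrable setT (EFin \o h) ->
  (forall C : set R, measurable C ->
     (\int[distribution P Th]_(x in C) (h x)%:E = P (E `&` Th @^-1` C))%E) ->
  is_cond_prob P Th E (h \o Th).
Proof.
move=> mh ih H; have mh' : measurable_fun setT (EFin \o h) by exact/measurable_EFinP.
have iT : P.-integrable setT (EFin \o (h \o Th)).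
  apply/integrableP; split.
    by apply/measurable_EFinP; exact: measurableT_comp.
  move/integrableP : ih => [_].
  by rewrite ge0_integral_distribution//; exact: measurableT_comp.
split; first exact: sigma_measurable_comp.
split=> // C mC; rewrite -H//.
have iC : P.-integrable (Th @^-1` C) ((EFin \o h) \o Th).
  by apply: integrableS iT => //; exact: measurable_preim.
have mTh : measurable_fun setT Th by [].
by have := integral_pushforward mTh mh' iC mC.
Qed.

Lemma cond_density_exists E : measurable E ->
  exists h : R -> R, [/\ measurable_fun setT h, forall x, 0 <= h x,
    (distribution P Th).-integrable setT (EFin \o h) &
    forall C : set R, measurable C ->
      (\int[distribution P Th]_(x in C) (h x)%:E = P (E `&` Th @^-1` C))%E].
Proof.
move=> mE; have nuP := @trace_measure_dom _ _ _ P Th _ mE.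
pose f := Radon_Nikodym_SigmaFinite.f (trace_fmeasure P Th mE) (distribution P Th).
have ffin x : f x \is a fin_num by exact: Radon_Nikodym_SigmaFinite.f_fin_num.
have fint : (distribution P Th).-integrable setT f.
  exact: (Radon_Nikodym_SigmaFinite.f_integrable nuP).
have fE : EFin \o (fine \o f) = f by apply/funext => x /=; rewrite fineK.
exists (fine \o f); split.
- by apply/measurable_EFinP; rewrite fE; exact: measurable_int fint.
- by move=> x; rewrite /= fine_ge0//; exact: Radon_Nikodym_SigmaFinite.f_ge0.
- by rewrite fE.
move=> C mC; transitivity (trace_fmeasure P Th mE C); last by [].
rewrite (Radon_Nikodym_SigmaFinite.f_integral nuP mC).
by apply: eq_integral => x _; rewrite /= fineK.
Qed.

Lemma cond_prob_exists E : measurable E ->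
  exists2 h : R -> R, measurable_fun setT h & is_cond_prob P Th E (h \o Th).
Proof.
by move=> /cond_density_exists[h [mh _ ih hE]]; exists h => //; exact: cond_probP.
Qed.

Lemma measurable_le_event (X : Omega -> \bar R) (x : R) : measurable_fun setT X ->
  measurable [set w | (X w <= x%:E)%E].
Proof.
move=> mX; rewrite (_ : [set w | _] = setT `&` X @^-1` `]-oo, x%:E]%classic).
  by apply: mX => //; exact: emeasurable_itv.
by rewrite setTI; apply/seteqP; split => w /=; rewrite in_itv.
Qed.

Lemma measurable_all_le_event (I : eqType) (s : seq I) (X : I -> Omega -> \bar R) (x : I -> R) :
  (forall i, measurable_fun setT (X i)) ->
  measurable [set w | forall i, i \in s -> (X i w <= (x i)%:E)%E].
Proof.
move=> mX; rewrite (_ : [set w | _] = \bigcap_(i in [set` s]) [set w | (X i w <= (x i)%:E)%E]).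
  apply: fin_bigcap_measurable; first exact: finite_seq.
  by move=> i _; exact: measurable_le_event.
by apply/seteqP; split => w /= H i; exact: H.
Qed.

(** [cond_indep] compares the product with any version for the intersection. As a version exists,
    the product is one itself. *)
Lemma cond_indep_prod (I : eqType) (X : I -> Omega -> \bar R) (s : seq I)
    (x : I -> R) (gs : I -> Omega -> R) :
  cond_indep P Th X -> uniq s -> (forall i, measurable_fun setT (X i)) ->
  (forall i, is_cond_prob P Th [set w | (X i w <= (x i)%:E)%E] (gs i)) ->
  is_cond_prob P Th [set w | forall i, i \in s -> (X i w <= (x i)%:E)%E]
    (fun w => \prod_(i <- s) gs i w).
Proof.
move=> ci us mX Hgs.
have mE := measurable_all_le_event s x mX.
have [h mh hE] := cond_prob_exists mE.
apply: (cond_prob_ae_eq hE).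
  by apply: sigma_measurable_prod => i; case: (Hgs i).
by apply: (ci _ x) => // i _; exact: Hgs.
Qed.

Lemma cond_prob_ae_distribution E (h k : R -> R) :
  measurable_fun setT h -> measurable_fun setT k ->
  is_cond_prob P Th E (h \o Th) -> is_cond_prob P Th E (k \o Th) ->
  {ae distribution P Th, forall x, h x = k x}.
Proof.
move=> mh mk hE kE.
have [B [mB B0 sB]] := cond_prob_unique hE kE.
have mD : measurable [set x | h x != k x].
  have -> : [set x | h x != k x] = setT `&` (fun x => h x == k x) @^-1` [set false].
    by rewrite setTI; apply/seteqP; split => x /=; [move/negbTE|move=> ->].
  exact: (measurable_fun_eqr mh mk).
exists [set x | h x != k x]; split => //; last by move=> x /= /eqP.
apply/eqP; rewrite -measure_le0 -B0.
change (P (Th @^-1` [set x | h x != k x]) <= P B)%E.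
apply: le_measure; rewrite ?inE.
- exact: measurable_preim mD.
- exact: mB.
- by move=> w /= /eqP hk; exact: sB.
Qed.

Lemma ae_distribution (Q : R -> Prop) :
  {ae distribution P Th, forall x, Q x} -> {ae P, forall w, Q (Th w)}.
Proof.
move=> [B [mB B0 sB]]; exists (Th @^-1` B); split => //.
- exact: measurable_preim.
- by move=> w /= nQ; exact: sB.
Qed.

End cond_prob.

(** * From increments over grids to interarrival times *)

Section grid_events.
Context {R : realType} {d : measure_display} {Omega : measurableType d}.
Variable N : R -> Omega -> \bar R.
Hypothesis cN : counting_process N.

Definition cell_event (delta : R) (s : seq nat) : set Omega :=
  [set w | forall j, (j < size s)%N ->
     (N (j.+1%:R * delta) w - N (j%:R * delta) w)%E = ((nth 0%N s j)%:R)%:E].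

Definition lone_word (m : nat) : seq nat := rcons (nseq m 0%N) 1%N.

(* After the cells described by s, each further arrival is alone in its cell,
   and is preceded by at least as many empty cells as prescribed by ms. *)
Fixpoint gap_event (delta : R) (s ms : seq nat) : set Omega :=
  if ms is m :: ms' then
    \bigcup_n gap_event delta (s ++ lone_word (m + n)) ms'
  else cell_event delta s.

Lemma sum_nth_take (s : seq nat) j : (j <= size s)%N ->
  (\sum_(i < j) nth 0 s i = sumn (take j s))%N.
Proof.
elim: j => [|j IH] js; first by rewrite big_ord0 take0.
rewrite big_ord_recr/= IH ?(ltnW js)//.
by rewrite (take_nth 0%N js) sumn_rcons.
Qed.

Lemma cell_event_cumul delta s w : cell_event delta s w <->
  (forall j, (j <= size s)%N -> N (j%:R * delta) w = ((sumn (take j s))%:R)%:E).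
Proof.
have N0 : N (0%:R * delta) w = (0%:R)%:E by rewrite mul0r (N_at0 cN).
have := increments_cumul (t := fun j => j%:R * delta) (nth 0%N s) (size s) N0.
rewrite /cell_event /= => ->; split => H j.
  case: j => [|j] js; first by rewrite take0 N0.
  by rewrite H// add0n sum_nth_take.
by move=> js; rewrite add0n sum_nth_take// H.
Qed.

Lemma measurable_cell_event delta s : 0 <= delta -> measurable (cell_event delta s).
Proof.
move=> d0; rewrite (_ : cell_event _ _ = \bigcap_(j in [set j | (j < size s)%N])
    [set w | (N (j.+1%:R * delta) w - N (j%:R * delta) w)%E = ((nth 0%N s j)%:R)%:E])//.
apply: fin_bigcap_measurable; first exact: finite_II.
move=> j _; rewrite -[X in measurable X]setTI.
have mf := @measurable_increment _ _ _ _ cN (j%:R * delta) (j.+1%:R * delta).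
have {}mf := mf (mulr_ge0 (ler0n _ _) d0) (mulr_ge0 (ler0n _ _) d0).
exact: (mf measurableT _ (emeasurable_set1 ((nth 0%N s j)%:R)%:E)).
Qed.

Lemma measurable_gap_event delta s ms : 0 <= delta -> measurable (gap_event delta s ms).
Proof.
move=> d0; elim: ms s => [|m ms IH] s /=; first exact: measurable_cell_event.
by apply: bigcupT_measurable => n; exact: IH.
Qed.

Lemma size_lone_word m : size (lone_word m) = m.+1.
Proof. by rewrite size_rcons size_nseq. Qed.

Lemma sumn_lone_word m : sumn (lone_word m) = 1%N.
Proof. by rewrite sumn_rcons sumn_nseq mul0n. Qed.

Lemma sumn_take_lone_word m j : (j <= m)%N -> sumn (take j (lone_word m)) = 0%N.
Proof.
move=> jm; rewrite /lone_word -cats1 take_cat size_nseq.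
case: ltnP => [_|mj]; first by rewrite take_nseq ?sumn_nseq ?mul0n.
have -> : j = m by apply/eqP; rewrite eqn_leq jm.
by rewrite subnn take0 cats0 sumn_nseq mul0n.
Qed.

Lemma cell_event_cat delta s s' w : cell_event delta (s ++ s') w -> cell_event delta s w.
Proof.
move=> H j js; have := H j; rewrite size_cat nth_cat js => -> //.
exact: ltn_addr.
Qed.

Lemma gap_event_cell delta s ms w : gap_event delta s ms w -> cell_event delta s w.
Proof.
elim: ms s => [|m ms IH] s //= [n _ /IH]; exact: cell_event_cat.
Qed.

(** Different indices put the first arrival after [s] into different cells: at the end of the
    shorter word, one event has counted it and the other has not. *)
Lemma trivIset_gap_event delta s m ms :
  trivIset setT (fun n => gap_event delta (s ++ lone_word (m + n)) ms).
Proof.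
apply: ltn_trivIset => j i ij; apply/seteqP; split => // w [].
have mij : (m + i <= m + j)%N by rewrite leq_add2l ltnW.
move=> /gap_event_cell/cell_event_cumul Hi /gap_event_cell/cell_event_cumul Hj.
have sz k : size (s ++ lone_word (m + k)) = (size s + (m + k).+1)%N.
  by rewrite size_cat size_lone_word.
have := Hi (size s + (m + i).+1)%N; rewrite sz// leqnn => /(_ isT).
have := Hj (size s + (m + i).+1)%N; rewrite sz//.
rewrite leq_add2l ltnS mij => /(_ isT) ->.
rewrite !take_cat !ltnNge !leq_addr/= !addKn !sumn_cat.
rewrite sumn_take_lone_word; last by rewrite ltn_add2l.
rewrite take_oversize ?size_lone_word// sumn_lone_word => -[] /eqP.
by rewrite eqr_nat eqn_add2l.
Qed.

(** Arrival number [sumn s] has occurred by the end of the cells of [s], and the next one comes only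
    after m + n further empty cells. *)
Lemma gap_event_sub delta s ms w : 0 <= delta -> gap_event delta s ms w ->
  forall i, (i < size ms)%N ->
  (nth 0%N ms i)%:R * delta < interarrival N (sumn s + i) w.
Proof.
move=> d0; elim: ms s => [|m ms IH] s //= [n _ H] [_|i].
  have := (@cell_event_cumul delta _ w).1 (gap_event_cell H).
  rewrite size_cat size_lone_word => C; rewrite /= addn0.
  have /(N_eq cN _ _ (mulr_ge0 (ler0n _ _) d0))/andP[h1 _] :
      N ((size s)%:R * delta) w = ((sumn s)%:R)%:E.
    by rewrite C ?leq_addr// take_size_cat.
  have /(N_eq cN _ _ (mulr_ge0 (ler0n _ _) d0))/andP[_ h2] :
      N ((size s + (m + n))%:R * delta) w = ((sumn s)%:R)%:E.
    rewrite C ?leq_add2l// take_cat ltnNge leq_addr/= addKn sumn_cat.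
    by rewrite sumn_take_lone_word// addn0.
  rewrite interarrivalE; move: h1 h2; rewrite !natrD => h1 h2.
  have : 0 <= n%:R * delta by rewrite mulr_ge0.
  lra.
rewrite ltnS => im; have := IH _ H i im.
by rewrite sumn_cat sumn_lone_word addn1 addSnnS.
Qed.

(** A converse of [gap_event_sub] that loses one cell: the preceding arrival is only known to lie
    somewhere in the last cell of [s], whence the successor on each entry of [ms]. The bound on one
    more interarrival time makes the last arrival, too, alone in its cell. *)
Lemma sub_gap_event delta s ms w : 0 < delta -> cell_event delta s w ->
  (size s)%:R * delta - delta < atime N (sumn s) w ->
  (forall i, (i < size ms)%N ->
     (nth 0%N ms i).+1%:R * delta < interarrival N (sumn s + i) w) ->
  delta < interarrival N (sumn s + size ms) w ->
  gap_event delta s ms w.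
Proof.
move=> d0; have kd (k : nat) : 0 <= k%:R * delta by rewrite mulr_ge0// ltW.
elim: ms s => [|m ms IH] s //= Cs Ts Hms Hlast.
set k := sumn s in Ts Hms Hlast *.
have W0 : m.+1%:R * delta < interarrival N k w by have := Hms 0%N isT; rewrite addn0.
have W1 : delta < interarrival N k.+1 w.
  case: ms {IH} Hms Hlast => [|m' ms] Hms Hlast /=; first by rewrite addn1 in Hlast.
  have /= := Hms 1%N isT; rewrite addn1; apply: le_lt_trans.
  by rewrite ler_peMl ?(ltW d0)// ler1n.
move: (W0) (W1); rewrite !interarrivalE => {}W0 {}W1.
(* The cell of the next arrival. It is closed on the right because [N] at the right endpoint counts
   an arrival occurring there. *)
have [K [K1 K2]] : exists K : nat,
    K%:R * delta < atime N k.+1 w /\ atime N k.+1 w <= K.+1%:R * delta.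
  pose Q K := atime N k.+1 w <= K.+1%:R * delta.
  have exQ : exists K, Q K.
    exists (Num.truncn (atime N k.+1 w / delta)); rewrite /Q -ler_pdivrMr//.
    by apply/ltW/truncnS_gt.
  exists (ex_minn exQ); case: ex_minnP => -[|K] QK minK; split => //.
    by rewrite mul0r (le_lt_trans _ (atime_lt cN k w))// atime_ge0.
  rewrite ltNge; apply/negP => QK'; have := minK _ QK'; by rewrite ltnn.
have mK : (size s + m <= K)%N.
  rewrite -ltnS -(ltr_nat R) -(ltr_pM2r d0); apply: lt_le_trans K2.
  move: Ts W0; rewrite natrD -[m.+1]addn1 natrD => Ts W0; lra.
exists (K - (size s + m))%N => //.
have -> : (m + (K - (size s + m)) = K - size s)%N.
  by rewrite subnDA addnBA// ?addKn ?subnKC// leq_subRL// (leq_trans _ mK)// leq_addr.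
have sK : (size s <= K)%N by rewrite (leq_trans _ mK)// leq_addr.
have sz : size (s ++ lone_word (K - size s)) = K.+1.
  by rewrite size_cat size_lone_word addnS subnKC.
have sm : sumn (s ++ lone_word (K - size s)) = k.+1.
  by rewrite sumn_cat sumn_lone_word addn1.
have [_ Tk] : (size s <= size s)%N /\ atime N k w <= (size s)%:R * delta.
  split => //; have := (@cell_event_cumul _ _ _).1 Cs _ (leqnn _).
  by rewrite take_size => /(N_eq cN _ _ (kd _))/andP[].
apply: IH.
- apply/cell_event_cumul => j; rewrite sz leq_eqVlt => /predU1P[->|].
    rewrite take_oversize ?sz// sm; apply/(N_eq cN) => //; rewrite K2/=.
    rewrite -[K.+1]addn1 natrD; lra.
  rewrite ltnS => jK; have [js|sj] := leqP j (size s).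
    rewrite takel_cat//; exact: ((@cell_event_cumul _ _ _).1 Cs).
  rewrite take_cat ltnNge (ltnW sj)/= sumn_cat sumn_take_lone_word ?leq_sub2r//.
  rewrite addn0; apply/(N_eq cN) => //; apply/andP; split.
    by rewrite (le_trans Tk)// ler_pM2r// ler_nat ltnW.
  by rewrite (le_lt_trans _ K1)// ler_pM2r// ler_nat.
- rewrite sz sm; move: K1; rewrite -[K.+1]addn1 natrD; lra.
- by move=> i im; rewrite sm addSnnS; have := Hms i.+1; exact.
- by rewrite sm addSnnS.
Qed.

End grid_events.

Section grid_limit.
Context {R : realType} {d : measure_display} {Omega : measurableType d}.
Variables (P : probability Omega R) (U : probability R R) (N : R -> Omega -> \bar R).
Hypothesis cN : counting_process N.

Definition cell_pmf (x : R) (s : seq nat) : R :=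
  \prod_(k <- s) (expR (- x) * x ^+ k / (k`!)%:R).

(* For x > 0 this is x / (exp x - 1), the sum over n of the probabilities that
   the first arrival is the only one in the n-th cell. *)
Definition gap_factor (x : R) : R := x * expR (- ln (expR x - 1)).

Lemma expR_sub1_gt0 (x : R) : 0 < x -> 0 < expR x - 1.
Proof. by move=> x0; rewrite subr_gt0 expR_gt1. Qed.

Lemma gap_factorE x : 0 < x -> gap_factor x = x / (expR x - 1).
Proof.
by move=> x0; rewrite /gap_factor expRN lnK// posrE expR_sub1_gt0.
Qed.

Lemma gap_factor_le1 x : 0 < x -> gap_factor x <= 1.
Proof.
move=> x0; rewrite gap_factorE// ler_pdivrMr ?expR_sub1_gt0// mul1r.
have h := expR_ge1Dx x; lra.
Qed.

(** The lower bound is chosen exponential: for x = theta delta it merely lengthens the total time in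
    the Laplace transform by one mesh per interarrival time. *)
Lemma expRN_le_gap_factor x : 0 < x -> expR (- x) <= gap_factor x.
Proof.
move=> x0; rewrite gap_factorE// ler_pdivlMr ?expR_sub1_gt0//.
rewrite mulrBr mulr1 -expRD addNr expR0.
have h := expR_ge1Dx (- x); lra.
Qed.

Lemma gap_factor_ge0 x : 0 < x -> 0 <= gap_factor x.
Proof. by move=> x0; apply: (le_trans (expR_ge0 (- x))); exact: expRN_le_gap_factor. Qed.

Lemma measurable_gap_factor : measurable_fun setT gap_factor.
Proof.
apply: measurable_funM => //; apply: measurableT_comp => //.
apply: measurableT_comp => //; apply: measurableT_comp; first exact: measurable_ln.
by apply: measurable_funB.
Qed.

Lemma measurable_cell_pmf s : measurable_fun setT (cell_pmf ^~ s).
Proof.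
apply: measurable_prod => k _; apply: measurable_funM => //.
apply: measurable_funM; last exact: measurable_funX.
by apply: measurableT_comp => //; exact: measurable_funN.
Qed.

Lemma cell_pmf_ge0 x s : 0 <= x -> 0 <= cell_pmf x s.
Proof.
move=> x0; apply: prodr_ge0 => k _; rewrite !mulr_ge0 ?expR_ge0 ?invr_ge0//.
exact: exprn_ge0.
Qed.

Lemma cell_pmf_cat x s s' : cell_pmf x (s ++ s') = cell_pmf x s * cell_pmf x s'.
Proof. by rewrite /cell_pmf big_cat. Qed.

Lemma cell_pmf_lone_word x m : cell_pmf x (lone_word m) = expR (- x) ^+ m.+1 * x.
Proof.
rewrite /cell_pmf big_rcons/= expr1 divr1 exprSr.
rewrite (_ : \prod_(i <- nseq m 0%N) _ = expR (- x) ^+ m); first by ring.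
elim: m => [|m IH]; first by rewrite big_nil.
by rewrite /= big_cons IH exprS fact0 expr0; field.
Qed.

Definition gap_pmf (x : R) (ms : seq nat) : R :=
  \prod_(m <- ms) (expR (- x) ^+ m * gap_factor x).

Lemma measurable_gap_pmf ms : measurable_fun setT (gap_pmf ^~ ms).
Proof.
apply: measurable_prod => m _; apply: measurable_funM; last exact: measurable_gap_factor.
apply: measurable_funX; apply: measurableT_comp => //; exact: measurable_funN.
Qed.

Lemma gap_pmf_ge0 x ms : 0 < x -> 0 <= gap_pmf x ms.
Proof.
move=> x0; apply: prodr_ge0 => m _.
by rewrite mulr_ge0 ?gap_factor_ge0// exprn_ge0// expR_ge0.
Qed.

(** A geometric series of ratio q = exp (- x), using q x / (1 - q) = x / (exp x - 1). *)
Lemma nneseries_lone_word x (a : R) m : 0 < x -> 0 <= a ->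
  (\sum_(n <oo) (a * cell_pmf x (lone_word (m + n)))%:E =
   (a * (expR (- x) ^+ m * gap_factor x))%:E)%E.
Proof.
move=> x0 a0; set q := expR (- x).
have q1 : `|q| < 1 by rewrite ger0_norm ?expR_ge0// expR_lt1 oppr_lt0.
have := @cvg_geometric_series _ (a * (q ^+ m.+1 * x)) _ q1.
have -> : a * (q ^+ m.+1 * x) / (1 - q) = a * (q ^+ m * gap_factor x).
  rewrite gap_factorE// exprS /q expRN.
  have y0 : expR x != 0 by rewrite gt_eqF ?expR_gt0.
  have y1 : expR x - 1 != 0 by rewrite gt_eqF ?expR_sub1_gt0.
  have -> : 1 - (expR x)^-1 = (expR x - 1) / expR x by field.
  by field; rewrite y0 y1.
move=> h; transitivity (limn (EFin \o series (geometric (a * (q ^+ m.+1 * x)) q))).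
  apply/congr_lim/funext => n /=; rewrite /series/= -sumEFin.
  apply: eq_bigr => i _; congr _%:E.
  by rewrite cell_pmf_lone_word /geometric/= -/q -addSn exprD; ring.
by rewrite EFin_lim; [rewrite (cvg_lim _ h)|apply: cvgP h].
Qed.

(** The union over the position of the next arrival is disjoint, and its sum is taken under the
    integral. The word [s] grows along the induction on [ms]. *)
Lemma prob_gap_event (delta : R) ms s : 0 < delta ->
  (forall s, P (cell_event N delta s) =
     (\int[U]_(theta in posR) (cell_pmf (theta * delta) s)%:E)%E) ->
  P (gap_event N delta s ms) =
  (\int[U]_(theta in posR)
    (cell_pmf (theta * delta) s * gap_pmf (theta * delta) ms)%:E)%E.
Proof.
move=> d0 H; have mposR : measurable (posR : set R) by exact: measurable_itv.
have pos (theta : R) : posR theta -> 0 < theta * delta.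
  by rewrite /posR /= in_itv/= andbT => t0; exact: mulr_gt0.
have mM (f : R -> R) : measurable_fun setT f ->
    measurable_fun (posR : set R) (fun theta => f (theta * delta)).
  by move=> mf; apply: measurable_funTS; apply: measurableT_comp => //; exact: measurable_funM.
elim: ms s => [|m ms IH] s /=.
  by rewrite H; apply: eq_integral => theta _; rewrite /gap_pmf big_nil mulr1.
rewrite measure_semi_bigcup; last 3 first.
- by move=> n; apply: measurable_gap_event => //; exact: ltW.
- exact: trivIset_gap_event.
- by apply: bigcupT_measurable => n; apply: measurable_gap_event => //; exact: ltW.
rewrite (eq_eseriesr (fun n _ => IH _)) -integral_nneseries//; last 2 first.
- move=> n; apply/measurable_EFinP; apply: measurable_funM.
    exact: (mM _ (measurable_cell_pmf _)).
  exact: (mM _ (measurable_gap_pmf _)).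
- move=> n theta /pos p; rewrite lee_fin mulr_ge0 ?gap_pmf_ge0//.
  by rewrite cell_pmf_ge0// ltW.
apply: eq_integral => theta; rewrite inE => /pos p.
rewrite [X in _ = (_ * X)%:E]/gap_pmf big_cons -/(gap_pmf _ ms).
transitivity (\sum_(n <oo) (cell_pmf (theta * delta) s * gap_pmf (theta * delta) ms *
    cell_pmf (theta * delta) (lone_word (m + n)))%:E)%E.
  by apply: eq_eseriesr => n _; rewrite cell_pmf_cat; congr _%:E; ring.
rewrite nneseries_lone_word//; last first.
  by rewrite mulr_ge0 ?gap_pmf_ge0// cell_pmf_ge0// ltW.
congr _%:E; ring.
Qed.

Definition laplace (x : R) : \bar R := (\int[U]_(theta in posR) (expR (- (theta * x)))%:E)%E.

Lemma measurable_survival r (w : nat -> R) :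
  measurable [set o | forall i, (i < r)%N -> w i < interarrival N i o].
Proof.
rewrite (_ : [set o | _] =
    \bigcap_(i in [set i | (i < r)%N]) (interarrival N i @^-1` `]w i, +oo[%classic)).
  apply: fin_bigcap_measurable; first exact: finite_II.
  move=> i _; rewrite -[X in measurable X]setTI.
  by apply: (measurable_interarrival cN) => //; exact: measurable_itv.
by apply/seteqP; split => o /= H i ir; have := H i ir; rewrite /= in_itv/= andbT.
Qed.

(** Each w_i is rounded up to a multiple of delta, which costs at most delta. In the first bound,
    the other delta is the cell lost in [sub_gap_event], and the index r provides the extra
    interarrival time required there. In the second bound, the other r delta come from
    [expRN_le_gap_factor]. *)
Lemma survival_grid (delta : R) r (w : nat -> R) : 0 < delta -> (forall i, 0 <= w i) ->
  (forall s, P (cell_event N delta s) =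
     (\int[U]_(theta in posR) (cell_pmf (theta * delta) s)%:E)%E) ->
  (P [set o | forall i, (i < r.+1)%N ->
     ((if i == r then 0 else w i) + 2 * delta < interarrival N i o)%R] <=
   laplace (\sum_(i < r) w i)%R)%E /\
  (laplace (\sum_(i < r) w i + 2 * r%:R * delta)%R <=
   P [set o | forall i, (i < r)%N -> (w i < interarrival N i o)%R])%E.
Proof.
move=> d0 w0 H.
pose ms := [seq (Num.truncn (w i / delta)).+1 | i <- iota 0 r].
have mE i : (i < r)%N -> nth 0%N ms i = (Num.truncn (w i / delta)).+1.
  by move=> ir; rewrite (nth_map 0%N) ?size_iota// nth_iota// add0n.
have szms : size ms = r by rewrite size_map size_iota.
have lo i : w i < (Num.truncn (w i / delta)).+1%:R * delta.
  by rewrite -ltr_pdivrMr// truncnS_gt.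
have hi i : (Num.truncn (w i / delta)).+1%:R * delta <= w i + delta.
  rewrite -natr1 mulrDl mul1r lerD2r -ler_pdivlMr//.
  by rewrite truncn_le divr_ge0// ltW.
have mposR : measurable (posR : set R) by exact: measurable_itv.
have mexp (x : R) : measurable_fun (posR : set R) (fun theta => (expR (- (theta * x)))%:E).
  apply: measurable_funTS; apply/measurable_EFinP; apply: measurableT_comp => //.
  by apply: measurable_funN; exact: measurable_funM.
have PE : P (gap_event N delta [::] ms) =
    (\int[U]_(theta in posR) (gap_pmf (theta * delta) ms)%:E)%E.
  rewrite prob_gap_event//; apply: eq_integral => theta _.
  by rewrite /cell_pmf big_nil mul1r.
have mg : measurable_fun (posR : set R) (fun theta => (gap_pmf (theta * delta) ms)%:E).
  apply: measurable_funTS; apply/measurable_EFinP.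
  have := measurable_gap_pmf ms => mg.
  by apply: (measurableT_comp mg); exact: measurable_funM.
have pos (theta : R) : posR theta -> 0 < theta by rewrite /posR /= in_itv/= andbT.
have gE theta : gap_pmf (theta * delta) ms =
    expR (- (theta * (\sum_(i < r) (Num.truncn (w i / delta)).+1%:R * delta))) *
    gap_factor (theta * delta) ^+ r.
  rewrite /gap_pmf /ms big_map -[r in iota 0 r]subn0 -/(index_iota 0 r) big_mkord.
  rewrite big_split/= prodr_const card_ord; congr (_ * _).
  rewrite mulr_sumr -sumrN expR_sum; apply: eq_bigr => i _.
  by rewrite -expRM_natl; congr expR; ring.
split.
- apply: (@le_trans _ _ (P (gap_event N delta [::] ms))).
    apply: le_measure; rewrite ?inE.
    + exact: measurable_survival.
    + by apply: measurable_gap_event => //; exact: ltW.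
    + move=> o /= Ho; apply: sub_gap_event => //=.
      * by rewrite mul0r sub0r (atime0 cN) oppr_lt0.
      * move=> i; rewrite szms => ir; rewrite add0n; apply: le_lt_trans (Ho i (ltnW ir)).
        rewrite mE// (ltn_eqF ir) -natr1 mulrDl mul1r.
        by have h := hi i; lra.
      * by rewrite szms add0n; have := Ho r (leqnn _); rewrite eqxx => h; lra.
  rewrite PE; apply: ge0_le_integral => //.
  + by move=> theta /pos t0; rewrite lee_fin gap_pmf_ge0// mulr_gt0.
  + move=> theta /pos t0; rewrite lee_fin gE -[leRHS]mulr1 ler_pM ?expR_ge0//.
    * by rewrite exprn_ge0// gap_factor_ge0// mulr_gt0.
    * rewrite ler_expR lerN2 ler_pM2l//; apply: ler_sum => i _; exact: ltW.
    * by rewrite exprn_ile1// ?gap_factor_ge0 ?gap_factor_le1// mulr_gt0.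
- apply: (@le_trans _ _ (P (gap_event N delta [::] ms))); last first.
    apply: le_measure; rewrite ?inE.
    + by apply: measurable_gap_event => //; exact: ltW.
    + exact: measurable_survival.
    + move=> o Ho i ir.
      have := gap_event_sub cN (ltW d0) Ho (i := i); rewrite szms => /(_ ir).
      by rewrite mE// add0n; apply: lt_trans.
  rewrite PE; apply: ge0_le_integral => //.
  + move=> theta /pos t0; rewrite lee_fin gE.
    apply: (@le_trans _ _ (expR (- (theta * (\sum_(i < r) (Num.truncn (w i / delta)).+1%:R * delta))) *
        expR (- (theta * delta)) ^+ r)).
      rewrite -expRM_natl -expRD ler_expR.
      have : \sum_(i < r) (Num.truncn (w i / delta)).+1%:R * delta <= \sum_(i < r) (w i + delta).
        by apply: ler_sum => i _.
      rewrite big_split/= sumr_const card_ord -mulr_natl => h.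
      have h2 := ler_wpM2l (ltW t0) h; lra.
    rewrite ler_wpM2l ?expR_ge0// lerXn2r ?nnegrE ?expR_ge0 ?gap_factor_ge0
      ?expRN_le_gap_factor ?mulr_gt0//.
Qed.

Lemma cvg_shift_inv (a : R) : (a + 2 * (n.+1%:R)^-1 : R) @[n --> \oo] --> a.
Proof.
rewrite -[X in _ --> X]addr0 -(mulr0 2).
apply: cvgD; first exact: cvg_cst.
by apply: cvgMl_tmp; exact: cvg_harmonic.
Qed.

(** As the mesh shrinks, the events of the upper bound increase to the survival event, because W_r
    is positive; the lower bounds increase to the Laplace transform by monotone convergence. *)
Lemma survival_of_grid r (w : nat -> R) : (forall i, 0 <= w i) ->
  (forall n s, P (cell_event N (n.+1%:R)^-1 s) =
     (\int[U]_(theta in posR) (cell_pmf (theta * (n.+1%:R)^-1) s)%:E)%E) ->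
  P [set o | forall i, (i < r)%N -> w i < interarrival N i o] =
  laplace (\sum_(i < r) w i).
Proof.
move=> w0 H; pose delta n : R := (n.+1%:R)^-1.
have dgt0 n : 0 < delta n by rewrite /delta invr_gt0.
pose F n := [set o | forall i, (i < r.+1)%N ->
     ((if i == r then 0 else w i) + 2 * delta n < interarrival N i o)%R].
have mF n : measurable (F n).
  exact: (measurable_survival r.+1 (fun i => (if i == r then 0 else w i) + 2 * delta n)).
have FE : \bigcup_n F n = [set o | forall i, (i < r)%N -> w i < interarrival N i o].
  apply/seteqP; split => o /=.
    move=> [n _ Fn] i ir; have := Fn i (ltnW ir); rewrite (ltn_eqF ir).
    by apply: lt_trans; rewrite ltrDl mulr_gt0.
  move=> Ho.
  have : \forall n \near \oo, forall i, (i < r.+1)%N ->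
      (if i == r then 0 else w i) + 2 * delta n < interarrival N i o.
    have near1 i : (i < r.+1)%N -> \forall n \near \oo,
        (if i == r then 0 else w i) + 2 * delta n < interarrival N i o.
      move=> ir; move/cvgr_lt: (@cvg_shift_inv (if i == r then 0 else w i)); apply.
      case: eqP => [_|/eqP ir']; first exact: interarrival_gt0.
      by apply: Ho; rewrite ltn_neqAle ir'.
    elim: (r.+1) near1 => [_|k IH near1]; first by exists 0%N.
    have h1 : \forall n \near \oo, forall i, (i < k)%N ->
      (if i == r then 0 else w i) + 2 * delta n < interarrival N i o.
      by apply: IH => i ik; apply: near1; exact: ltnW.
    have h2 := near1 k (leqnn _).
    near=> n => i; rewrite ltnS leq_eqVlt => /predU1P[->|].
      by near: n.
    by move: i; near: n.
  move=> [n _ Hn]; exists n => //; exact: Hn (leqnn _).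
have bounds n := survival_grid r (dgt0 n) w0 (H n).
have mposR : measurable (posR : set R) by exact: measurable_itv.
have pos (theta : R) : posR theta -> 0 < theta by rewrite /posR /= in_itv/= andbT.
apply/eqP; rewrite eq_le; apply/andP; split.
  have cF : (P \o F) x @[x --> \oo] --> P (\bigcup_n F n).
    apply: nondecreasing_cvg_mu => //; first exact: bigcupT_measurable.
    move=> n m nm; apply/subsetPset => o /= Fn i ir.
    apply: le_lt_trans (Fn i ir); rewrite lerD2l ler_pM2l//.
    by rewrite lef_pV2 ?posrE// ler_nat.
  rewrite -FE; apply: (cvge_le _ cF).
  by apply: nearW => n; case: (bounds n).
set s := \sum_(i < r) w i.
pose g n theta : \bar R := (expR (- (theta * (s + 2 * r%:R * delta n))))%:E.
have mg n : measurable_fun (posR : set R) (g n).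
  apply: measurable_funTS; apply/measurable_EFinP; apply: measurableT_comp => //.
  by apply: measurable_funN; exact: measurable_funM.
have cg := cvg_monotone_convergence (mu := U) mposR mg.
have {}cg := cg (fun n x _ => (expR_ge0 _ : (0 <= (_)%:E)%E)).
apply: (@le_trans _ _ (\int[U]_(theta in posR) limn (g ^~ theta))%E).
  rewrite le_eqVlt; apply/orP; left; apply/eqP; apply: eq_integral => theta _.
  apply/esym/cvg_lim => //; apply: cvg_EFin; first exact: nearW.
  apply: continuous_cvg; first exact: continuous_expR.
  apply: cvgN; apply: cvgMl_tmp; rewrite -[X in _ --> X]addr0 -(mulr0 (2 * r%:R)).
  by apply: cvgD; [exact: cvg_cst|apply: cvgMl_tmp; exact: cvg_harmonic].
apply: (cvge_le _ (cg _)).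
  by apply: nearW => n; case: (bounds n).
move=> theta /pos t0 n m nm; rewrite lee_fin ler_expR lerN2 ler_pM2l// lerD2l.
by rewrite ler_wpM2l// lef_pV2 ?posrE// ler_nat.
Unshelve. all: by end_near. Qed.

End grid_limit.

(** * From exponential interarrival times to Poisson increments *)

Section exponential_law.
Context {R : realType} (theta : R) (theta_gt0 : 0 < theta).

Definition expo_law : probability (measurableTypeR R) R :=
  exponential_distribution_exponential_prob__canonical__probability_measure_Probability
    theta_gt0.

Lemma expo_lawE A : expo_law A = exponential_prob theta A. Proof. by []. Qed.

Lemma expo_law_lt0 : expo_law `]-oo, 0[%classic = 0%E.
Proof.
rewrite expo_lawE /exponential_prob integral0_eq// => x.
by rewrite /= in_itv/= => x0; rewrite lt0_exponential_pdf.
Qed.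

Lemma expo_law_set1 x : expo_law [set x] = 0%E.
Proof. by rewrite expo_lawE /exponential_prob integral_set1. Qed.

Lemma expo_law_Nyc x : expo_law `]-oo, x]%classic =
  (if 0 <= x then 1 - expR (- (theta * x)) else 0)%:E.
Proof.
have key y : y <= 0 -> expo_law `]-oo, y]%classic = 0%E.
  move=> y0; apply/eqP; rewrite -measure_le0.
  apply: (@le_trans _ _ (expo_law (`]-oo, 0[%classic `|` [set 0]))).
    apply: le_measure; rewrite ?inE//; first exact: measurableU.
    move=> z /=; rewrite !in_itv/= => zy; have := le_trans zy y0.
    by rewrite le_eqVlt => /predU1P[->|z0]; [right|left].
  rewrite measureU//.
    by rewrite [X in (X + _)%E]expo_law_lt0 [X in (_ + X)%E]expo_law_set1 add0e.
  by apply/seteqP; split=> // z /= [+ z0]; rewrite z0 in_itv/= ltxx.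
have [x0|x0] := leP 0 x; last exact: key (ltW x0).
move: x0; rewrite le_eqVlt => /predU1P[<-|x0].
  by rewrite key// mulr0 oppr0 expR0 subrr.
rewrite (_ : `]-oo, x]%classic = `]-oo, 0[%classic `|` `[0, x]%classic); last first.
  by rewrite -itv_bndbnd_setU// bnd_simp// ltW.
rewrite measureU//.
  rewrite [X in (X + _)%E]expo_law_lt0 add0e [LHS]expo_lawE exponential_prob_itv0c//.
  by rewrite mulNr.
by apply/seteqP; split=> // z /= []; rewrite !in_itv/= => /lt_geF ->.
Qed.

Lemma expo_law_oy x : expo_law `]x, +oo[%classic =
  (expR (- (theta * Num.max 0 x)))%:E.
Proof.
rewrite -setCitvl probability_setC// expo_law_Nyc.
case: leP => x0; last by rewrite mulr0 oppr0 expR0 sube0.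
by rewrite -EFinB subKr.
Qed.

Lemma expo_law_dom : expo_law `<< (@lebesgue_measure R).
Proof.
apply/null_content_dominatesP => A mA A0.
rewrite expo_lawE /exponential_prob; apply: null_set_integral => //.
by apply: measurable_funTS; apply/measurable_EFinP; exact: measurable_exponential_pdf.
Qed.

Lemma ge0_integral_expo_law (f : R -> \bar R) (E : set R) : measurable E ->
  measurable_fun setT f -> (forall x, 0 <= f x)%E ->
  (\int[expo_law]_(x in E) f x =
   \int[lebesgue_measure]_(x in E) (f x * (exponential_pdf theta x)%:E))%E.
Proof.
move=> mE mf f0.
have mfE := measurable_funTS mf : measurable_fun E f.
have mpdf : measurable_fun setT (EFin \o exponential_pdf theta).
  by apply/measurable_EFinP; exact: measurable_exponential_pdf.
rewrite -(Radon_Nikodym_SigmaFinite.change_of_variables expo_law_dom f0 mE mfE).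
have iRN := Radon_Nikodym_SigmaFinite.f_integrable expo_law_dom.
have mRN := measurable_int _ iRN.
apply: ae_eq_integral => //.
- by apply: emeasurable_funM => //; exact: measurable_funTS.
- by apply: emeasurable_funM => //; exact: measurable_funTS.
apply: ae_eqe_mul2l.
apply: (@ae_eq_subset _ _ _ _ _ setT) => //.
apply: integral_ae_eq => // A _ mA.
by rewrite -(Radon_Nikodym_SigmaFinite.f_integral expo_law_dom mA).
Qed.

(** On the positive half-line, the image of the law under translation by - t is the law scaled by
    exp (- theta t); it is enough to compare the two on the half-lines ]x, +oo[. *)
Lemma expo_law_memoryless (t : R) (f : R -> \bar R) : 0 <= t ->
  measurable_fun setT f -> (forall x, 0 <= f x)%E ->
  (\int[expo_law]_(s in `]t, +oo[%classic) f (s - t)%R =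
   (expR (- (theta * t)))%:E * \int[expo_law]_s f s)%E.
Proof.
move=> t0 mf f0.
have mt : measurable (`]t, +oo[%classic : set R) by exact: measurable_itv.
pose D0 : set (measurableTypeR R) := `]0, +oo[%classic.
have mD : measurable D0 by exact: measurable_itv.
pose phi (s : measurableTypeR R) : measurableTypeR R := s - t.
have mphi : measurable_fun setT phi by exact: measurable_funB.
pose sB : {mfun measurableTypeR R >-> measurableTypeR R} := mfun_Sub (mem_set mphi).
have phiD : phi @^-1` D0 = `]t, +oo[%classic.
  by rewrite /D0; apply/seteqP; split => x /=; rewrite !in_itv/= !andbT subr_gt0.
pose c : {nonneg R} := NngNum (expR_ge0 (- (theta * t))).
transitivity (\int[distribution expo_law sB]_(y in D0) f y)%E.
  by rewrite -phiD /distribution ge0_integral_pushforward//; exact: measurable_funTS.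
transitivity (\int[mscale c expo_law]_(y in D0) f y)%E; last first.
  rewrite ge0_integral_mscale//; last exact: measurable_funTS.
  congr (_ * _)%E.
  pose Dn : set (measurableTypeR R) := `]-oo, 0[%classic.
  pose Dz : set (measurableTypeR R) := [set 0].
  have mDn : measurable Dn by exact: measurable_itv.
  have mDz : measurable Dz by exact: measurable_set1.
  have TE : [set: measurableTypeR R] = Dn `|` (Dz `|` D0).
    apply/seteqP; split => // x _; rewrite /Dn /Dz /D0 /= !in_itv/= andbT.
    by case: (ltgtP (x : R) 0) => h; [left|right; right|right; left].
  have mfT (B : set (measurableTypeR R)) : measurable_fun B f by exact: measurable_funTS.
  rewrite [in RHS]TE ge0_integral_setU//; last 2 first.
  - exact: measurableU.
  - apply/disj_setPS => x []; rewrite /Dn /Dz /D0 /= !in_itv/= => x0 [x0'|].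
      by rewrite x0' ltxx in x0.
    by rewrite andbT => /lt_trans /(_ x0); rewrite ltxx.
  rewrite ge0_integral_setU//; last first.
    by apply/disj_setPS => x []; rewrite /Dz /D0 /= => ->; rewrite in_itv/= ltxx.
  rewrite (null_set_integral mDn (mfT _) expo_law_lt0) add0e.
  by rewrite (null_set_integral mDz (mfT _) (expo_law_set1 0)) add0e.
apply: eq_measure_integral => A mA AD.
pose m1 : {measure set (measurableTypeR R) -> \bar R} := mrestr (distribution expo_law sB) mD.
pose m2 : {measure set (measurableTypeR R) -> \bar R} := mrestr (mscale c expo_law) mD.
suff : m1 A = m2 A by rewrite /m1 /m2/= /mrestr setIidl.
pose G : set (set (measurableTypeR R)) := @RGenOInfty.G R.
pose g n : set (measurableTypeR R) := `]- n%:R, +oo[%classic.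
apply: (@measure_unique _ R (measurableTypeR R) G g) => //.
- exact: RGenOInfty.measurableE.
- move=> _ _ [x ->] [y ->]; exists (Num.max x y).
  apply/seteqP; split => z /=; rewrite !in_itv/= !andbT gt_max.
    by move=> [-> ->].
  by move=> /andP[].
- by move=> n; exists (- n%:R).
- apply/seteqP; split => // x _; exists (Num.truncn `|x|).+1 => //=.
  rewrite /g /= in_itv/= andbT ltrNl (le_lt_trans _ (truncnS_gt _))//.
  by rewrite -normrN ler_norm.
- move=> _ [x ->].
  change (expo_law (phi @^-1` (`]x, +oo[%classic `&` D0)) =
    ((expR (- (theta * t)))%:E * expo_law (`]x, +oo[%classic `&` D0))%E).
  have -> : phi @^-1` (`]x, +oo[%classic `&` D0) = `]t + Num.max 0 x, +oo[%classic.
    rewrite /D0; apply/seteqP; split => s /=; rewrite !in_itv/= !andbT.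
      by move=> [h1 h2]; rewrite -ltrBrDl gt_max h1 h2.
    by rewrite -ltrBrDl gt_max => /andP[].
  have -> : `]x, +oo[%classic `&` D0 = `]Num.max 0 x, +oo[%classic.
    rewrite /D0; apply/seteqP; split => s /=; rewrite !in_itv/= !andbT gt_max.
      by move=> [-> ->].
    by move=> /andP[].
  rewrite !expo_law_oy -EFinM -expRD; congr (expR _)%:E.
  have m0 : 0 <= Num.max 0 x by rewrite le_max lexx.
  rewrite (@max_r _ _ 0 (t + Num.max 0 x)) ?addr_ge0//.
  rewrite (@max_r _ _ 0 (Num.max 0 x))//.
  ring.
- move=> n; rewrite /m1/= /mrestr/= (le_lt_trans (probability_le1 _ _)) ?ltry//.
  have mg : measurable (g n) by exact: measurable_itv.
  by have := mphi measurableT _ (measurableI _ _ mg mD); rewrite setTI.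
Qed.

Definition poisson_weight (x : R) (k : nat) : R := expR (- x) * x ^+ k / (k`!)%:R.

Lemma poisson_weight_ge0 x k : 0 <= x -> 0 <= poisson_weight x k.
Proof. by move=> x0; rewrite /poisson_weight !mulr_ge0 ?expR_ge0 ?invr_ge0// exprn_ge0. Qed.

Lemma measurable_poisson_weight k : measurable_fun setT (poisson_weight ^~ k).
Proof.
apply: measurable_funM => //; apply: measurable_funM; last exact: measurable_funX.
by apply: measurableT_comp => //; exact: measurable_funN.
Qed.

(** This is the decomposition according to the first arrival time s. The exponentials combine into
    one not depending on s, which leaves a multiple of (t - s)^k with an explicit antiderivative. *)
Lemma integral_expo_law_poisson_weight (t : R) k : 0 <= t ->
  (\int[expo_law]_(s in `]0%R, t]%classic) (poisson_weight (theta * (t - s)) k)%:E =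
   (poisson_weight (theta * t) k.+1)%:E)%E.
Proof.
rewrite le_eqVlt => /predU1P[<-|t0].
  rewrite set_itvoc0 integral_set0 mulr0.
  by rewrite /poisson_weight expr0n/= mulr0 mul0r.
have mw : measurable_fun setT (fun s : R => poisson_weight (theta * (t - s)) k).
  apply: (measurableT_comp (measurable_poisson_weight k)).
  by apply: measurable_funM => //; exact: measurable_funB.
pose c := expR (- (theta * t)) * theta ^+ k.+1 / (k`!)%:R.
pose c' := expR (- (theta * t)) * theta ^+ k.+1 / (k.+1`!)%:R.
have wE s : 0 <= s -> poisson_weight (theta * (t - s)) k * exponential_pdf theta s =
    c * (t - s) ^+ k.
  move=> s0; rewrite exponential_pdfE// /poisson_weight /c exprMn.
  rewrite mulNr (_ : - (theta * t) = - (theta * (t - s)) + - (theta * s)); last by ring.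
  by rewrite expRD exprS; ring.
(* Cut off outside ]0, t], since for s > t and odd k the weight is negative and the change to the
   density asks for a nonnegative function on the whole line. *)
pose ft (s : R) : \bar R :=
  (\1_(`]0, t]%classic : set R) s * poisson_weight (theta * (t - s)) k)%:E.
have ftE s : `]0, t]%classic s -> ft s = (poisson_weight (theta * (t - s)) k)%:E.
  by move=> st; rewrite /ft indicE mem_set// mul1r.
transitivity (\int[expo_law]_(s in `]0%R, t]%classic) ft s)%E.
  by apply: eq_integral => s; rewrite inE => /ftE ->.
rewrite ge0_integral_expo_law//; last 2 first.
- by apply/measurable_EFinP; apply: measurable_funM => //; exact: measurable_indic.
- move=> s; rewrite /ft lee_fin indicE; have [|_] := boolP (s \in _); last by rewrite mul0r.
  rewrite inE/= in_itv/= => /andP[s0 st]; rewrite mul1r poisson_weight_ge0//.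
  by rewrite mulr_ge0 ?subr_ge0// ltW.
transitivity (\int[lebesgue_measure]_(s in `]0%R, t]%classic) (c * (t - s) ^+ k)%:E)%E.
  apply: eq_integral => s; rewrite inE => st; rewrite ftE//.
  by move: st; rewrite /= in_itv/= => /andP[s0 _]; rewrite -EFinM wE// ltW.
pose F (s : R) := - c' * (t - s) ^+ k.+1.
have dF (s : R) : is_derive s 1 F (c * (t - s) ^+ k).
  have dts : is_derive s 1 (fun s : R => t - s) (- 1).
    by apply: is_derive_eq; rewrite add0r mul1r.
  have dX := is_deriveZ (- c') (is_deriveX k.+1 dts).
  have -> : F = - c' \*: (fun s : R => t - s) ^+ k.+1.
    by apply/funext => x; rewrite /F exprfctE.
  apply: is_derive_eq; rewrite /c /c' factS natrM /GRing.scale/=.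
  have : (k.+1%:R : R) != 0 by rewrite pnatr_eq0.
  have : ((k`!)%:R : R) != 0 by rewrite pnatr_eq0 -lt0n fact_gt0.
  move: (k`!)%:R (k.+1%:R) => b a b0 a0.
  by field; rewrite a0 b0.
have cF (s : R) : {for s, continuous F}.
  by apply: differentiable_continuous; apply/derivable1_diffP; exact: ex_derive.
have cf : continuous (fun s : R => c * (t - s) ^+ k).
  move=> s; apply: cvgMl_tmp.
  apply: (@continuous_comp _ _ _ (fun s : R => t - s) (fun x => x ^+ k)).
    by apply: cvgB => //; exact: cvg_cst.
  exact: exprn_continuous.
rewrite integral_itv_obnd_cbnd//; last first.
  by apply: measurable_funTS; apply/measurable_EFinP; exact: continuous_measurable_fun.
rewrite (@continuous_FTC2 _ _ F)//.
- rewrite /F subrr subr0 expr0n/= mulr0 -EFinB sub0r mulNr opprK.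
  by rewrite /c' /poisson_weight exprMn; congr _%:E; ring.
- exact: continuous_subspaceT.
- split; first by move=> s _; exact: ex_derive.
    by apply: cvg_at_right_filter; exact: cF.
  by apply: cvg_at_left_filter; exact: cF.
- by move=> s _; rewrite derive1E derive_val.
Qed.

End exponential_law.

(** * Laws on the space of real sequences *)

Section sequence_space.
Context {R : realType}.

Definition coord_gen : set (set (nat -> R)) :=
  [set A | exists i r, A = [set x : nat -> R | x i <= r]].

Definition seq_space := g_sigma_algebraType coord_gen.

HB.instance Definition _ := Measurable.on seq_space.

Lemma measurable_coord i : measurable_fun setT (fun x : seq_space => x i).
Proof.
apply: (measurability _ (RGenOInfty.measurableE R)) => //.
move=> _ [_ [r ->] <-]; rewrite setTI.
rewrite (_ : _ @^-1` _ = ~` [set x | x i <= r]).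
  by apply: measurableC; apply: sub_sigma_algebra; exists i, r.
by apply/seteqP; split => x /=; rewrite in_itv/= andbT ltNge => /negP.
Qed.

Lemma measurable_to_seq d (T : measurableType d) (f : T -> seq_space) :
  (forall i, measurable_fun setT (fun t => f t i)) -> measurable_fun setT f.
Proof.
move=> mf; apply: (measurability (coord_gen : set (set seq_space))) => //.
move=> _ [_ [i [r ->]] <-].
have := mf i measurableT `]-oo, r]%classic (measurable_itv _).
by congr (measurable _); apply/seteqP; split => t [_] /=; rewrite in_itv.
Qed.

Definition lower_rect r (q : nat -> R) : set seq_space :=
  [set x | forall i, (i < r)%N -> x i <= q i].

Lemma measurable_lower_rect r q : measurable (lower_rect r q).
Proof.
rewrite (_ : lower_rect _ _ = \bigcap_(i in [set i | (i < r)%N]) [set x | x i <= q i])//.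
apply: fin_bigcap_measurable; first exact: finite_II.
by move=> i _; apply: sub_sigma_algebra; exists i, (q i).
Qed.

(** Lower rectangles are stable under intersection. They bound all coordinates before r, so {x_i <=
    r} is recovered by sending the other bounds to infinity while rational bounds tend to r from
    above. Rational bounds keep the number of events countable. *)
Lemma seq_space_measure_unique (m1 m2 : probability seq_space R) :
  (forall r (q : nat -> rat), m1 (lower_rect r (ratr \o q)) =
     m2 (lower_rect r (ratr \o q))) ->
  forall A, measurable A -> m1 A = m2 A.
Proof.
move=> m12.
pose G : set (set seq_space) :=
  [set A | exists r (q : nat -> rat), A = lower_rect r (ratr \o q)].
have GT : G setT by exists 0%N, (fun=> 0%Q); apply/seteqP; split.
apply: (@measure_unique _ R seq_space G (fun=> setT)) => //.
- rewrite eqEsubset; split.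
    apply: smallest_sub; first exact: smallest_sigma_algebra.
    move=> _ [i [r ->]].
    pose GT' := g_sigma_algebraType G.
    have qP n : exists q : rat, r < ratr q < r + n.+1%:R^-1.
      have [|q] := @rat_in_itvoo R r (r + n.+1%:R^-1); first by rewrite ltrDl.
      by rewrite in_itv/= => h; exists q.
    have [q qE] := choice qP.
    rewrite (_ : [set x | _] = \bigcap_n \bigcup_m
        lower_rect i.+1 (ratr \o (fun j => if j == i then q n else m%:R))).
      apply: (@bigcapT_measurable _ GT') => n; apply: (@bigcupT_measurable _ GT') => m.
      by apply: sub_sigma_algebra; exists i.+1; eexists; reflexivity.
    apply/seteqP; split => [x xi n _|x H] /=.
      exists (\max_(j < i.+1) (Num.truncn `|x j|).+1)%N => // j ji /=.
      case: eqP => [->|_]; first by apply: (le_trans xi); case/andP: (qE n) => /ltW.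
      rewrite ratr_nat (le_trans (ler_norm _))// (le_trans (ltW (truncnS_gt _)))//.
      rewrite ler_nat.
      exact: (@leq_bigmax _ (fun j : 'I_i.+1 => (Num.truncn `|x j|).+1) (Ordinal ji)).
    apply/ler_addgt0Pr => e e0.
    have [n ne] : exists n, n.+1%:R^-1 < e.
      exists (Num.truncn e^-1); rewrite invf_plt ?posrE//; exact: truncnS_gt.
    have [m _ /(_ i (leqnn _))] := H n I; rewrite /= eqxx => xi.
    apply: (le_trans xi); case/andP: (qE n) => _ /ltW h; apply: (le_trans h).
    by rewrite lerD2l ltW.
  apply: smallest_sub; first exact: sigma_algebra_measurable.
  by move=> _ [r [q ->]]; exact: measurable_lower_rect.
- move=> _ _ [r [q ->]] [r' [q' ->]]; exists (maxn r r').
  exists (fun i => if (i < r)%N then if (i < r')%N then Num.min (q i) (q' i) else q i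
    else q' i).
  have minE (a b : rat) : ratr (Num.min a b) = Num.min (ratr a) (ratr b) :> R.
    by case: (leP a b) => ab; [rewrite min_l|rewrite min_r]; rewrite ?ler_rat// ltW.
  apply/seteqP; split => x /=.
    move=> [H H'] i; rewrite leq_max => irr /=.
    case: ifPn => ir; last by apply: H'; rewrite (negbTE ir) in irr.
    by case: ifPn => ir'; [rewrite minE le_min H//= H'|exact: H].
  move=> H; split=> i ir; have := H i; rewrite leq_max ir ?orbT /= => /(_ isT).
    by rewrite ir; case: ifPn => // _; rewrite minE le_min => /andP[].
  by rewrite ir; case: ifPn => // _; rewrite minE le_min => /andP[].
- by rewrite bigcup_const//; exists 0%N.
- by move=> _ [r [q ->]]; exact: m12.
- by move=> _; rewrite (le_lt_trans (probability_le1 m1 measurableT)) ?ltry.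
Qed.

Definition seq_cons (p : measurableTypeR R * seq_space) : seq_space :=
  fun i => if i is j.+1 then p.2 j else p.1.

Lemma measurable_seq_cons : measurable_fun setT seq_cons.
Proof.
apply: measurable_to_seq => -[|i]; first exact: measurable_fst.
exact: measurableT_comp (measurable_coord i) (@measurable_snd _ _ _ _).
Qed.

Definition seq_cons_mfun : {mfun (measurableTypeR R * seq_space)%type >-> seq_space} :=
  mfun_Sub (mem_set measurable_seq_cons).

Section iid.
Variables (mu : probability (measurableTypeR R) R) (pi : probability seq_space R).

Lemma measurable_slice_fun (A : set seq_space) : measurable A ->
  measurable_fun setT (fun s => pi [set y | A (seq_cons (s, y))]).
Proof.
move=> mA.
have mA' : measurable (seq_cons @^-1` A).
  by rewrite -[X in measurable X]setTI; exact: measurable_seq_cons.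
have := measurable_fun_xsection pi mA'.
congr (measurable_fun _ _); apply/funext => s /=; congr (pi _).
by apply/seteqP; split => y; rewrite /xsection /= inE.
Qed.

(** The law of an i.i.d. sequence is unchanged when an independent entry of law [mu] is put in
    front; on rectangles this is the product formula. *)
Lemma iid_first_step :
  (forall r (q : nat -> rat), pi (lower_rect r (ratr \o q)) =
     (\prod_(i < r) mu `]-oo, ratr (q i)]%classic)%E) ->
  forall A, measurable A -> pi A = (\int[mu]_s pi [set y | A (seq_cons (s, y))])%E.
Proof.
move=> H A mA.
have -> : (\int[mu]_s pi [set y | A (seq_cons (s, y))])%E =
    distribution (mu \x pi)%E seq_cons_mfun A.
  rewrite /distribution /pushforward /product_measure1; apply: eq_integral => s _ /=.
  by congr (pi _); apply/seteqP; split => y; rewrite /xsection /= inE.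
apply: seq_space_measure_unique mA => -[|r] q.
  have -> : lower_rect 0 (ratr \o q) = setT by apply/seteqP; split.
  by rewrite !probability_setT.
have E : seq_cons @^-1` lower_rect r.+1 (ratr \o q) =
    `]-oo, ratr (q 0%N)]%classic `*` lower_rect r (ratr \o (q \o S)).
  apply/seteqP; split => -[s y] /=; rewrite in_itv/=.
    move=> h; split; first exact: (h 0%N).
    by move=> i ir; exact: (h i.+1).
  by move=> [h0 h] [|i] ir //=; exact: h.
transitivity ((mu \x pi)%E (seq_cons @^-1` lower_rect r.+1 (ratr \o q))); last by [].
rewrite E product_measure1E//; last exact: measurable_lower_rect.
rewrite H big_ord_recl; congr (_ * _)%E; exact: esym (H r (q \o succn)).
Qed.

Hypothesis first_step :
  forall A, measurable A -> pi A = (\int[mu]_s pi [set y | A (seq_cons (s, y))])%E.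

Lemma iid_rect r (B : nat -> set R) : (forall i, measurable (B i)) ->
  pi [set x | forall i, (i < r)%N -> B i (x i)] = (\prod_(i < r) mu (B i))%E.
Proof.
move=> mB; elim: r B mB => [|r IH] B mB.
  rewrite big_ord0 (_ : [set x | _] = setT) ?probability_setT//.
  by apply/seteqP; split.
rewrite first_step; last first.
  rewrite (_ : [set x | _] = \bigcap_(i in [set i | (i < r.+1)%N]) [set x | B i (x i)])//.
  apply: fin_bigcap_measurable; first exact: finite_II.
  move=> i _; rewrite -[X in measurable X]setTI.
  exact: (measurable_coord i measurableT (mB i)).
transitivity (\int[mu]_s ((\1_(B 0%N) s)%:E * \prod_(i < r) mu (B i.+1))%E)%E.
  apply: eq_integral => s _; rewrite indicE.
  have [|] := boolP (s \in B 0%N).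
    rewrite inE mul1e => B0; rewrite -(IH (fun i => B i.+1))//; congr (pi _).
    apply/seteqP; split => y /= h; first by move=> i ir; exact: (h i.+1).
    by move=> [|i] ir //=; exact: h.
  rewrite notin_setE mul0e => nB0.
  rewrite (_ : [set y | _] = set0) ?measure0//.
  by apply/seteqP; split => // y /= h; apply: nB0; exact: (h 0%N).
rewrite ge0_integralZr//; last 2 first.
- by apply/measurable_EFinP; apply: measurable_indic; exact: mB.
- by apply: prode_ge0 => i _; exact: measure_ge0.
by rewrite integral_indic ?setIT ?big_ord_recl//; exact: mB.
Qed.

End iid.
End sequence_space.

Arguments seq_space : clear implicits.

(** * Poisson counts by first-step analysis *)

Section iid_exponential.
Context {R : realType} (theta : R) (theta_gt0 : 0 < theta).
Variable pi : probability (seq_space R) R.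
Hypothesis first_step : forall A, measurable A ->
  pi A = (\int[expo_law theta_gt0]_s pi [set y | A (seq_cons (s, y))])%E.
Hypothesis pi_pos : pi [set x | forall i, 0 < x i] = 1%E.

Definition psum n (x : nat -> R) : R := \sum_(i < n) x i.

Lemma psum_cons n (s : R) (y : seq_space R) : psum n.+1 (seq_cons (s, y)) = s + psum n y.
Proof. by rewrite /psum big_ord_recl. Qed.

Lemma psum_ge0 n y : (forall i, 0 < y i) -> 0 <= psum n y.
Proof. by move=> y0; apply: sumr_ge0 => i _; exact: ltW. Qed.

(* In the counting process with interarrival times x, started at time c with n
   arrivals, successive time intervals of lengths t contain k arrivals. *)
Fixpoint fits (c : R) (n : nat) (l : seq (R * nat)) (x : nat -> R) : Prop :=
  if l is (t, k) :: l' then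
    psum (n + k) x <= c + t < psum (n + k).+1 x /\ fits (c + t) (n + k) l' x
  else True.

(** Once the first arrival has been counted, its time only shifts the clock. *)
Lemma fits_cons c n l (s : R) (y : seq_space R) :
  fits c n.+1 l (seq_cons (s, y)) <-> fits (c - s) n l y.
Proof.
elim: l c n => [|[t k] l IH] c n //=.
rewrite addSn !psum_cons IH addrAC.
by rewrite -lerBrDl -ltrBlDl (_ : c + t - s = c - s + t)//; ring.
Qed.

(** The first entry occurs in every partial sum except the empty one, and the comparison with the
    empty sum holds on both sides because all times are nonnegative. *)
Lemma fits_shift c u n l (s : R) (y : seq_space R) :
  0 <= c -> 0 <= u -> all (fun p => 0 <= p.1) l ->
  fits (c + u) n l (seq_cons (s, y)) <-> fits c n l (seq_cons (s - u, y)).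
Proof.
move=> c0 u0; elim: l c n c0 => [|[t k] l IH] c n c0 //= /andP[t0 l0].
rewrite (_ : c + u + t = c + t + u); last by ring.
rewrite (IH (c + t))//; last exact: addr_ge0.
rewrite psum_cons [psum (n + k).+1 _]psum_cons.
case: (n + k)%N => [|j].
  rewrite /psum !big_ord0 !addr0 !addr_ge0//=.
  by rewrite ltrBrDr.
rewrite !psum_cons (_ : s - u + psum j y = s + psum j y - u); last by ring.
rewrite (_ : s - u + psum j.+1 y = s + psum j.+1 y - u); last by ring.
by rewrite lerBlDr ltrBrDr.
Qed.

Lemma measurable_psum n : measurable_fun setT (psum n   : seq_space R -> R).
Proof. by apply: measurable_sum => i; exact: measurable_coord. Qed.

(** Positivity is carried along because it confines the first entry to ]0, t] when an arrival is due
    before t. *)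
Definition posfits l : set (seq_space R) := [set x | fits 0 0 l x /\ forall i, 0 < x i].

Lemma measurable_pos_seq : measurable ([set x | forall i, 0 < x i] : set (seq_space R)).
Proof.
rewrite (_ : [set x | _] = \bigcap_i ((fun x : seq_space R => x i) @^-1` `]0, +oo[%classic)).
  apply: bigcapT_measurable => i; rewrite -[X in measurable X]setTI.
  by apply: measurable_coord => //; exact: measurable_itv.
apply/seteqP; split => x /= H i; first by move=> _; rewrite /= in_itv/= andbT.
by have := H i I; rewrite /= in_itv/= andbT.
Qed.

Lemma measurable_posfits l : measurable (posfits l).
Proof.
suff mf c n : measurable ([set x | fits c n l x] : set (seq_space R)).
  exact: measurableI (mf 0 0%N) measurable_pos_seq.
elim: l c n => [|[t k] l IH] c n.
  by have -> : [set x | fits c n [::] x] = setT by apply/seteqP; split.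
have -> : [set x | fits c n ((t, k) :: l) x] = (psum (n + k) @^-1` `]-oo, c + t]%classic `&`
  psum (n + k).+1 @^-1` `]c + t, +oo[%classic) `&` [set x | fits (c + t) (n + k) l x].
  apply/seteqP; split => x /=; rewrite !in_itv/= andbT.
    by move=> [/andP[-> ->] ?].
  by move=> [[-> ->] ?].
apply: measurableI => //.
have mp k' := @measurable_psum k' measurableT.
have m1 := mp (n + k)%N _ (measurable_itv `]-oo, c + t]).
have m2 := mp (n + k).+1 _ (measurable_itv `]c + t, +oo[).
by move: m1 m2; rewrite !setTI; exact: measurableI.
Qed.

Lemma pos_seq_cons (s : R) (y : seq_space R) : (forall i, 0 < seq_cons (s, y) i) <->
  0 < s /\ forall i, 0 < y i.
Proof.
split; first by move=> h; split; [exact: (h 0%N)|move=> i; exact: (h i.+1)].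
move=> [s0 y0] [|i] //=; exact: y0.
Qed.

Lemma posfits_cons0 t l s : 0 <= t -> all (fun p => 0 <= p.1) l ->
  [set y | posfits ((t, 0%N) :: l) (seq_cons (s, y))] =
  if t < s then [set y | posfits l (seq_cons (s - t, y))] else set0.
Proof.
move=> t0 l0.
have E y : posfits ((t, 0%N) :: l) (seq_cons (s, y)) <->
    (t < s /\ (posfits l (seq_cons (s - t, y)))).
  rewrite /posfits /= addn0 psum_cons [psum 0 _]big_ord0 [psum 0 _]big_ord0 addr0 add0r t0/=.
  have := @fits_shift 0 t 0%N l s y (lexx 0) t0 l0; rewrite add0r => ->.
  rewrite !pos_seq_cons subr_gt0.
  split; first by move=> [[ts H] [s0 y0]].
  by move=> [ts [H [_ y0]]]; do !split => //; exact: le_lt_trans ts.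
case: ifPn => ts; apply/seteqP; split => y //=; rewrite E; first by case.
  by move=> H; split.
by move=> [ts']; rewrite ts' in ts.
Qed.

Lemma posfits_consS t k l s : 0 <= t ->
  [set y | posfits ((t, k.+1) :: l) (seq_cons (s, y))] =
  if 0 < s <= t then posfits ((t - s, k) :: l) else set0.
Proof.
move=> t0.
have E y : posfits ((t, k.+1) :: l) (seq_cons (s, y)) <->
    (0 < s <= t /\ posfits ((t - s, k) :: l) y).
  rewrite /posfits /= !add0n !psum_cons fits_cons !add0r pos_seq_cons.
  rewrite -lerBrDl -ltrBlDl; split.
    move=> [[/andP[h1 h2] H] [s0 y0]]; rewrite s0 h1 h2 /=; do !split => //.
    by rewrite -subr_ge0 (le_trans (psum_ge0 k y0)).
  by move=> [/andP[s0 st] [[/andP[-> ->] H] y0]].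
case: ifPn => st; apply/seteqP; split => y //=; rewrite E; first by case.
  by move=> H; split.
by move=> [st']; rewrite st' in st.
Qed.

(** Induction on the list, then on the count k of the first interval. For k = 0 memorylessness
    restarts the process at the end of the interval; otherwise the first arrival at s leaves k - 1
    arrivals for a length t - s, and the integral over s raises the Poisson weight by one. *)
Lemma prob_posfits l : all (fun p => 0 <= p.1) l ->
  pi (posfits l) = (\prod_(p <- l) poisson_weight (theta * p.1) p.2)%:E.
Proof.
elim: l => [|[t k] l IH] /=.
  by rewrite big_nil -pi_pos => _; congr (pi _); apply/seteqP; split => x; [case|].
move=> /andP[t0 l0]; rewrite big_cons /=.
have {}IH := IH l0; set c := \prod_(p <- l) _ in IH *.
have c0 : 0 <= c.
  by rewrite -lee_fin -IH; exact: measure_ge0.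
elim: k t t0 => [|k IHk] t t0.
  rewrite first_step; last exact: measurable_posfits.
  pose f s := pi [set y | posfits l (seq_cons (s, y))].
  have mf : measurable_fun setT f by apply: measurable_slice_fun; exact: measurable_posfits.
  transitivity (\int[expo_law theta_gt0]_(s in `]t, +oo[%classic) f (s - t)%R)%E.
    rewrite [RHS]integral_mkcond; apply: eq_integral => s _.
    rewrite posfits_cons0// patchE mem_setE/= in_itv/= andbT.
    by case: ifPn => // _; rewrite measure0.
  rewrite expo_law_memoryless// -first_step; last exact: measurable_posfits.
  rewrite IH -EFinM; congr _%:E.
  by rewrite /poisson_weight expr0 fact0 !divr1 mulr1.
rewrite first_step; last exact: measurable_posfits.
transitivity (\int[expo_law theta_gt0]_(s in `]0%R, t]%classic)
    ((poisson_weight (theta * (t - s)) k)%:E * c%:E))%E.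
  rewrite [RHS]integral_mkcond; apply: eq_integral => s _.
  rewrite posfits_consS// patchE mem_setE/= in_itv/=.
  case: ifPn => [/andP[_ st]|_]; last by rewrite measure0.
  by rewrite IHk ?subr_ge0// EFinM.
rewrite ge0_integralZr//.
- by rewrite integral_expo_law_poisson_weight// EFinM.
- apply: measurable_funTS; apply/measurable_EFinP.
  apply: (measurableT_comp (measurable_poisson_weight k)).
  by apply: measurable_funM => //; exact: measurable_funB.
- move=> s /=; rewrite in_itv/= => /andP[_ st].
  by rewrite lee_fin poisson_weight_ge0// mulr_ge0 ?subr_ge0// ltW.
Qed.

End iid_exponential.

Lemma big_ord_mem_uniq (T : Type) (idx : T) (op : Monoid.com_law idx) r (s : seq nat)
    (f : nat -> T) : uniq s -> (forall i, i \in s -> (i < r)%N) ->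
  \big[op/idx]_(i < r) (if (i : nat) \in s then f i else idx) = \big[op/idx]_(i <- s) f i.
Proof.
move=> us sr; rewrite -(big_mkord xpredT (fun i => if i \in s then f i else idx)).
rewrite -big_mkcond -big_filter; apply: perm_big; apply: uniq_perm => //.
  by rewrite filter_uniq// iota_uniq.
move=> i; rewrite mem_filter mem_index_iota andbC /=.
by apply/andP/idP => [[]//|si]; split => //; exact: sr.
Qed.

Section interarrival_law.
Context {R : realType} {d : measure_display} {Omega : measurableType d}.
Variable N : R -> Omega -> \bar R.
Hypothesis cN : counting_process N.
Variable Q : probability Omega R.

Definition interarrival_seq (w : Omega) : seq_space R := fun n => interarrival N n w.

Lemma measurable_interarrival_seq : measurable_fun setT interarrival_seq.
Proof. by apply: measurable_to_seq => i; exact: measurable_interarrival. Qed.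

Definition interarrival_mfun : {mfun Omega >-> seq_space R} :=
  mfun_Sub (mem_set measurable_interarrival_seq).

Let pi : probability (seq_space R) R := distribution Q interarrival_mfun.

(** Stated for rational rectangles so that it can hold simultaneously for almost every member of a
    disintegration. *)
Definition iid_exp (theta : R) := 0 < theta /\ forall r (q : nat -> rat),
  Q [set w | forall i, (i < r)%N -> interarrival N i w <= ratr (q i)] =
  (\prod_(i < r) exponential_prob theta `]-oo, ratr (q i)]%classic)%E.

Definition increments_event m (t : nat -> R) (kappa : nat -> nat) : set Omega :=
  [set w | forall j, (j < m)%N -> (N (t j.+1) w - N (t j) w)%E = ((kappa j)%:R)%:E].

Lemma time_grid_ge0 m t j : @time_grid R m t -> (j <= m)%N -> 0 <= t j.
Proof.
move=> [t0 tS]; elim: j => [//|j IH] jm.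
by rewrite (le_trans (IH (ltnW jm)))// ltW// tS.
Qed.

Lemma measurable_increments_event m t kappa : time_grid m t ->
  measurable (increments_event m t kappa).
Proof.
move=> tm; rewrite (_ : increments_event _ _ _ = \bigcap_(j in [set j | (j < m)%N])
    [set w | (N (t j.+1) w - N (t j) w)%E = ((kappa j)%:R)%:E])//.
apply: fin_bigcap_measurable; first exact: finite_II.
move=> j /= jm; rewrite -[X in measurable X]setTI.
have mf := measurable_increment cN (time_grid_ge0 tm (ltnW jm)) (time_grid_ge0 tm jm).
exact: (mf measurableT _ (emeasurable_set1 ((kappa j)%:R)%:E)).
Qed.

Lemma poisson_weight_sum x : 0 <= x -> (\sum_(k <oo) (@poisson_weight R x k)%:E = 1)%E.
Proof.
rewrite le_eqVlt => /predU1P[<-|x0].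
  (* The mean 0 arises for grids starting at time 0; [poisson_prob] follows the exponential formula
     for positive rates only, so the sum is computed by hand. *)
  rewrite (@nneseries_split R _ 0 1); last by move=> k _; rewrite lee_fin poisson_weight_ge0.
  rewrite add0n big_nat1.
  rewrite (_ : poisson_weight 0 0 = 1); last first.
    by rewrite /poisson_weight oppr0 expR0 expr0 fact0 divr1 mulr1.
  rewrite eseries0 ?adde0// => k k0 _.
  by rewrite /poisson_weight expr0n gtn_eqF// mulr0 mul0r.
have : (poisson_prob x 0 [set: nat] = 1)%E by exact: (probability_setT (poisson_prob x 0)).
rewrite /poisson_prob x0 -nneseries_esumT; last by move=> k; rewrite lee_fin poisson_pmf_ge0.
move=> <-; apply: eq_eseriesr => k _.
by rewrite /poisson_weight /poisson_pmf x0; congr _%:E; ring.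
Qed.

Lemma fits_increments (t : nat -> R) (kappa : nat -> nat) m i n w :
  (forall j, (i <= j <= i + m)%N -> 0 <= t j) -> N (t i) w = (n%:R)%:E ->
  fits (t i) n [seq (t j.+1 - t j, kappa j) | j <- iota i m] (interarrival_seq w) <->
  forall j, (i <= j < i + m)%N -> (N (t j.+1) w - N (t j) w)%E = ((kappa j)%:R)%:E.
Proof.
have psumE k : psum k (interarrival_seq w) = atime N k w by rewrite (atimeE cN).
elim: m i n => [|m IH] i n t0 Ni /=.
  by split=> // _ j; rewrite addn0 => /andP[ij ji]; have := leq_ltn_trans ij ji; rewrite ltnn.
rewrite !psumE addrC subrK.
have t1 : 0 <= t i.+1 by apply: t0; rewrite leqnSn -addn1 leq_add2l.
rewrite -(N_eq cN _ _ t1); split.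
  move=> [Ni1 F] j; rewrite leq_eqVlt => /andP[/predU1P[<- _|ij jm]].
    by rewrite Ni1 Ni natrD EFinD addeAC subee// add0e.
  apply: (IH i.+1 (n + kappa i)%N _ Ni1).1 => //; last by rewrite ij addSnnS.
  by move=> k /andP[ik km]; apply: t0; rewrite ltnW// -addSnnS.
move=> H; have Ni1 : N (t i.+1) w = ((n + kappa i)%:R)%:E.
  have := H i; rewrite leqnn -addSnnS leq_addr => /(_ isT).
  rewrite Ni; case: (N (t i.+1) w) => [r||]//= [] rE; congr _%:E.
  by rewrite natrD -rE; ring.
split => //; apply/(IH i.+1 (n + kappa i)%N _ Ni1).
  by move=> k /andP[ik km]; apply: t0; rewrite ltnW// -addSnnS.
by move=> j /andP[ij jm]; apply: H; rewrite ltnW// -addSnnS.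
Qed.

Section iid_exp_consequences.
Variable theta : R.
Hypothesis iid : iid_exp theta.

Let theta_gt0 : 0 < theta. Proof. by case: iid. Qed.

Let first_step A : measurable A ->
  pi A = (\int[expo_law theta_gt0]_s pi [set y | A (seq_cons (s, y))])%E.
Proof. by apply: iid_first_step => r q; exact: (iid.2 r q). Qed.

Lemma iid_exp_rect r (B : nat -> set R) : (forall i, measurable (B i)) ->
  Q [set w | forall i, (i < r)%N -> B i (interarrival N i w)] =
  (\prod_(i < r) exponential_prob theta (B i))%E.
Proof. by move=> mB; rewrite -(iid_rect first_step r mB). Qed.

Lemma iid_exp_marginal n (B : set R) : measurable B ->
  Q (interarrival N n @^-1` B) = exponential_prob theta B.
Proof.
move=> mB; pose C i := if i == n then B else setT.
have mC i : measurable (C i) by rewrite /C; case: ifP.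
have Cn : C n = B by rewrite /C eqxx.
have := iid_exp_rect n.+1 mC; rewrite big_ord_recr/= Cn big1 ?mul1e => [<-|i _].
  congr (Q _); apply/seteqP; split => w /= H.
    by move=> i _; rewrite /C; case: eqP => [->|].
  by have := H n (leqnn _); rewrite /C eqxx.
rewrite /C (ltn_eqF (ltn_ord i)).
exact: (probability_setT (expo_law theta_gt0)).
Qed.

Lemma iid_exp_indep : indep Q (fun n w => (interarrival N n w)%:E).
Proof.
move=> s x us; pose B i := if i \in s then `]-oo, x i]%classic else setT.
have mB i : measurable (B i) by rewrite /B; case: ifP.
pose r := (\max_(i <- s) i).+1.
have sr i : i \in s -> (i < r)%N by move=> si; rewrite ltnS (@leq_bigmax_seq _ s xpredT id i).
transitivity (\prod_(i < r) exponential_prob theta (B i))%E.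
  rewrite -iid_exp_rect//; congr (Q _); apply/seteqP; split => w /= H i.
    by move=> ir; rewrite /B; case: ifPn => // /H; rewrite lee_fin /= in_itv.
  by move=> si; have := H i (sr _ si); rewrite /B si /= in_itv/= lee_fin.
rewrite -(@big_ord_mem_uniq _ _ _ r)//; apply: eq_bigr => i _; rewrite /B.
case: ifP => _; last exact: (probability_setT (expo_law theta_gt0)).
by rewrite -(iid_exp_marginal i).
Qed.

(** A grid need not start at 0, whereas [fits] does: the stretch before [t 0] is treated as a first
    interval with k arrivals, and k is summed out afterwards. *)
Lemma iid_exp_prob_start m t kappa k : time_grid m t ->
  Q ([set w | N (t 0%N) w = (k%:R)%:E] `&` increments_event m t kappa) =
  (poisson_weight (theta * t 0%N) k *
   \prod_(j < m) poisson_weight (theta * (t j.+1 - t j)) (kappa j))%:E.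
Proof.
move=> tm; have t0 : 0 <= t 0%N by case: tm.
have pos1 : pi [set x | forall i, 0 < x i] = 1%E.
  rewrite /pi /distribution/= /pushforward -(probability_setT Q); congr (Q _).
  by apply/seteqP; split => // w _ i; exact: interarrival_gt0.
pose l := (t 0%N, k) :: [seq (t j.+1 - t j, kappa j) | j <- iota 0 m].
have l0 : all (fun p => 0 <= p.1) l.
  rewrite /= t0 all_map; apply/allP => j; rewrite mem_iota add0n => /andP[_ jm] /=.
  by rewrite subr_ge0 ltW//; case: tm => _; exact.
have <- : \prod_(p <- l) poisson_weight (theta * p.1) p.2 =
    poisson_weight (theta * t 0%N) k *
    \prod_(j < m) poisson_weight (theta * (t j.+1 - t j)) (kappa j).
  rewrite /l big_cons big_map/= -[X in iota 0 X]subn0 -/(index_iota 0 m).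
  by rewrite big_mkord.
rewrite -(prob_posfits first_step pos1 l0).
rewrite /pi /distribution/= /pushforward; congr (Q _).
have ht j : (0 <= j <= 0 + m)%N -> 0 <= t j by rewrite add0n => /andP[_]; exact: time_grid_ge0.
apply/seteqP; split => w /=.
  move=> [N0 H]; split; last by move=> i; exact: interarrival_gt0.
  split; last first.
    rewrite !add0r add0n; apply/(@fits_increments t kappa m 0 k w ht N0) => j /andP[_].
    exact: H.
  rewrite add0r add0n /psum -!(atimeE cN); exact/(N_eq cN _ _ t0).
move=> [[h1 h2] _].
have N0 : N (t 0%N) w = (k%:R)%:E.
  by apply/(N_eq cN _ _ t0); move: h1; rewrite add0r add0n /psum -!(atimeE cN).
split => // j jm; move: h2; rewrite add0r add0n => /(@fits_increments t kappa m 0 k w ht N0); exact.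
Qed.

Lemma iid_exp_increments m t kappa : time_grid m t ->
  Q (increments_event m t kappa) =
  (\prod_(j < m) poisson_weight (theta * (t j.+1 - t j)) (kappa j))%:E.
Proof.
move=> tm; have t0 : 0 <= t 0%N by case: tm.
(* Without any increment, nothing forces [N (t 0)] to be finite, and the decomposition over its
   value would fail. *)
case: m tm => [|m] tm.
  rewrite big_ord0 (_ : increments_event _ _ _ = setT) ?probability_setT//.
  by apply/seteqP; split.
set c := \prod_(j < _) _.
have c0 : 0 <= c.
  apply: prodr_ge0 => j _; rewrite poisson_weight_ge0// mulr_ge0 ?(ltW theta_gt0)//.
  by rewrite subr_ge0 ltW//; case: tm => _; exact.
have mN k : measurable [set w | N (t 0%N) w = (k%:R)%:E].
  rewrite -[X in measurable X]setTI.
  exact: (cN.1 _ t0 measurableT _ (emeasurable_set1 (k%:R)%:E)).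
have mI := measurable_increments_event kappa tm.
rewrite (_ : increments_event _ _ _ = \bigcup_k
    ([set w | N (t 0%N) w = (k%:R)%:E] `&` increments_event m.+1 t kappa)); last first.
  apply/seteqP; split => [w H|w [k _ []]//].
  have [[k Nk]|Ny] := N_nat_or_pinfty cN w t0; first by exists k.
  have := H 0%N isT; rewrite Ny; by case: (N (t 1%N) w).
rewrite measure_semi_bigcup//; last 3 first.
- by move=> k; exact: measurableI.
- move=> i j _ _ [w /= [[Ni _] [Nj _]]].
  by move: Nj; rewrite Ni => -[] /eqP; rewrite eqr_nat => /eqP.
- by apply: bigcupT_measurable => k; exact: measurableI.
rewrite (eq_eseriesr (fun k _ => iid_exp_prob_start kappa k tm)).
transitivity (\sum_(k <oo) (c%:E * (poisson_weight (theta * t 0%N) k)%:E))%E.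
  by apply: eq_eseriesr => k _; rewrite -EFinM mulrC.
have tt0 : 0 <= theta * t 0%N by rewrite mulr_ge0// ltW.
rewrite nneseriesZl ?poisson_weight_sum ?mule1// => k _.
by rewrite lee_fin poisson_weight_ge0.
Qed.

End iid_exp_consequences.
End interarrival_law.

Arguments increments {R d Omega} N m t.

Section counts.
Context {R : realType} {d : measure_display} {Omega : measurableType d}.
Variable Q : probability Omega R.

Lemma probability_setI1 (A F : set Omega) : measurable A -> measurable F ->
  Q F = 1%E -> Q (A `&` F) = Q A.
Proof.
move=> mA mF F1; rewrite [RHS](measureDI Q mA mF).
rewrite [X in (X + _)%E](_ : _ = 0%E) ?add0e//.
apply/eqP; rewrite -measure_le0.
apply: (@le_trans _ _ (Q (~` F))).
  apply: le_measure; rewrite ?inE; [exact: measurableD|exact: measurableC|].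
  by move=> w [].
by rewrite probability_setC// F1 subee.
Qed.

Variables (m : nat) (X : nat -> Omega -> \bar R).
Hypothesis mX : forall j, (j < m)%N -> measurable_fun setT (X j).

Definition counts_event (D : nat -> set nat) : set Omega :=
  [set w | forall j, (j < m)%N -> exists2 k, D j k & X j w = (k%:R)%:E].

Lemma measurable_count j k : (j < m)%N -> measurable [set w | X j w = (k%:R)%:E].
Proof.
move=> jm; rewrite -[Y in measurable Y]setTI.
exact: (mX jm measurableT (emeasurable_set1 (k%:R)%:E)).
Qed.

Lemma measurable_counts_event D : measurable (counts_event D).
Proof.
rewrite (_ : counts_event D = \bigcap_(j in [set j | (j < m)%N])
    \bigcup_(k in D j) [set w | X j w = (k%:R)%:E])//.
apply: fin_bigcap_measurable; first exact: finite_II.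
by move=> j jm; apply: bigcup_measurable => k _; exact: measurable_count.
Qed.

(** Coordinates are released one at a time: in [D' i] the first i range over [D] and the others stay
    pinned to [kappa], so each step sums a single weight. *)
Lemma prob_counts (p : nat -> nat -> R) (D : nat -> set nat) (s : nat -> R) :
  (forall j k, (j < m)%N -> 0 <= p j k) ->
  (forall j, (j < m)%N -> (\esum_(k in D j) (p j k)%:E = (s j)%:E)%E) ->
  (forall kappa : nat -> nat,
     Q [set w | forall j, (j < m)%N -> X j w = ((kappa j)%:R)%:E] =
     (\prod_(j < m) p j (kappa j))%:E) ->
  Q (counts_event D) = (\prod_(j < m) s j)%:E.
Proof.
move=> p0 sE H.
pose D' i (kappa : nat -> nat) j := if (j < i)%N then D j else [set kappa j].
suff key i kappa : (i <= m)%N -> Q (counts_event (D' i kappa)) =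
    (\prod_(j < m) (if (j < i)%N then s j else p j (kappa j)))%:E.
  transitivity (Q (counts_event (D' m (fun=> 0%N)))).
    congr (Q _); apply/seteqP; split => w /= h j jm; have := h j jm;
      by rewrite /D' jm.
  by rewrite key//; congr _%:E; apply: eq_bigr => j _; rewrite ltn_ord.
elim: i kappa => [|i IH] kappa im.
  rewrite -H; congr (Q _); apply/seteqP; split => w /= h j jm.
    by have [k ->] := h j jm.
  by exists (kappa j) => //; exact: h.
pose upd k j := if j == i then k else kappa j.
rewrite (_ : counts_event _ = \bigcup_(k in D i) counts_event (D' i (upd k))); last first.
  apply/seteqP; split => [w h|w [k Dk h] j jm].
    have [k] := h i im; rewrite /D' ltnSn => Dk Xk; exists k => // j jm.
    have [l] := h j jm; rewrite /D' ltnS [(j <= i)%N]leq_eqVlt /upd.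
    case: eqP => [-> _ _|_ /=]; first by exists k => //; rewrite ltnn.
    by move=> Dl Xl; exists l.
  have [l] := h j jm; rewrite /D' /upd ltnS [(j <= i)%N]leq_eqVlt.
  case: eqP => [->|_] /=; last by move=> Dl Xl; exists l.
  by rewrite ltnn => -> Xl; exists k.
rewrite measure_bigcup; last 2 first.
- by move=> k _; exact: measurable_counts_event.
- move=> k k' _ _ [w [hk hk']].
  have [l] := hk i im; rewrite /D' /upd ltnn eqxx => -> Xk.
  have [l'] := hk' i im; rewrite /D' /upd ltnn eqxx => ->.
  by rewrite Xk => -[] /eqP; rewrite eqr_nat => /eqP.
rewrite (eq_eseriesr (fun k _ => IH (upd k) (ltnW im))).
pose io := Ordinal im.
pose A : R := \prod_(j < m | j != io) (if (j < i.+1)%N then s j else p j (kappa j)).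
transitivity (\sum_(k <oo | k \in D i) (A%:E * (p i k)%:E))%E.
  apply: eq_eseriesr => k _; rewrite -EFinM; congr _%:E.
  rewrite (bigD1 io)//= ltnn /upd eqxx mulrC; congr (_ * _).
  apply: eq_bigr => j; rewrite -val_eqE/= => ji.
  by rewrite (negbTE ji) ltnS [(j <= i)%N]leq_eqVlt (negbTE ji).
rewrite nneseriesZl; last by move=> k _; rewrite lee_fin p0.
rewrite nneseries_esum; last by move=> k _; rewrite lee_fin p0.
rewrite set_mem_set sE// -EFinM; congr _%:E.
by rewrite [RHS](bigD1 io)//= ltnSn mulrC.
Qed.

End counts.

Lemma increments_event_of_seq (R : realType) d (Omega : measurableType d)
    (N : R -> Omega -> \bar R) m t (B : set (m.-tuple R)) w :
  counting_process N -> time_grid m t ->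
  vec_event (increments N m t) B w <->
  exists kappa : m.-tuple nat, B [tuple of [seq k%:R | k <- kappa]] /\
    increments_event N m t (nth 0%N kappa) w.
Proof.
move=> cN tm.
have natX (j : 'I_m) r : (N (t j.+1) w - N (t j) w)%E = r%:E -> exists k : nat, r = k%:R.
  have tj := time_grid_ge0 tm (ltnW (ltn_ord j)).
  have tj1 := time_grid_ge0 tm (ltn_ord j).
  have tjj : t j <= t j.+1 by rewrite ltW//; case: tm => _; apply.
  have := N_nondecreasing cN w tj tjj.
  have [[k ->]|->] := N_nat_or_pinfty cN w tj1; have [[l ->]|->] // := N_nat_or_pinfty cN w tj.
  rewrite lee_fin ler_nat => lk [] <-; exists (k - l)%N; by rewrite natrB.
split=> [[v [Bv hv]]|[kappa [Bk hk]]].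
  have nv j : exists k : nat, tnth v j = k%:R by apply: (natX j); rewrite -hv.
  have [f fE] := choice nv.
  exists (mktuple f); split.
    rewrite (_ : [tuple of _] = v)//; apply: eq_from_tnth => j.
    by rewrite tnth_map tnth_mktuple fE.
  move=> j jm; have := hv (Ordinal jm); rewrite /increments /= => ->.
  have E : nth 0%N (mktuple f) j = f (Ordinal jm).
    by rewrite -[RHS](tnth_mktuple f) (tnth_nth 0%N).
  by rewrite E fE.
exists [tuple of [seq k%:R | k <- kappa]]; split => // j.
by rewrite /increments (hk j (ltn_ord j)) tnth_map (tnth_nth 0%N).
Qed.

Section PP_of_increments.
Context {R : realType} {d : measure_display} {Omega : measurableType d}.
Variable N : R -> Omega -> \bar R.
Hypothesis cN : counting_process N.
Variables (Q : probability Omega R) (theta : R).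
Hypothesis theta_gt0 : 0 < theta.

(** Finite increments of [N] are naturals, so a Borel event is a countable union over tuples of
    naturals. These are enumerated through their codes; an index coding no tuple of [B] yields
    [set0], which preserves disjointness. *)
Definition tuple_event m t (B : set (m.-tuple R)) (n : nat) : set Omega :=
  if @pickle_inv (m.-tuple nat) n is Some kappa then
    if `[< B [tuple of [seq k%:R | k <- kappa]] >] then
      increments_event N m t (nth 0%N kappa) else set0
  else set0.

Lemma measurable_tuple_event m t B n : time_grid m t -> measurable (@tuple_event m t B n).
Proof.
move=> tm; rewrite /tuple_event; case: pickle_inv => // kappa; case: ifP => // _.
exact: measurable_increments_event.
Qed.

Lemma vec_eventE m t B : time_grid m t ->
  vec_event (increments N m t) B = \bigcup_n @tuple_event m t B n.
Proof.
move=> tm; apply/seteqP; split => w.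
  move=> /(increments_event_of_seq B w cN tm)[kappa [Bk hk]].
  exists (pickle kappa) => //; rewrite /tuple_event pickleK_inv.
  by case: asboolP.
move=> [n _]; rewrite /tuple_event; case E : pickle_inv => [kappa|//].
case: asboolP => // Bk hk; apply/(increments_event_of_seq B w cN tm).
by exists kappa.
Qed.

Lemma measurable_vec_event m t B : time_grid m t ->
  measurable (vec_event (increments N m t) B).
Proof.
move=> tm; rewrite vec_eventE//; apply: bigcupT_measurable => n.
exact: measurable_tuple_event.
Qed.

Lemma value_eventE t B : 0 <= t ->
  value_event N t B = \bigcup_(k in [set k : nat | B k%:R]) [set w | N t w = (k%:R)%:E].
Proof.
move=> t0; apply/seteqP; split => w.
  move=> [r [Br Nr]]; have [[k Nk]|Ny] := N_nat_or_pinfty cN w t0; last by rewrite Ny in Nr.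
  by exists k => //=; move: Nr; rewrite Nk => -[] ->.
by move=> [k Bk Nk]; exists k%:R.
Qed.

Lemma measurable_value_event t B : 0 <= t -> measurable (value_event N t B).
Proof.
move=> t0; rewrite value_eventE//; apply: bigcup_measurable => k _.
rewrite -[X in measurable X]setTI.
exact: (cN.1 _ t0 measurableT _ (emeasurable_set1 (k%:R)%:E)).
Qed.

Hypothesis incr : forall m t kappa, time_grid m t ->
  Q (increments_event N m t kappa) =
  (\prod_(j < m) poisson_weight (theta * (t j.+1 - t j)) (kappa j))%:E.

Lemma poissonRE (x : R) B : 0 < x ->
  poissonR x B = (\esum_(k in [set k : nat | B k%:R]) (poisson_weight x k)%:E)%E.
Proof.
move=> x0; rewrite /poissonR /poisson_prob x0; apply: eq_esum => k _.
by rewrite /poisson_weight /poisson_pmf x0; congr _%:E; ring.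
Qed.

Lemma poissonR_fin_num (x : R) B : poissonR x B \is a fin_num.
Proof. exact: (fin_num_measure (poisson_prob x 0)). Qed.

Lemma poissonRT (x : R) : poissonR x setT = 1%E.
Proof. exact: (probability_setT (poisson_prob x 0)). Qed.

Lemma grid_rate_gt0 m (t : nat -> R) j : time_grid m t -> (j < m)%N ->
  0 < theta * (t j.+1 - t j).
Proof. by move=> [_ tm] jm; rewrite mulr_gt0// subr_gt0 tm. Qed.

Lemma prob_increments_counts m t (B : nat -> set R) : time_grid m t ->
  Q (counts_event m (fun j w => (N (t j.+1) w - N (t j) w)%E)
       (fun j => [set k : nat | B j k%:R])) =
  (\prod_(j < m) poissonR (theta * (t j.+1 - t j)) (B j))%E.
Proof.
move=> tm.
rewrite (@prob_counts _ _ _ _ m _ _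
  (fun j k => poisson_weight (theta * (t j.+1 - t j)) k) _
  (fun j => fine (poissonR (theta * (t j.+1 - t j)) (B j)))).
- rewrite -prodEFin; apply: eq_bigr => j _; rewrite fineK//; exact: poissonR_fin_num.
- move=> j jm; apply: measurable_increment => //; apply: time_grid_ge0 tm _ => //.
  exact: ltnW.
- by move=> j k jm; rewrite poisson_weight_ge0// ltW// (grid_rate_gt0 tm).
- move=> j jm; rewrite fineK ?poissonR_fin_num// poissonRE//.
  exact: grid_rate_gt0 tm jm.
- by move=> kappa; exact: incr.
Qed.

Lemma PP_of_increments : PP Q theta N.
Proof.
split => //; split; [|split].
- move=> m t tm s x us.
  pose X j w := (N (t j.+1) w - N (t j) w)%E.
  (* An increment +oo - +oo = -oo lies below every bound but is no count; [F] removes such paths and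
     has probability one. *)
  pose F := counts_event m X (fun=> [set k : nat | (setT : set R) k%:R]).
  have mX j : (j < m)%N -> measurable_fun setT (X j).
    move=> jm; apply: measurable_increment => //; apply: time_grid_ge0 tm _ => //.
    exact: ltnW.
  have mF : measurable F by exact: measurable_counts_event.
  have F1 : Q F = 1%E.
    by rewrite (prob_increments_counts (fun=> setT))// big1// => j _; exact: poissonRT.
  have mle (j : 'I_m) : measurable [set w | (increments N m t j w <= (x j)%:E)%E].
    have := mX j (ltn_ord j) measurableT `]-oo, (x j)%:E]%classic (emeasurable_itv _).
    by congr (measurable _); apply/seteqP; split => w /=; rewrite in_itv/=; tauto.
  pose B (s' : seq 'I_m) (j : nat) : set R :=
    if insub j is Some i then if i \in s' then `]-oo, x i]%classic else setT else setT.
  have key (s' : seq 'I_m) : uniq s' ->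
      Q [set w | forall i, i \in s' -> (increments N m t i w <= (x i)%:E)%E] =
      (\prod_(i <- s') poissonR (theta * (t i.+1 - t i)) `]-oo, x i]%classic)%E.
    move=> us'.
    have mE : measurable [set w | forall i, i \in s' -> (increments N m t i w <= (x i)%:E)%E].
      rewrite (_ : [set w | _] = \bigcap_(i in [set` s'])
          [set w | (increments N m t i w <= (x i)%:E)%E]).
        by apply: fin_bigcap_measurable => // i _; exact: mle.
      by apply/seteqP; split => w /= h i; exact: h.
    rewrite -(probability_setI1 mE mF F1).
    transitivity (Q (counts_event m X (fun j => [set k : nat | B s' j k%:R]))).
      congr (Q _); apply/seteqP; split => w.
        move=> [h Fw] j jm; have [k _ Xk] := Fw j jm; exists k => //=.
        rewrite /B insubT; case: ifPn => // js.
        by have := h _ js; rewrite /increments /= -/(X j w) Xk lee_fin in_itv.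
      move=> h; split; last by move=> j jm; have [k _ Xk] := h j jm; exists k.
      move=> i si; have [k] := h i (ltn_ord i); rewrite /B /= valK si /= in_itv/= => ki Xk.
      by rewrite /increments -/(X i w) Xk lee_fin.
    rewrite prob_increments_counts// [RHS]big_uniq// [RHS]big_mkcond/=.
    apply: eq_bigr => i _; rewrite /B valK; case: ifP => // _; exact: poissonRT.
  rewrite key//; apply: eq_bigr => i _.
  have := key [:: i] isT; rewrite big_seq1 => <-; congr (Q _).
  apply/seteqP; split => w /=; first by move=> h; apply: h; rewrite inE.
  by move=> h j; rewrite inE => /eqP ->.
- move=> m t h tm h0 B mB.
  have tm' : time_grid m (fun j => t j + h).
    by case: tm => t0 tS; split => [|j jm]; [exact: addr_ge0|rewrite ltrD2r tS].
  rewrite !vec_eventE//.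
  have tr t' : time_grid m t' -> trivIset setT (@tuple_event m t' B).
    move=> _ i j _ _ [w []]; rewrite /tuple_event.
    case Ei : (pickle_inv i) => [k|//]; case: ifP => // _ hi.
    case Ej : (pickle_inv j) => [k'|//]; case: ifP => // _ hj.
    have := @pickle_invK (m.-tuple nat) i; rewrite Ei /= => <-.
    have := @pickle_invK (m.-tuple nat) j; rewrite Ej /= => <-.
    congr pickle; apply: eq_from_tnth => a; rewrite !(tnth_nth 0%N).
    by have := hi a (ltn_ord a); rewrite (hj a (ltn_ord a)) => -[] /eqP; rewrite eqr_nat => /eqP.
  rewrite !measure_semi_bigcup//; last 6 first.
  - by move=> n; exact: measurable_tuple_event.
  - exact: tr.
  - by apply: bigcupT_measurable => n; exact: measurable_tuple_event.
  - by move=> n; exact: measurable_tuple_event.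
  - exact: tr.
  - by apply: bigcupT_measurable => n; exact: measurable_tuple_event.
  apply: eq_eseriesr => n _; rewrite /tuple_event.
  case: pickle_inv => [k|//]; case: ifP => // _.
  rewrite [LHS]incr// [RHS]incr//; congr _%:E; apply: eq_bigr => j _.
  congr (poisson_weight (_ * _) _).
  ring.
- move=> t t0 B mB.
  pose u (j : nat) : R := if j is 0%N then 0 else t.
  have um : time_grid 1 u by split => // -[|j].
  have := prob_increments_counts (fun=> B) um; rewrite big_ord1/= subr0 => <-.
  rewrite value_eventE ?ltW//; congr (Q _); apply/seteqP; split => w.
    move=> [k Bk Nk] [|j]//= _; exists k => //; rewrite (N_at0 cN) sube0; exact: Nk.
  move=> h; have [k Bk] := h 0%N isT; rewrite /= (N_at0 cN) sube0 => Nk.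
  by exists k.
Qed.

End PP_of_increments.

(** On the set where k < h, the integrals over every measurable subset agree, so h = k almost
    everywhere there and the set is negligible. *)
Lemma ae_le_of_integral d (T : measurableType d) (R : realType)
    (mu : {measure set T -> \bar R}) (h k : T -> R) :
  measurable_fun setT h -> measurable_fun setT k ->
  mu.-integrable setT (EFin \o h) -> mu.-integrable setT (EFin \o k) ->
  (forall A, measurable A ->
    (\int[mu]_(x in A) (h x)%:E <= \int[mu]_(x in A) (k x)%:E)%E) ->
  {ae mu, forall x, h x <= k x}.
Proof.
move=> /measurable_EFinP mh /measurable_EFinP mk ih ik hk.
pose D := [set x | k x < h x].
have mD : measurable D.
  by have := measurable_lte measurableT mk mh; rewrite setTI.
have [B [mB B0 sB]] : ae_eq mu D (EFin \o h) (EFin \o k).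
  apply: integral_ae_eq => //.
  - exact: integrableS ih.
  - exact: measurable_funTS.
  - move=> A AD mA; apply/eqP; rewrite eq_le hk//=.
    apply: le_integral => //; [exact: integrableS ik|exact: integrableS ih|].
    by move=> x; rewrite inE => /AD; rewrite /D /= lee_fin; exact: ltW.
exists B; split => // x /= hkx; apply: sB => /= hkE.
have Dx : D x by rewrite /D /= ltNge; exact/negP.
by have [] := hkE Dx => e; move: Dx; rewrite /D /= e ltxx.
Qed.

(** * Existence of disintegrations *)

Section conditional_quantile.
Context {R : realType} {d : measure_display} {Omega : measurableType d}.
Variables (P : probability Omega R) (Th f : {mfun Omega >-> R}).
Hypothesis f01 : forall w, 0 <= f w <= 1.

Let PTh : probability R R := distribution P Th.

Let below (q : rat) : set Omega := [set w | f w <= ratr q].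

Let mbelow q : measurable (below q).
Proof.
rewrite (_ : below q = f @^-1` `]-oo, ratr q]%classic).
  by apply: measurable_preim; exact: measurable_itv.
by apply/seteqP; split => w /=; rewrite in_itv.
Qed.

Let dens : rat -> R -> R := projT1 (choice (fun q => cond_density_exists P Th (mbelow q))).

Let densP q : [/\ measurable_fun setT (dens q), forall x, 0 <= dens q x,
    PTh.-integrable setT (EFin \o dens q) &
    forall C : set R, measurable C ->
      (\int[PTh]_(x in C) (dens q x)%:E = P (below q `&` Th @^-1` C))%E].
Proof. exact: (projT2 (choice (fun q => cond_density_exists P Th (mbelow q))) q). Qed.

Definition unif : probability (measurableTypeR R) R :=
  uniform_distribution_uniform_prob__canonical__probability_measure_Probability
    (@ltr01 R).

Lemma unif_Nyc c : 0 <= c <= 1 -> unif `]-oo, c]%classic = c%:E.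
Proof.
move=> /andP[c0 c1]; transitivity (uniform_prob (@ltr01 R) `]-oo, c]%classic); first by [].
rewrite /uniform_prob integral_uniform_pdf.
rewrite (_ : `]-oo, c] `&` `[0, 1] = `[0, c]%classic); last first.
  apply/seteqP; split => x /=; rewrite !in_itv/=; first by move=> [-> /andP[->]].
  by move=> /andP[-> xc]; rewrite xc (le_trans xc).
rewrite (eq_integral (cst 1%E)) ?integral_cst//= ?lebesgue_measure_itv/=.
  rewrite mul1e; case: ifPn => //; rewrite ?sube0// lte_fin -leNgt => c0'.
  by congr _%:E; apply/eqP; rewrite eq_le c0.
move=> x; rewrite inE/= in_itv/= => /andP[x0 xc].
by rewrite /uniform_pdf x0 (le_trans xc)//= subr0 invr1.
Qed.

(** A rational whose conditional distribution function does not reach the level counts as 1, the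
    upper bound of [f]. So [quant] is an infimum over all rationals, hence measurable, and needs no
    regularity of the chosen densities. *)
Let rung q (p : R * measurableTypeR R) : R :=
  if (0 <= (ratr q : R) <= 1) && (p.2 <= (dens q p.1 : R)) then ratr q else 1.

Let rung_itv q p : 0 <= rung q p <= 1.
Proof. by rewrite /rung; case: ifPn => [/andP[]//|_]; rewrite ler01 lexx. Qed.

(* The conditional quantile function of f given Th = p.1, at level p.2. *)
Let quant (p : R * measurableTypeR R) : R := inf (range (rung ^~ p)).

Let has_inf_rung p : has_inf (range (rung ^~ p)).
Proof.
split; first by exists (rung 0 p), 0%Q.
by exists 0 => _ [q _ <-]; case/andP: (rung_itv q p).
Qed.

Let quant_lt p x : (quant p < x) <-> exists q, rung q p < x.
Proof.
split.
  by move/(inf_lt (has_inf_rung p).1) => [_ [q _ <-]]; exists q.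
by move=> [q]; apply: le_lt_trans; apply: ge_inf; [exact: (has_inf_rung p).2|exists q].
Qed.

Let measurable_rung q : measurable_fun setT (rung q).
Proof.
apply: measurable_fun_ifT => //; apply: measurable_and => //.
apply: measurable_fun_ler; first exact: measurable_snd.
by apply: measurableT_comp; [case: (densP q)|exact: measurable_fst].
Qed.

Let measurable_quant : measurable_fun setT quant.
Proof.
apply: (measurability _ (RGenInftyO.measurableE R)) => //.
move=> _ [_ [x ->] <-]; rewrite setTI.
rewrite (_ : _ @^-1` _ = \bigcup_q (rung q @^-1` `]-oo, x[%classic)).
  apply: bigcupT_measurable_rat => q; rewrite -[X in measurable X]setTI.
  by apply: measurable_rung => //; exact: measurable_itv.
apply/seteqP; split => p /=; rewrite in_itv/=.
  by move=> /quant_lt[q qx]; exists q => //=; rewrite in_itv.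
by move=> [q _]; rewrite /= in_itv/= => qx; apply/quant_lt; exists q.
Qed.

Let quant_mfun : {mfun (R * measurableTypeR R)%type >-> R} :=
  mfun_Sub (mem_set measurable_quant).

Let dens_mono : {ae PTh, forall x, forall q q', q <= q' -> dens q x <= dens q' x}.
Proof.
have cst : {ae PTh, forall x, forall n : nat,
    if (unpickle n : option (rat * rat)) is Some (q, q')
    then (q <= q') ==> (dens q x <= dens q' x) else true}.
  apply/ae_foralln => n; case: unpickle => [[q q']|]; last by apply: aeW.
  have [qq'|qq'] := leP q q'; last by apply: aeW => x.
  have [mq _ iq Eq] := densP q; have [mq' _ iq' Eq'] := densP q'.
  apply: ae_le_of_integral => // A mA; rewrite Eq// Eq'//.
  have mTA : measurable (Th @^-1` A) by exact: measurable_preim.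
  apply: le_measure; rewrite ?inE; [exact: measurableI|exact: measurableI|].
  by apply: setSI => w; rewrite /below /= => /le_trans; apply; rewrite ler_rat.
apply: filterS cst => x H q q' qq'.
by have := H (pickle (q, q')); rewrite pickleK qq'.
Qed.

Let dens_le1 : {ae PTh, forall x, forall q, dens q x <= 1}.
Proof.
have cst : {ae PTh, forall x, forall n : nat,
    if (unpickle n : option rat) is Some q then dens q x <= 1 else true}.
  apply/ae_foralln => n; case: unpickle => [q|]; last by apply: aeW.
  have [mq _ iq Eq] := densP q.
  apply: (@ae_le_of_integral _ _ _ _ _ (cst 1)) => //.
    exact: finite_measure_integrable_cst.
  move=> A mA; rewrite Eq// (integral_cst PTh mA 1) mul1e.
  have mTA : measurable (Th @^-1` A) by exact: measurable_preim.
  by apply: le_measure; rewrite ?inE; [exact: measurableI|exact: mTA|exact: subIsetr].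
apply: filterS cst => x H q.
by have := H (pickle q); rewrite pickleK.
Qed.

Section cell.
Variable C : set R.
Hypothesis mC : measurable C.

Let mTC : measurable (Th @^-1` C). Proof. exact: measurable_preim. Qed.

Let mCT : measurable (C `*` [set: measurableTypeR R]).
Proof. exact: measurableX. Qed.

(** For fixed [C], the law of [f] on {Th in C} is to equal the law of the conditional quantile at a
    uniform level independent of [Th]. *)
Let m1 := trace_fmeasure P f mTC.
Let m2 := trace_fmeasure (distribution P Th \x unif)%E quant_mfun mCT.

Let m2E A : measurable A ->
  m2 A = (\int[PTh]_(x in C) unif [set u | A (quant (x, u))])%E.
Proof.
move=> mA.
have mqA : measurable (quant @^-1` A).
  by rewrite -[X in measurable X]setTI; exact: measurable_quant.
rewrite [RHS]integral_mkcond; apply: eq_integral => x _ /=.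
rewrite patchE; case: ifPn => [|] xC.
  congr (unif _); apply/seteqP; split => u; rewrite /xsection /= inE; first by case.
  by move=> h; split => //; split => //; rewrite inE in xC.
rewrite (_ : xsection _ _ = set0) ?measure0//.
apply/seteqP; split => // u; rewrite /xsection /= inE => -[[Cx _] _].
by rewrite notin_setE in xC; exact: xC.
Qed.

Let m1E q : m1 `]-oo, ratr q]%classic = (\int[PTh]_(x in C) (dens q x)%:E)%E.
Proof.
have [_ _ _ ->//] := densP q.
rewrite /m1/= /trace_measure setIC; congr (P (_ `&` _)).
Qed.

Let mquant_slice (B : set R) x : measurable B -> measurable [set u | B (quant (x, u))].
Proof.
move=> mB; rewrite -[X in measurable X]setTI.
exact: (measurableT_comp measurable_quant (measurable_pair1 x)) measurableT B mB.
Qed.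

(** The densities are indexed by rationals and not made right-continuous, so the measures are
    compared with slack between q and x; [m12_Nyo] removes the slack by approaching x from below. *)
Let m1_le_m2 q x : ratr q < x -> (m1 `]-oo, ratr q]%classic <= m2 `]-oo, x[%classic)%E.
Proof.
move=> qx; have [q0|q0] := ltP (ratr q : R) 0.
  rewrite (_ : m1 _ = 0%E) ?measure_ge0//.
  rewrite /m1/= /trace_measure (_ : _ `&` _ = set0) ?measure0//.
  apply/seteqP; split => // w [_] /=; rewrite in_itv/= => h.
  by have /andP[h0 _] := f01 w; have := le_lt_trans (le_trans h0 h) q0; rewrite ltxx.
have [mq dq0 iq Eq] := densP q.
rewrite m1E m2E; last exact: measurable_itv.
apply: ae_ge0_le_integral => //.
- by move=> y _; rewrite lee_fin.
- by apply: measurable_funTS; exact/measurable_EFinP.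
- have mA : measurable (quant @^-1` `]-oo, x[%classic).
    by rewrite -[X in measurable X]setTI; apply: measurable_quant => //; exact: measurable_itv.
  apply: measurable_funTS; have := measurable_fun_xsection unif mA.
  by congr (measurable_fun _ _); apply/funext => y /=; congr (unif _); apply/seteqP; split => u;
    rewrite /xsection /= inE.
apply: filterS dens_le1 => y /(_ q) dq1 _.
rewrite -(@unif_Nyc (dens q y)) ?dq0//.
apply: le_measure; rewrite ?inE; [exact: measurable_itv|exact: mquant_slice (measurable_itv _)|].
move=> u; rewrite /= !in_itv/= => udq; apply/quant_lt.
have [q1|q1] := leP (ratr q : R) 1.
  by exists q; rewrite /rung q0 q1 udq.
exists q; rewrite /rung (leNgt (ratr q : R) 1) q1 andbF/=.
exact: lt_trans qx.
Qed.

Let m2_le_m1 q x : x <= ratr q -> (m2 `]-oo, x[%classic <= m1 `]-oo, ratr q]%classic)%E.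
Proof.
move=> xq; have [mq dq0 iq Eq] := densP q.
(* For x > 1 the default value 1 of [rung] lies below x and says nothing about the level; but then f
   <= 1 gives [m1] its full mass. *)
have [x1|x1] := ltP 1 x.
  rewrite (_ : m1 _ = m2 setT).
    by apply: le_measure; rewrite ?inE//; exact: measurable_itv.
  rewrite m2E// (eq_integral (cst 1%E)); last first.
    by move=> y _; rewrite (_ : [set u | _] = setT) ?probability_setT//; apply/seteqP; split.
  rewrite integral_cst// mul1e; rewrite /m1/= /trace_measure setIidl//.
  move=> w _ /=; rewrite in_itv/=; case/andP: (f01 w) => _ /le_trans; apply.
  exact: le_trans (ltW x1) xq.
rewrite m1E m2E; last exact: measurable_itv.
apply: ae_ge0_le_integral => //.
- have mA : measurable (quant @^-1` `]-oo, x[%classic).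
    by rewrite -[X in measurable X]setTI; apply: measurable_quant => //; exact: measurable_itv.
  apply: measurable_funTS; have := measurable_fun_xsection unif mA.
  by congr (measurable_fun _ _); apply/funext => y /=; congr (unif _); apply/seteqP; split => u;
    rewrite /xsection /= inE.
- by move=> y _; rewrite lee_fin.
- by apply: measurable_funTS; exact/measurable_EFinP.
apply: filterS2 dens_le1 dens_mono => y /(_ q) dq1 mono _.
rewrite -(@unif_Nyc (dens q y)) ?dq0//.
apply: le_measure; rewrite ?inE; [exact: mquant_slice (measurable_itv _)|exact: measurable_itv|].
move=> u; rewrite /= !in_itv/= => /quant_lt[q']; rewrite /rung.
case: ifPn => [/andP[_ u1] q'x|_]; last by move=> /lt_le_trans /(_ x1); rewrite ltxx.
apply: (le_trans u1); apply: mono; rewrite -(ler_rat R).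
by rewrite ltW// (lt_le_trans q'x).
Qed.

Let m12_Nyo x : m1 `]-oo, x[%classic = m2 `]-oo, x[%classic.
Proof.
pose y n : R := x - n.+1%:R^-1.
pose F n : set R := `]-oo, y n[%classic.
have yx n : y n < x by rewrite /y ltrBlDr ltrDl.
have FE : \bigcup_n F n = `]-oo, x[%classic.
  apply/seteqP; split => z.
    by move=> [n _]; rewrite /F /= !in_itv/= => /lt_trans; apply.
  rewrite /= in_itv/= => zx; pose e := x - z; have e0 : 0 < e by rewrite subr_gt0.
  exists (Num.truncn e^-1) => //; rewrite /F /= in_itv/= /y ltrBrDr -ltrBrDl.
  by rewrite invf_plt ?posrE//; exact: truncnS_gt.
have mF n : measurable (F n) by exact: measurable_itv.
have ndF : {homo F : n m / (n <= m)%N >-> (n <= m)%O}.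
  move=> n m nm; apply/subsetPset => z; rewrite /F /= !in_itv/= => /lt_le_trans; apply.
  by rewrite lerD2l lerN2 lef_pV2 ?posrE// ler_nat.
have qP n : exists q : rat, y n < ratr q < x.
  by have [q] := rat_in_itvoo (yx n); rewrite in_itv/= => h; exists q.
have mUF : measurable (\bigcup_n F n) by exact: bigcupT_measurable.
have c1 := @nondecreasing_cvg_mu _ _ _ m1 F mF mUF ndF.
have c2 := @nondecreasing_cvg_mu _ _ _ m2 F mF mUF ndF.
rewrite FE in c1 c2; apply/eqP; rewrite eq_le; apply/andP; split.
  apply: (cvge_le _ c1); apply: nearW => n /=.
  have [q /andP[q1 q2]] := qP n; apply: le_trans (m1_le_m2 q2).
  apply: le_measure; rewrite ?inE; [exact: mTC|exact: mF|exact: measurable_itv|].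
  by move=> z; rewrite /F /= !in_itv/= => /ltW /le_trans; apply; exact: ltW.
apply: (cvge_le _ c2); apply: nearW => n /=.
have [q /andP[q1 q2]] := qP n; apply: (le_trans (m2_le_m1 (ltW q1))).
apply: le_measure; rewrite ?inE; [exact: measurable_itv|exact: measurable_itv|].
by move=> z; rewrite /= !in_itv/= => /le_lt_trans; apply.
Qed.

Lemma quantile_law_on A : measurable A ->
  P (Th @^-1` C `&` f @^-1` A) =
  (\int[distribution P Th]_(x in C) unif [set u | A (quant (x, u))])%E.
Proof.
move=> mA; rewrite -m2E//; change (m1 A = m2 A).
apply: (measure_unique (@RGenInftyO.G R) (fun n => `]-oo, n%:R[%classic)) => //.
- exact: RGenInftyO.measurableE.
- move=> _ _ [x ->] [y ->]; exists (Num.min x y).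
  apply/seteqP; split => z /=; rewrite !in_itv/= lt_min.
    by move=> [-> ->].
  by move=> /andP[].
- by move=> n; exists n%:R.
- apply/seteqP; split => // x _; exists (Num.truncn `|x|).+1 => //=.
  by rewrite in_itv/= (le_lt_trans (ler_norm _))// truncnS_gt.
- by move=> _ [x ->]; exact: m12_Nyo.
- move=> n; rewrite -ge0_fin_numE// fin_num_measure//; exact: measurable_itv.
Qed.

End cell.

Lemma quantile_transform : exists2 X : R * measurableTypeR R -> R,
  measurable_fun setT X &
  forall A C, measurable A -> measurable C -> P (Th @^-1` C `&` f @^-1` A) =
    (\int[distribution P Th]_(x in C) unif [set u | A (X (x, u))])%E.
Proof. by exists quant => // A C mA mC; exact: quantile_law_on. Qed.

End conditional_quantile.

(** * Coding a sequence of events by one real function *)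

Section ternary_code.
Context {R : realType} {d : measure_display} {Omega : measurableType d}.
Variable E : nat -> set Omega.
Hypothesis mE : forall k, measurable (E k).

(* Truncation of the number whose i-th ternary digit is 2 on E (k + i) and 0 elsewhere. *)
Fixpoint ternary_trunc (n k : nat) (w : Omega) : R :=
  if n is n'.+1 then (2 * \1_(E k) w + ternary_trunc n' k.+1 w) / 3 else 0.

Definition ternary_code (k : nat) (w : Omega) : R :=
  limn (fun n => ternary_trunc n k w).

Let trunc_itv n k w : 0 <= ternary_trunc n k w <= 1.
Proof.
elim: n k => [|n IH] k /=; first by rewrite lexx ler01.
by have := IH k.+1; rewrite indicE; case: (w \in E k) => /=; lra.
Qed.

Let trunc_nd k w : nondecreasing_seq (fun n => ternary_trunc n k w).
Proof.
apply/nondecreasing_seqP => n; elim: n k => [|n IH] k.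
  by case/andP: (trunc_itv 1 k w).
by have := IH k.+1 => /=; lra.
Qed.

Let cvg_trunc k w : cvgn (fun n => ternary_trunc n k w).
Proof.
apply: nondecreasing_is_cvgn => //.
by exists 1 => _ [n _ <-]; case/andP: (trunc_itv n k w).
Qed.

Lemma ternary_code_itv k w : 0 <= ternary_code k w <= 1.
Proof.
apply/andP; split; [apply: limr_ge|apply: limr_le] => //; apply: nearW => n;
  by case/andP: (trunc_itv n k w).
Qed.

Lemma ternary_codeS k w :
  ternary_code k w = (2 * \1_(E k) w + ternary_code k.+1 w) / 3.
Proof.
apply/cvg_lim => //; rewrite -(cvg_shiftS (fun n => ternary_trunc n k w)) /=.
by apply: cvgMr_tmp; apply: cvgD; [exact: cvg_cst|exact: cvg_trunc].
Qed.

Lemma measurable_ternary_code k : measurable_fun setT (ternary_code k).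
Proof.
apply: (measurable_fun_cvg (h := fun n => ternary_trunc n k)) => [n|w _]; last exact: cvg_trunc.
elim: n k => [|n IH] k //=.
apply: measurable_funM => //; apply: measurable_funD => //.
by apply: measurable_funM => //; exact: measurable_indic.
Qed.

(** The digits 0 and 2 in base 3 avoid the double expansions of base 2: a leading 0 gives at most
    1/3, a leading 2 at least 2/3. *)
Lemma ternary_code_digit k w : E k w <-> 2 / 3 <= ternary_code k w.
Proof.
have := ternary_code_itv k.+1 w; rewrite (ternary_codeS k) indicE => h.
split => [Ek|]; first by rewrite mem_set//=; lra.
by apply: contraPP => Ek; rewrite memNset//= => ?; lra.
Qed.

(** Dropping the leading digit is a Borel function of the code, so the k-th digit is read by pulling
    [2/3, +oo[ back k times. *)
Lemma ternary_code_preimage k : exists2 A : set R, measurable A &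
  ternary_code 0 @^-1` A = E k.
Proof.
pose shift (x : R) := 3 * x - 2 * \1_(`[2 / 3, +oo[%classic) x.
have mshift : measurable_fun setT shift.
  apply: measurable_funB; apply: measurable_funM => //.
have shiftE w j : ternary_code j.+1 w = shift (ternary_code j w).
  rewrite /shift [in X in X - _]ternary_codeS !indicE.
  rewrite (_ : (ternary_code j w \in _) = (w \in E j)); first by field.
  by apply/idP/idP; rewrite !inE /= in_itv/= andbT => /ternary_code_digit.
have pull B : measurable B -> exists2 A : set R, measurable A &
    ternary_code 0 @^-1` A = ternary_code k @^-1` B.
  elim: k B => [|k IH] B mB; first by exists B.
  have [|A mA AE] := IH (shift @^-1` B).
    by rewrite -[X in measurable X]setTI; exact: mshift.
  by exists A => //; rewrite AE; apply/seteqP; split => w /=; rewrite shiftE.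
have [|A mA AE] := pull `[2 / 3, +oo[%classic; first exact: measurable_itv.
by exists A => //; rewrite AE; apply/seteqP; split => w; rewrite /= in_itv/= andbT => /ternary_code_digit.
Qed.

End ternary_code.

Section disintegration.
Context {R : realType} {d : measure_display} {Omega : measurableType d}.

Lemma countably_generated_code : countably_generated (Omega := Omega) ->
  exists f : {mfun Omega >-> R}, (forall w, 0 <= f w <= 1) /\
    forall E : set Omega, measurable E ->
      exists2 A : set R, measurable A & f @^-1` A = E.
Proof.
move=> [G [/countable_injP[c cI] GE]].
(* [c] numbers the generators injectively; a number that is not taken stands for [set0]. *)
have /choice[E HE] k : exists E : set Omega, measurable E /\
    forall A, G A -> c A = k -> E = A.
  have [[A [GA <-]]|nA] := pselect (exists A, G A /\ c A = k).
    exists A; split; first by rewrite GE; exact: sub_gen_smallest.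
    by move=> B GB cBA; apply/esym/cI; rewrite ?inE.
  by exists set0; split => // A GA cA; exfalso; apply: nA; exists A.
have mE k : measurable (E k) by case: (HE k).
exists (mfun_Sub (mem_set (measurable_ternary_code (R := R) mE 0))).
split => [w|F]; first exact: ternary_code_itv.
pose f := ternary_code (R := R) E 0.
rewrite GE => mF.
suff [A mA AF] : preimage_set_system setT f measurable F.
  by exists A => //; rewrite -AF setTI.
move: F mF; apply: smallest_sub.
  by apply: sigma_algebra_preimage; exact: sigma_algebra_measurable.
move=> A GA; have [B mB BE] := ternary_code_preimage (R := R) E (c A).
by exists B => //; rewrite setTI BE; case: (HE (c A)) => _ /(_ A GA); exact.
Qed.

Variable P : probability Omega R.

Lemma disintegration_exists (Th : {mfun Omega >-> R}) :
  perfect P -> countably_generated (Omega := Omega) ->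
  exists Qt : R -> probability Omega R,
    (forall E, measurable E -> measurable_fun setT (Qt ^~ E)) /\
    forall E C, measurable E -> measurable C ->
      (\int[distribution P Th]_(x in C) Qt x E)%E = P (E `&` Th @^-1` C).
Proof.
move=> perfP /countably_generated_code[f [f01 fE]].
have [B [mB [Bf PB]]] := perfP f (measurable_funPT f).
have [X mX XE] := quantile_transform P Th f01.
(* Although it comes from choice, the section is measurable on [B]: every event is the preimage
   under [f] of some Borel set, so that [s x] belongs to it exactly when x belongs to that Borel
   set. *)
have /choice[s sP] (x : R) : exists w, B x -> f w = x.
  have [Bx|nBx] := pselect (B x); last by exists point.
  by have [w _ <-] := Bf _ Bx; exists w.
pose s' x := if x \in B then s x else point.
have ms : measurable_fun setT (s' : measurableTypeR R -> Omega).
  move=> _ E mE; rewrite setTI; have [A mA AE] := fE E mE.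
  rewrite (_ : _ @^-1` _ = (B `&` A) `|` (if point \in E then ~` B else set0)).
    by apply: measurableU; [exact: measurableI|case: ifPn => // _; exact: measurableC].
  apply/seteqP; split => x /=; rewrite /s'; have [xB|xB] := pselect (B x).
  - by rewrite mem_set// -AE /= sP// => Ax; left.
  - by rewrite memNset// => Ep; right; rewrite mem_set.
  - rewrite (mem_set xB) => -[[_]|]; first by rewrite -AE /= sP.
    by case: ifPn.
  - by rewrite (memNset xB) => -[[]//|]; case: ifPn => //; rewrite inE.
(* s' is a measurable section of f on B, and Qt x the image under s' of the
   conditional law of f given Th = x. *)
have mY x : measurable_fun setT (fun u : measurableTypeR R => s' (X (x, u))).
  exact: (measurableT_comp ms (measurableT_comp mX (measurable_pair1 x))).
pose Qt x : probability Omega R := distribution (@unif R) (mfun_Sub (mem_set (mY x))).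
exists Qt; split.
  move=> E mE.
  have mF : measurable ((fun p => s' (X p)) @^-1` E).
    by rewrite -[X in measurable X]setTI; exact: (measurableT_comp ms mX).
  have := measurable_fun_xsection (@unif R) mF.
  by congr (measurable_fun _ _); apply/funext => y /=; congr (@unif R _);
    apply/seteqP; split => u; rewrite /xsection /= inE.
move=> E C mE mC.
have mA : measurable (s' @^-1` E).
  by rewrite -[X in measurable X]setTI; exact: ms.
transitivity (\int[distribution P Th]_(x in C) @unif R [set u | (s' @^-1` E) (X (x, u))])%E.
  by [].
rewrite -XE//.
have mf A : measurable A -> measurable (f @^-1` A) by exact: measurable_preim.
have mTC := measurable_preim Th mC.
(* Perfectness allows restricting to f in [B]. There w and [s' (f w)] have the same image under [f],
   hence belong to the same events. *)
rewrite -[LHS](probability_setI1 _ (mf _ mB) PB); last exact: measurableI (mf _ mA).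
rewrite -[RHS](probability_setI1 _ (mf _ mB) PB); last exact: measurableI.
congr (P _); have [A _ <-] := fE E mE.
apply/seteqP; split => w /=; rewrite /s'.
  by move=> [[Cw]]; move=> + Bw; rewrite mem_set//= sP.
by move=> [[Aw Cw] Bw]; split=> //; split=> //; rewrite mem_set//= sP.
Qed.

End disintegration.

(** * Disintegrations and mixed Poisson processes *)

Section disintegration_cond_prob.
Context {R : realType} {d : measure_display} {Omega : measurableType d}.
Variables (P : probability Omega R) (Th : {mfun Omega >-> R}).
Variable Qt : R -> probability Omega R.

(** Disintegration and consistency merged into one integral identity, which says at the same time
    that [Qt (Th w)] gives the conditional probabilities given [Th]. *)
Definition disintegrates : Prop :=
  (forall E, measurable E -> measurable_fun setT (Qt ^~ E)) /\
  forall E C, measurable E -> measurable C ->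
    (\int[distribution P Th]_(x in C) Qt x E)%E = P (E `&` Th @^-1` C).

Lemma disintegrates_disintegration : disintegrates ->
  disintegration P (distribution P Th) setT Qt.
Proof.
by move=> [mQ QE]; split => // E mE; rewrite QE// preimage_setT setIT.
Qed.

Lemma disintegrates_consistent : disintegrates ->
  consistent (distribution P Th) setT Qt Th.
Proof.
move=> [mQ QE] B mB _; have mTB := measurable_preim Th mB.
have [A [mA A0 sA]] : ae_eq (distribution P Th) B (cst 1%E) (fun x => Qt x (Th @^-1` B)).
  apply: integral_ae_eq => //.
  - exact: finite_measure_integrable_cst.
  - by apply: measurable_funTS; exact: mQ.
  move=> C CB mC; rewrite QE// integral_cst// mul1e.
  change (P (Th @^-1` C) = P (Th @^-1` B `&` Th @^-1` C)).
  by congr (P _); rewrite setIidr//; exact: preimage_subset.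
exists A; split => // x nB; apply: sA => /= h; apply: nB => Bx.
by rewrite -h.
Qed.

(** Consistency for [C] and for its complement gives Th^-1 C mass 1 or 0 under almost every [Qt x],
    according as x lies in [C] or not; so intersecting with it restricts the integral to [C]. *)
Lemma consistent_disintegrates :
  disintegration P (distribution P Th) setT Qt ->
  consistent (distribution P Th) setT Qt Th -> disintegrates.
Proof.
move=> [mQ QE] cQ; split => // E C mE mC; have mTC := measurable_preim Th mC.
have mI : measurable (E `&` Th @^-1` C) by exact: measurableI.
rewrite -QE// [LHS]integral_mkcond; apply: ae_eq_integral => //.
- apply/(measurable_restrictT _ mC)/measurable_funTS; exact: mQ.
- exact: mQ.
apply: filterS2 (cQ C mC (@subsetT _ _)) (cQ (~` C) (measurableC mC) (@subsetT _ _)).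
move=> x QC QnC _; rewrite patchE; case: ifPn; rewrite ?inE ?notin_setE => xC.
  by rewrite probability_setI1// QC.
apply/esym/eqP; rewrite -measure_le0.
rewrite -(_ : Qt x (~` (Th @^-1` (~` C))) = 0%E).
  apply: le_measure; rewrite ?inE//; last by move=> w [_ Cw] /(_ Cw).
  by apply: measurableC; apply: measurable_preim; exact: measurableC.
rewrite probability_setC ?QnC// ?subee//.
by apply: measurable_preim; exact: measurableC.
Qed.

Hypothesis HQ : disintegrates.

Lemma disintegrates_cond_prob E : measurable E ->
  is_cond_prob P Th E ((fun x => fine (Qt x E)) \o Th).
Proof.
case: HQ => mQ QE mE; apply: cond_probP.
- by apply: measurableT_comp => //; exact: mQ.
- apply: (@le_integrable _ _ _ _ _ _ _ (cst 1%E)) => //.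
  + by apply/measurable_EFinP; apply: measurableT_comp => //; exact: mQ.
  + move=> x _ /=; rewrite lee_fin normr1 ger0_norm ?fine_ge0// -lee_fin.
    by rewrite fineK ?fin_num_measure// probability_le1.
  + exact: finite_measure_integrable_cst.
- move=> C mC; rewrite -QE//; apply: eq_integral => x _.
  by rewrite fineK// fin_num_measure.
Qed.

Lemma disintegrates_ae E (h : R -> R) : measurable E -> measurable_fun setT h ->
  is_cond_prob P Th E (h \o Th) ->
  {ae distribution P Th, forall x, Qt x E = (h x)%:E}.
Proof.
move=> mE mh hE; have mQ : measurable_fun setT (fun x => fine (Qt x E)).
  by apply: measurableT_comp => //; exact: HQ.1.
have := cond_prob_ae_distribution mQ mh (disintegrates_cond_prob mE) hE.
by apply: filterS => x <-; rewrite fineK// fin_num_measure.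
Qed.

End disintegration_cond_prob.

Section poisson_disintegration.
Context {R : realType} {d : measure_display} {Omega : measurableType d}.
Variable N : R -> Omega -> \bar R.
Hypothesis cN : counting_process N.
Variable P : probability Omega R.

Lemma measurable_increments m t j : time_grid m t ->
  measurable_fun setT (increments N m t j).
Proof.
move=> tm; exact: (measurable_increment cN (time_grid_ge0 tm (ltnW (ltn_ord j)))
  (time_grid_ge0 tm (ltn_ord j))).
Qed.

Lemma ae_probability (mu : probability R R) (A : set R) :
  measurable A -> {ae mu, forall x, A x} -> mu A = 1%E.
Proof.
move=> mA [B [mB B0 sB]].
rewrite -[A]setCK probability_setC; last exact: measurableC.
rewrite (_ : mu (~` A) = 0%E) ?sube0//; apply/eqP; rewrite -measure_le0 -B0.
by apply: le_measure; rewrite ?inE//; exact: measurableC.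
Qed.

(** Every version of a conditional probability agrees almost surely with [Qt (Th w)], so each clause
    of [MPP] is the corresponding clause of [PP] at Th w. *)
Lemma PP_disintegration_MPP (Th : {RV P >-> R}) (Qt : R -> probability Omega R) :
  disintegrates P Th Qt -> {ae distribution P Th, forall x, PP (Qt x) x N} ->
  MPP N Th.
Proof.
move=> HQ PPQ; have PPw := ae_distribution PPQ.
have cp E g : measurable E -> is_cond_prob P Th E g ->
    {ae P, forall w, (g w)%:E = Qt (Th w) E}.
  move=> mE gE; have := cond_prob_unique gE (disintegrates_cond_prob HQ mE).
  by apply: filterS => w -> /=; rewrite fineK// fin_num_measure.
split; [|split; [|split]].
- apply: ae_probability; first exact: measurable_itv.
  by apply: filterS PPQ => x [x0 _] /=; rewrite in_itv/= x0.
- move=> m t tm s x g gs us gE gsE.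
  have mX i := measurable_increments i tm.
  have {}gE := cp _ _ (measurable_all_le_event s x mX) gE.
  have {}gsE : {ae P, forall w, forall i : 'I_m, i \in s ->
      (gs i w)%:E = Qt (Th w) [set w | (increments N m t i w <= (x i)%:E)%E]}.
    apply: filter_forall => i; have [si|_] := boolP (i \in s); last by apply: aeW.
    by apply: filterS (cp _ _ (measurable_le_event _ (mX i)) (gsE i si)) => w ->.
  apply: filterS3 gE gsE PPw => w gE gsE [_ [ind _]].
  apply: EFin_inj; rewrite gE (ind m t tm s x us) -prodEFin big_seq [RHS]big_seq.
  by apply: eq_bigr => i si; rewrite gsE.
- move=> m t h tm h0 B g g' mB gE g'E.
  have tm' : time_grid m (fun j => t j + h).
    by case: tm => t0 tS; split => [|j jm]; [exact: addr_ge0|rewrite ltrD2r tS].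
  have {}gE := cp _ _ (measurable_vec_event cN B tm) gE.
  have {}g'E := cp _ _ (measurable_vec_event cN B tm') g'E.
  apply: filterS3 gE g'E PPw => w gE g'E [_ [_ [stat _]]].
  by apply: EFin_inj; rewrite gE g'E (stat m t h tm h0 B mB).
- move=> t t0 B g mB gE.
  have {}gE := cp _ _ (measurable_value_event cN B (ltW t0)) gE.
  by apply: filterS2 gE PPw => w -> [_ [_ [_ val]]]; rewrite val.
Qed.

Lemma assertion_iii_i : assertion_iii P N -> assertion_i P N.
Proof.
move=> [Th [Qt [disQ [conQ PPQ]]]]; exists Th.
exact: PP_disintegration_MPP (consistent_disintegrates disQ conQ) PPQ.
Qed.

End poisson_disintegration.

Section mixed_poisson_increments.
Context {R : realType} {d : measure_display} {Omega : measurableType d}.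
Variable N : R -> Omega -> \bar R.
Hypothesis cN : counting_process N.
Variables (P : probability Omega R) (Th : {RV P >-> R}).
Hypothesis mppN : MPP N Th.

Lemma MPP_gt0 : {ae P, forall w, 0 < Th w}.
Proof.
have [H _] := mppN; exists (Th @^-1` ~` `]0, +oo[%classic); split.
- by apply: measurable_preim; apply: measurableC; exact: measurable_itv.
- change (distribution P Th (~` `]0, +oo[%classic) = 0%E).
  by rewrite probability_setC; [rewrite [X in (1 - X)%E]H subee|exact: measurable_itv].
- by move=> w /= Thw; rewrite in_itv/= andbT.
Qed.

(** The Poisson clause for the whole line says that [N t] is real with conditional probability
    one. *)
Lemma prob_pinfty_eq0 t : 0 <= t -> P (~` value_event N t setT) = 0%E.
Proof.
rewrite le_eqVlt => /predU1P[<-|t0].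
  rewrite (_ : value_event _ _ _ = setT) ?setCT ?measure0//.
  by apply/seteqP; split => // w _; exists 0; rewrite N_at0.
have mV := measurable_value_event cN setT (ltW t0).
have [h mh hE] := cond_prob_exists P Th mV.
have [_ [_ [_ val]]] := mppN.
have h1 := val t t0 setT _ measurableT hE.
rewrite probability_setC//; have [_ [_ /(_ setT measurableT)]] := hE.
rewrite preimage_setT setIT => <-.
rewrite (ae_eq_integral (cst 1%E))//.
- by rewrite integral_cst// mul1e [X in (1 - X)%E]probability_setT subee.
- by apply/measurable_EFinP; exact: measurableT_comp.
- by apply: filterS h1 => w -> _; rewrite poissonRT.
Qed.

(** The mass of the values below n, so that n = 0 is the empty event and consecutive differences are
    the weights. *)
Definition poisson_cdf (n : nat) (x : R) : R := \sum_(k < n) poisson_weight x k.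

Lemma measurable_poisson_cdf n : measurable_fun setT (poisson_cdf n).
Proof. by apply: measurable_sum => k; exact: measurable_poisson_weight. Qed.

Lemma poissonR_lt x n : 0 < x ->
  poissonR x `]-oo, n%:R - 1]%classic = (poisson_cdf n x)%:E.
Proof.
move=> x0; rewrite poissonRE//.
rewrite (_ : [set k | _] = `I_n); last first.
  apply/seteqP; split => k /=; rewrite in_itv/= lerBrDr natr1 ler_nat//.
rewrite esum_fset//; last by move=> k _; rewrite lee_fin poisson_weight_ge0// ltW.
by rewrite -fsbig_ord sumEFin.
Qed.

Lemma MPP_value_cdf t n : 0 < t ->
  is_cond_prob P Th (value_event N t `]-oo, n%:R - 1]%classic)
    (fun w => poisson_cdf n (Th w * t)).
Proof.
move=> t0; have [h mh hE] := cond_prob_exists P Th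
  (measurable_value_event cN `]-oo, n%:R - 1]%classic (ltW t0)).
have mcdf : measurable_fun setT (fun x : R => poisson_cdf n (x * t)).
  by apply: measurableT_comp (measurable_poisson_cdf n) _; exact: measurable_funM.
apply: (cond_prob_ae_eq hE); first exact: (sigma_measurable_comp Th mcdf).
have [_ [_ [_ val]]] := mppN.
have := val t t0 `]-oo, n%:R - 1]%classic _ (measurable_itv _) hE.
apply: filterS2 MPP_gt0 => w Th0.
by rewrite poissonR_lt ?mulr_gt0// => -[].
Qed.

Let single_increment (u : nat -> R) (x : R) : set Omega :=
  vec_event (increments N 1 u) [set v | tnth v ord0 <= x].

Let measurable_tnth_le (x : R) : measurable [set v : 1.-tuple R | tnth v ord0 <= x].
Proof.
rewrite (_ : [set v | _] = (fun v : 1.-tuple R => tnth v ord0) @^-1` `]-oo, x]%classic).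
  rewrite -[X in measurable X]setTI.
  by apply: (measurable_tnth ord0) => //; exact: measurable_itv.
by apply/seteqP; split => v /=; rewrite in_itv.
Qed.

Let single_incrementP u x w : single_increment u x w <->
  exists2 r, r <= x & (N (u 1%N) w - N (u 0%N) w)%E = r%:E.
Proof.
split => [[v [vx /(_ ord0) vE]]|[r rx rE]]; first by exists (tnth v ord0).
by exists [tuple r]; split => // j; rewrite (ord1 j).
Qed.

(** Stationarity compares the grid 0, t - s with its translate by s, and N_0 = 0 makes the former
    increment a value. [single_increment] asks for a finite increment while -oo also satisfies the
    inequality; the two events differ by a null set. *)
Lemma MPP_increment_cdf s t n : 0 <= s -> s < t ->
  is_cond_prob P Th [set w | (N t w - N s w <= (n%:R - 1)%:E)%E]
    (fun w => poisson_cdf n (Th w * (t - s))).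
Proof.
move=> s0 st; pose x : R := n%:R - 1; pose u i : R := i%:R * (t - s).
have ts0 : 0 < t - s by rewrite subr_gt0.
have u0 : u 0%N = 0 by rewrite /u mul0r.
have u1 : u 1%N = t - s by rewrite /u mul1r.
have gu : time_grid 1 u.
  by split; [rewrite u0|move=> [|//] _; rewrite u0 u1].
have gus : time_grid 1 (fun i => u i + s).
  by split; [rewrite u0 add0r|move=> [|//] _; rewrite u0 u1 add0r subrK].
have E0 : is_cond_prob P Th (single_increment u x) (fun w => poisson_cdf n (Th w * (t - s))).
  rewrite (_ : single_increment u x = value_event N (t - s) `]-oo, x]%classic).
    exact: MPP_value_cdf.
  apply/seteqP; split => w.
    move=> /single_incrementP[r rx]; rewrite u0 u1 N_at0// sube0 => Nr.
    by exists r; rewrite /= in_itv.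
  move=> [r]; rewrite /= in_itv/= => -[rx Nr]; apply/single_incrementP.
  by exists r => //; rewrite u0 u1 N_at0// sube0.
have mS := measurable_vec_event cN [set v : 1.-tuple R | tnth v ord0 <= x] gus.
have [h mh hE] := cond_prob_exists P Th mS.
have [_ [_ [stat _]]] := mppN.
have E0h := stat 1%N u s gu s0 _ _ _ (measurable_tnth_le x) E0 hE.
have {}hE : is_cond_prob P Th (single_increment (fun i => u i + s) x)
    (fun w => poisson_cdf n (Th w * (t - s))).
  apply: (cond_prob_ae_eq hE); first by case: E0.
  by apply: filterS E0h => w ->.
have mX : measurable [set w | (N t w - N s w <= x%:E)%E].
  by apply/measurable_le_event/(measurable_increment cN) => //; exact: le_trans (ltW st).
apply: (cond_prob_set hE) => //.
  rewrite (_ : _ `\` _ = set0) ?measure0//; apply/seteqP; split => // w [].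
  move=> /single_incrementP[r rx]; rewrite u0 u1 add0r subrK => NE; apply.
  by rewrite /= NE lee_fin.
have t0 : 0 <= t by exact: le_trans (ltW st).
apply/eqP; rewrite -measure_le0 -(prob_pinfty_eq0 t0).
apply: le_measure; rewrite ?inE; first exact: measurableD.
  by apply: measurableC; exact: measurable_value_event.
move=> w [/= Nx nE] [r [_ Nt]]; apply: nE; apply/single_incrementP.
rewrite u0 u1 add0r subrK; have [[k Nk]|Ny] := N_nat_or_pinfty cN w s0.
  by exists (r - k%:R); [move: Nx|]; rewrite Nt Nk.
by have := N_nondecreasing cN w s0 (ltW st); rewrite Ny Nt leye_eq.
Qed.

(** Conditional independence is formulated with inequalities only; exact values are therefore
    written as differences, the form that [prod_setD] handles. *)
Lemma increment_eq_setD s t k w : 0 <= s -> s < t ->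
  (N t w - N s w)%E = (k%:R)%:E <->
  ((N t w - N s w <= (k.+1%:R - 1)%:E) /\ ~ (N t w - N s w <= (k%:R - 1)%:E))%E.
Proof.
move=> s0 st; have t0 : 0 <= t by exact: le_trans (ltW st).
have k1 : k.+1%:R - 1 = k%:R :> R by rewrite -natr1 addrK.
split => [->|]; rewrite k1.
  by split => //; rewrite lee_fin; apply/negP; rewrite -ltNge ltrBlDr ltrDl.
have [[b Nb]|Ny] := N_nat_or_pinfty cN w t0; last first.
  rewrite Ny; have [[a ->]|->] := N_nat_or_pinfty cN w s0; last first.
    by move=> [_ []]; rewrite /= leNye.
  by move=> [] /=; rewrite leye_eq.
have := N_nondecreasing cN w s0 (ltW st); rewrite Nb.
have [[a ->]|->] := N_nat_or_pinfty cN w s0; last by rewrite leye_eq.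
rewrite lee_fin ler_nat => ab [+ /negP]; rewrite -!EFinB -natrB// !lee_fin -ltNge.
rewrite ltrBlDr natr1 ltr_nat ler_nat ltnS => h1 h2.
by congr (_%:R)%:E; apply/eqP; rewrite eqn_leq h1.
Qed.

Lemma MPP_increments_event m t kappa : time_grid m t ->
  is_cond_prob P Th (increments_event N m t kappa)
    (fun w => \prod_(j < m) poisson_weight (Th w * (t j.+1 - t j)) (kappa j)).
Proof.
move=> tm; have [_ [ind _]] := mppN.
pose X := increments N m t; have mX i := measurable_increments cN i tm.
have t_ge0 (i : 'I_m) : 0 <= t i by exact: time_grid_ge0 tm (ltnW (ltn_ord i)).
have t_lt (i : 'I_m) : t i < t i.+1 by case: tm => _; exact.
pose below n i := [set w | (X i w <= ((n : nat)%:R - 1)%:E)%E].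
pose cdf n (i : 'I_m) w := poisson_cdf n (Th w * (t i.+1 - t i)).
pose Rel E x := measurable E /\ is_cond_prob P Th E x.
have [] := @prod_setD Omega Omega 'I_m R Rel (fun i => below (kappa i).+1 i)
  (fun i => below (kappa i) i) (fun i => cdf (kappa i).+1 i) (fun i => cdf (kappa i) i)
  _ _ _ (index_enum 'I_m) (index_enum_uniq _).
- move=> A B x y BA [mA Ax] [mB By]; split; first exact: measurableD.
  exact: cond_probD.
- move=> i w /= /le_trans; apply; rewrite lee_fin lerD2r ler_nat//.
- move=> f s us.
  pose n (i : 'I_m) := if f i then (kappa i).+1 else kappa i.
  have := @cond_indep_prod _ _ _ P Th _ X s (fun i => (n i)%:R - 1) (fun i => cdf (n i) i)
    (ind m t tm) us mX _.
  have -> : [set w | forall i, i \in s ->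
      (if f i then below (kappa i).+1 i else below (kappa i) i) w] =
      [set w | forall i, i \in s -> (X i w <= ((n i)%:R - 1)%:E)%E].
    apply/seteqP; split => w /= H i /H; rewrite /n; by case: (f i).
  have -> : (fun w => \prod_(i <- s) (if f i then cdf (kappa i).+1 i w else cdf (kappa i) i w)) =
      (fun w => \prod_(i <- s) cdf (n i) i w).
    by apply/funext => w; apply: eq_bigr => i _; rewrite /n; case: (f i).
  move=> H; split; first exact: measurable_all_le_event.
  by apply: H => i; exact: MPP_increment_cdf.
move=> _; congr is_cond_prob.
  apply/seteqP; split => w /= H.
    move=> j jm; have := H (Ordinal jm) (mem_index_enum _).
    by move=> /(increment_eq_setD _ _ (t_ge0 (Ordinal jm)) (t_lt (Ordinal jm))).
  move=> i _; apply/(increment_eq_setD _ _ (t_ge0 i) (t_lt i)); exact: H.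
apply/funext => w; apply: eq_bigr => i _.
by rewrite /cdf /poisson_cdf big_ord_recr/= addrAC subrr add0r.
Qed.

Lemma MPP_increments_prob m t kappa : time_grid m t ->
  P (increments_event N m t kappa) =
  (\int[distribution P Th]_(x in posR)
     (\prod_(j < m) poisson_weight (x * (t j.+1 - t j)) (kappa j))%:E)%E.
Proof.
move=> tm; pose f (x : R) := \prod_(j < m) poisson_weight (x * (t j.+1 - t j)) (kappa j).
have mf : measurable_fun setT f.
  apply: measurable_prod => j _; apply: measurableT_comp (measurable_poisson_weight _) _.
  exact: measurable_funM.
have mpos : measurable (posR : set R) by exact: measurable_itv.
have [_ [_ /(_ posR mpos) H]] := MPP_increments_event kappa tm.
rewrite [RHS]ge0_integral_pushforward//=; last 2 first.
- by apply: measurable_funTS; exact/measurable_EFinP.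
- move=> x; rewrite inE /posR /= in_itv/= andbT => x0; rewrite lee_fin prodr_ge0// => j _.
  by rewrite poisson_weight_ge0// mulr_ge0 ?(ltW x0)// subr_ge0 ltW//; case: tm => _ ->.
rewrite [RHS]H probability_setI1//.
- exact: measurable_increments_event.
- exact: measurable_preim.
- by case: mppN.
Qed.

End mixed_poisson_increments.

Lemma assertion_i_iv (R : realType) (d : measure_display) (Omega : measurableType d)
    (P : probability Omega R) (N : R -> Omega -> \bar R) :
  counting_process N -> assertion_i P N -> assertion_iv P N.
Proof.
move=> cN [Th mppN]; exists (distribution P Th); split; first by case: mppN.
move=> m t kappa m0 t0 tS.
by rewrite (MPP_increments_prob cN mppN)//; split => //; rewrite t0.
Qed.

Section exponential_disintegration.
Context {R : realType} {d : measure_display} {Omega : measurableType d}.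
Variable N : R -> Omega -> \bar R.
Hypothesis cN : counting_process N.

(** Each {W_i <= q_i} is the complement of a survival event, and [prod_setD] carries out the
    inclusion-exclusion. *)
Lemma survival_iid_exp (Q : probability Omega R) (theta : R) : 0 < theta ->
  (forall r (w : nat -> R), (forall i, 0 <= w i) ->
    Q [set o | forall i, (i < r)%N -> w i < interarrival N i o] =
    (expR (- (theta * \sum_(i < r) w i)))%:E) ->
  iid_exp N Q theta.
Proof.
move=> theta0 H; split=> // r q.
(* Raising a negative bound to 0 does not change the event, which is empty in both cases since W_i
   is positive. *)
pose w i : R := Num.max 0 (ratr (q i)).
have w0 i : 0 <= w i by rewrite le_max lexx.
pose late i := [set o | w i < interarrival N i o].
pose e (i : nat) (_ : unit) := expR (- (theta * w i)).
pose Rel E (x : unit -> R) := measurable E /\ Q E = (x tt)%:E.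
have [] := @prod_setD Omega unit nat R Rel (fun=> setT) late (fun _ _ => 1) e
  _ _ _ (index_iota 0 r) (iota_uniq _ _).
- move=> X Y x y YX [mX QX] [mY QY]; split; first exact: measurableD.
  rewrite measureD//; last by rewrite [X in (X < _)%E]QX ltry.
  by rewrite setIidr// [X in (X - _)%E]QX [X in (_ - X)%E]QY.
- by [].
- move=> f s us.
  (* The bound 0 imposes no condition, so a set of indices can be completed to an initial
     segment. *)
  pose w' i := if i \in s then (if f i then 0 else w i) else 0.
  have w'0 i : 0 <= w' i by rewrite /w'; case: ifP => // _; case: ifP.
  pose l := (\max_(i <- s) i).+1.
  have sl i : i \in s -> (i < l)%N by move=> si; rewrite ltnS (@leq_bigmax_seq _ s xpredT id i).
  have -> : [set o | forall i, i \in s -> (if f i then setT else late i) o] =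
      [set o | forall i, (i < l)%N -> w' i < interarrival N i o].
    apply/seteqP; split => o /= Ho i.
      move=> _; rewrite /w'; case: ifPn => [/Ho|_]; last exact: interarrival_gt0.
      by case: (f i) => // _; exact: interarrival_gt0.
    by move=> si; have := Ho i (sl i si); rewrite /w' si; case: (f i).
  split; first exact: measurable_survival.
  rewrite H//; congr _%:E.
  rewrite (big_ord_mem_uniq _ (fun i => if f i then 0 else w i) us sl).
  rewrite big_distrr/= -sumrN expR_sum; apply: eq_bigr => i _.
  by rewrite /e; case: (f i) => //; rewrite mulr0 oppr0 expR0.
move=> _; rewrite big_mkord => QE.
transitivity (Q [set o | forall i, i \in index_iota 0 r -> (setT `\` late i) o]).
  congr (Q _); apply/seteqP; split => o /= Ho i.
    rewrite mem_index_iota => /= /Ho Wq; split => //; rewrite /late /= => wW.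
    have qw : ratr (q i) <= w i by rewrite le_max lexx orbT.
    by have := le_lt_trans (le_trans Wq qw) wW; rewrite ltxx.
  move=> ir; have [|_] := Ho i; first by rewrite mem_index_iota.
  rewrite /late /= => /negP; rewrite -leNgt /w le_max => /orP[W0|//].
  by have := interarrival_gt0 cN i o; rewrite ltNge W0.
rewrite QE -prodEFin; apply: eq_bigr => i _.
rewrite -(expo_lawE theta0) expo_law_Nyc /e /w.
case: ifPn => [q0|]; first by rewrite max_r.
by rewrite -ltNge => q0; rewrite max_l ?ltW// mulr0 oppr0 expR0 subrr.
Qed.

(** Under a single member, the cell probabilities are the mixed Poisson formula whose mixing law is
    the Dirac mass at x. Meshes 1/(n+1) and finite words make countably many events, so one null set
    suffices. *)
Lemma MPP_disintegration_iid_exp (P : probability Omega R) (Th : {RV P >-> R}) Qt :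
  MPP N Th -> disintegrates P Th Qt ->
  {ae distribution P Th, forall x, iid_exp N (Qt x) x}.
Proof.
move=> mppN HQ.
have pos : {ae distribution P Th, forall x, 0 < x}.
  have [pos1 _] := mppN; exists (~` `]0, +oo[%classic); split.
  - by apply: measurableC; exact: measurable_itv.
  - by rewrite probability_setC; [rewrite [X in (1 - X)%E]pos1 subee|exact: measurable_itv].
  - by move=> x /= x0; rewrite in_itv/= andbT.
have cells : {ae distribution P Th, forall x, forall k : nat,
    if (unpickle k : option (nat * seq nat)) is Some (n, s)
    then Qt x (cell_event N (n.+1%:R)^-1 s) = (cell_pmf (x * (n.+1%:R)^-1) s)%:E else True}.
  apply/ae_foralln => k; case: unpickle => [[n s]|]; last exact: aeW.
  have tm : time_grid (size s) (fun j => j%:R * (n.+1%:R)^-1 : R).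
    by split => [|j _]; rewrite ?mul0r// ltr_pM2r// ltr_nat.
  have mE := measurable_increments_event cN (nth 0%N s) tm.
  apply: (disintegrates_ae HQ mE).
    by apply: measurableT_comp (measurable_cell_pmf s) _; exact: measurable_funM.
  have := MPP_increments_event cN mppN (nth 0%N s) tm; congr is_cond_prob.
  apply/funext => w /=; rewrite /cell_pmf (big_nth 0%N) big_mkord.
  by apply: eq_bigr => j _; rewrite -mulrBl -natrB// subSnn mul1r.
apply: filterS2 pos cells => x x0 cells; apply: survival_iid_exp => // r w w0.
have mpos : measurable (posR : set R) by exact: measurable_itv.
have dpos : \d_x (posR : set R) = 1%E :> \bar R.
  by rewrite diracE mem_set// /posR /= in_itv/= x0.
rewrite (survival_of_grid (U := dirac x) cN r w0).
  rewrite /laplace integral_dirac//; last first.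
    apply: measurable_funTS; apply/measurable_EFinP; apply: measurableT_comp => //.
    by apply: measurable_funN; exact: measurable_funM.
  by rewrite dpos mul1e.
move=> n s; have := cells (pickle (n, s)); rewrite pickleK => ->.
rewrite integral_dirac//; last first.
  apply: measurable_funTS; apply/measurable_EFinP.
  by apply: measurableT_comp (measurable_cell_pmf s) _; exact: measurable_funM.
by rewrite dpos mul1e.
Qed.

End exponential_disintegration.

Section rational_rectangles.
Context {R : realType} {d : measure_display} {Omega : measurableType d}.
Variable N : R -> Omega -> \bar R.
Hypothesis cN : counting_process N.

Lemma measurable_le_interarrival n x :
  measurable [set w | interarrival N n w <= x].
Proof.
rewrite (_ : [set w | _] = setT `&` interarrival N n @^-1` `]-oo, x]%classic).
  by apply: (measurable_interarrival cN n) => //; exact: measurable_itv.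
by rewrite setTI; apply/seteqP; split => w /=; rewrite in_itv.
Qed.

Lemma measurable_interarrival_rect r (w : nat -> R) :
  measurable [set o | forall k, (k < r)%N -> interarrival N k o <= w k].
Proof.
rewrite (_ : [set o | _] = \bigcap_(k in [set k | (k < r)%N])
    [set o | interarrival N k o <= w k]).
  apply: fin_bigcap_measurable; first exact: finite_II.
  by move=> k _; exact: measurable_le_interarrival.
by apply/seteqP; split => o /= H k; exact: H.
Qed.

Definition rat_rect (s : seq rat) : set Omega :=
  [set w | forall i, (i < size s)%N -> interarrival N i w <= ratr (nth 0 s i)].

Definition exp_cdf (a x : R) : R := if 0 <= x then 1 - expR (- (a * x)) else 0.

Definition exp_rect (s : seq rat) (a : R) : R :=
  \prod_(i < size s) exp_cdf a (ratr (nth 0 s i)).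

Lemma measurable_rat_rect s : measurable (rat_rect s).
Proof. exact: (measurable_interarrival_rect (size s) (fun i => ratr (nth 0 s i))). Qed.

Lemma measurable_exp_rect s : measurable_fun setT (exp_rect s).
Proof.
apply: measurable_prod => i _; rewrite /exp_cdf; case: (0 <= (ratr (nth 0 s i) : R)) => //.
apply: measurable_funB => //; apply: measurableT_comp => //.
by apply: measurable_funN; exact: measurable_funM.
Qed.

Lemma iid_expP (Q : probability Omega R) a :
  iid_exp N Q a <-> 0 < a /\ forall s, Q (rat_rect s) = (exp_rect s a)%:E.
Proof.
split=> -[a0 H]; split=> //.
  move=> s; rewrite -prodEFin.
  transitivity (\prod_(i < size s) exponential_prob a `]-oo, ratr (nth 0%R s i)]%classic)%E.
    exact: H.
  by apply: eq_bigr => i _; rewrite -(expo_lawE a0) expo_law_Nyc.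
move=> r q; transitivity (Q (rat_rect (mkseq q r))).
  congr (Q _); apply/seteqP; split => o /= Ho i; have := Ho i; rewrite size_mkseq => + ir.
    by move=> /(_ ir); rewrite nth_mkseq.
  by move=> /(_ ir); rewrite nth_mkseq.
rewrite H -prodEFin size_mkseq; apply: eq_bigr => i _; rewrite nth_mkseq//.
by rewrite -(expo_lawE a0) expo_law_Nyc.
Qed.

Lemma iid_exp_prod (Q : probability Omega R) a r (w : nat -> R) : iid_exp N Q a ->
  Q [set o | forall k, (k < r)%N -> interarrival N k o <= w k] =
  (\prod_(k < r) Q [set o | (interarrival N k o <= w k)%R])%E.
Proof.
move=> iid; pose B i : set R := `]-oo, w i]%classic.
transitivity (Q [set o | forall i, (i < r)%N -> B i (interarrival N i o)]).
  by congr (Q _); apply/seteqP; split => o /= H i /H; rewrite /B /= in_itv.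
rewrite (iid_exp_rect cN iid); last by move=> i; exact: measurable_itv.
apply: eq_bigr => i _.
rewrite -(@iid_exp_marginal _ _ _ _ cN _ _ iid i); last exact: measurable_itv.
by congr (Q _); apply/seteqP; split => o /=; rewrite /B /= in_itv.
Qed.

Lemma measurable_prod_prob d' (T : measurableType d') (K : T -> probability Omega R)
    (E : nat -> set Omega) r :
  (forall F, measurable F -> measurable_fun setT (K ^~ F)) ->
  (forall k, measurable (E k)) ->
  measurable_fun setT (fun x => \prod_(k < r) K x (E k))%E.
Proof.
move=> mK mE.
rewrite (_ : (fun x => _) = (fun x : T => (\prod_(k < r) fine (K x (E k)))%:E)).
  apply/measurable_EFinP; apply: measurable_prod => k _; apply: measurableT_comp => //.
  exact: mK.
apply/funext => x; rewrite -prodEFin; apply: eq_bigr => k _.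
by rewrite fineK// fin_num_measure.
Qed.

Lemma ae_forall_seq_rat d' (T : measurableType d') (mu : probability T R)
    (F : T -> seq rat -> Prop) :
  (forall s, {ae mu, forall x, F x s}) -> {ae mu, forall x, forall s, F x s}.
Proof.
move=> H; pose code (k : nat) : seq rat := odflt [::] (unpickle k).
have codeK s : code (pickle s) = s by rewrite /code pickleK.
have key : {ae mu, forall x, forall k : nat, F x (code k)}.
  by apply/ae_foralln => k; exact: H.
apply: (@filterS _ _ (ae_filter_ringOfSetsType mu) _ _ _ key) => x Fx s.
by rewrite -(codeK s).
Qed.

End rational_rectangles.

Section exp_disintegrated.
Context {R : realType} {d : measure_display} {Omega : measurableType d}.
Variable N : R -> Omega -> \bar R.
Hypothesis cN : counting_process N.
Variables (P : probability Omega R) (Th : {RV P >-> R}).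
Variable Qt : R -> probability Omega R.
Hypothesis HQ : disintegrates P Th Qt.
Hypothesis expQ : {ae distribution P Th, forall x, iid_exp N (Qt x) x}.

Lemma exp_disintegrated_iii : assertion_iii P N.
Proof.
exists Th, Qt; split; first exact: disintegrates_disintegration.
split; first exact: disintegrates_consistent.
apply: filterS expQ => x iid; have x0 := iid.1.
apply: (PP_of_increments cN x0) => m t kappa tm.
exact: (iid_exp_increments cN iid).
Qed.

(** Generates B(Sigma) on the index set R, a sigma-algebra contained in the Borel one; [nu] is the
    law of [Th] viewed on it. *)
Let G : set (set R) := [set A | exists (E : set Omega) (B : set (\bar R)),
  measurable E /\ measurable B /\ A = (Qt ^~ E) @^-1` B].

Let Y := g_sigma_algebraType G.

Let measurable_law E : measurable E -> measurable_fun setT (fun y : Y => Qt y E).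
Proof.
move=> mE _ B mB; rewrite setTI; apply: sub_sigma_algebra; by exists E, B.
Qed.

Let mid : measurable_fun setT (id : R -> Y).
Proof.
apply: (@measurability _ _ R Y setT id G) => // _ [_ [E [B [mE [mB ->]]]] <-].
by rewrite setTI /=; have := HQ.1 E mE measurableT B mB; rewrite setTI.
Qed.

Let nu : probability Y R := distribution (distribution P Th) (mfun_Sub (mem_set mid)).

(** A Borel null set need not lie in a measurable null set of [Y]. The set where two [Y]-measurable
    functions differ is itself measurable there, so their almost sure equality does pass to [nu]. *)
Let ae_nu (f g : Y -> R) : measurable_fun setT f -> measurable_fun setT g ->
  {ae distribution P Th, forall x, f x = g x} -> {ae nu, forall y, f y = g y}.
Proof.
move=> mf mg [A [mA A0 sA]].
have mD : measurable [set y : Y | f y != g y].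
  have -> : [set y : Y | f y != g y] = setT `&` (fun y : Y => f y == g y) @^-1` [set false].
    by rewrite setTI; apply/seteqP; split => y /=; [move/negbTE|move=> ->].
  exact: (measurable_fun_eqr mf mg).
exists [set y : Y | f y != g y]; split => //; last by move=> y /= /eqP.
apply/eqP; rewrite -measure_le0 -A0.
change (distribution P Th [set x | f x != g x] <= distribution P Th A)%E.
apply: le_measure; rewrite ?inE //.
  by have := mid measurableT mD; rewrite setTI.
by move=> y /= /eqP fg; exact: sA.
Qed.

(* The identity of R need not be measurable for the sigma-algebra generated by the
   laws, so the rate is recovered from the law. *)
Let tail (y : Y) : R := fine (Qt y (interarrival N 0 @^-1` `]1, +oo[%classic)).

Let alpha (y : Y) : R := if 0 < tail y < 1 then - ln (tail y) else 1.

Let alpha_gt0 y : 0 < alpha y.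
Proof.
by rewrite /alpha; case: ifPn => [/andP[t0 t1]|_]; rewrite ?oppr_gt0 ?ln_lt0 ?t0 ?ltr01.
Qed.

Let measurable_tail : measurable_fun setT tail.
Proof.
apply: measurableT_comp => //; apply: measurable_law.
rewrite -[X in measurable X]setTI.
by apply: (measurable_interarrival cN 0 measurableT); exact: measurable_itv.
Qed.

Let measurable_alpha : measurable_fun setT alpha.
Proof.
apply: measurable_fun_ifT => //.
  by apply: measurable_and; apply: measurable_fun_ltr.
by apply: measurable_funN; apply: measurableT_comp => //; exact: measurable_ln.
Qed.

Let alphaE : {ae distribution P Th, forall x, alpha x = x}.
Proof.
apply: filterS expQ => x iid; have x0 := iid.1.
have tailE : tail x = expR (- x).
  rewrite /tail (iid_exp_marginal cN iid); last exact: measurable_itv.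
  by rewrite -(expo_lawE x0) expo_law_oy max_r// mulr1.
by rewrite /alpha tailE expR_gt0 expR_lt1 oppr_lt0 x0 expRK opprK.
Qed.

Let iid_alpha : {ae nu, forall y, iid_exp N (Qt y) (alpha y)}.
Proof.
have key : {ae nu, forall y, forall s,
    fine (Qt y (rat_rect N s)) = exp_rect s (alpha y)}.
  apply: ae_forall_seq_rat => s; apply: ae_nu.
  - by apply: measurableT_comp => //; apply: measurable_law; exact: measurable_rat_rect.
  - exact: measurableT_comp (measurable_exp_rect s) measurable_alpha.
  by apply: filterS2 expQ alphaE => x /iid_expP[_ QE] ->; rewrite QE.
apply: (@filterS _ _ (ae_filter_ringOfSetsType nu) _ _ _ key) => y H.
apply/iid_expP; split => [|s]; first exact: alpha_gt0.
by rewrite -H fineK// fin_num_measure//; exact: measurable_rat_rect.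
Qed.

Lemma exp_disintegrated_ii : assertion_ii P N.
Proof.
exists _, Y, Qt, nu, alpha; split => //; split; first exact: measurable_alpha.
split; first exact: alpha_gt0.
split.
  apply: (@filterS _ _ (ae_filter_ringOfSetsType nu) _ _ _ iid_alpha) => y iid.
  split; first exact: (iid_exp_indep cN iid).
  by move=> n B mB; exact: (iid_exp_marginal cN iid).
move=> r w r0 w0.
have mE k : measurable [set o | interarrival N k o <= w k] by exact: measurable_le_interarrival.
transitivity (\int[distribution P Th]_x \prod_(k < r)
    Qt x [set o | (interarrival N k o <= w k)%R])%E; last first.
  rewrite [RHS]ge0_integral_pushforward//; last by move=> y _; apply: prode_ge0.
  exact: (measurable_prod_prob r measurable_law mE).
rewrite -[X in P X]setIT -(preimage_setT Th) -HQ.2//; last exact: measurable_interarrival_rect.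
apply: ae_eq_integral => //.
- by apply: HQ.1; exact: measurable_interarrival_rect.
- exact: (measurable_prod_prob r HQ.1 mE).
by apply: filterS expQ => x iid _; exact: (iid_exp_prod cN r w iid).
Qed.

End exp_disintegrated.

(** * Survival functions depending on the total time *)

Section mixture.
Context {R : realType} {dY dO : measure_display}.
Context {Y : measurableType dY} {Omega : measurableType dO}.
Variables (nu : probability Y R) (Py : Y -> probability Omega R).
Hypothesis mPy : forall E, measurable E -> measurable_fun setT (Py ^~ E).

(** The measurability proof is an argument so that the measure structures declared below on
    [mixture_of mPy] can be inferred. *)
Definition mixture_of of (forall E, measurable E -> measurable_fun setT (Py ^~ E)) :
  set Omega -> \bar R := fun E => (\int[nu]_y Py y E)%E.

Let mixture := mixture_of mPy.

Let mixture0 : mixture set0 = 0%E.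
Proof. by rewrite /mixture /mixture_of integral0_eq. Qed.

Let mixture_ge0 E : (0 <= mixture E)%E.
Proof. exact: integral_ge0. Qed.

Let mixture_sigma_additive : semi_sigma_additive mixture.
Proof.
move=> F mF tF mUF; rewrite [X in _ --> X](_ : _ = \sum_(n <oo) mixture (F n))%E.
  by apply: is_cvg_nneseries => n _ _; exact: mixture_ge0.
rewrite /mixture /mixture_of -integral_nneseries//; last by move=> n; exact: mPy.
by apply: eq_integral => y _; rewrite measure_semi_bigcup.
Qed.

HB.instance Definition _ := isMeasure.Build _ _ _ (mixture_of mPy)
  mixture0 mixture_ge0 mixture_sigma_additive.

Let mixture_setT : mixture setT = 1%E.
Proof.
rewrite /mixture /mixture_of (eq_integral (cst 1%E)) => [|y _]; last exact: probability_setT.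
by rewrite integral_cst// mul1e; exact: probability_setT.
Qed.

HB.instance Definition _ := Measure_isProbability.Build _ _ _ (mixture_of mPy) mixture_setT.

Definition mixture_prob : probability Omega R := mixture_of mPy.

Lemma mixture_probE E : mixture_prob E = (\int[nu]_y Py y E)%E. Proof. by []. Qed.

End mixture.

Section survival_sum.
Context {R : realType} {d : measure_display} {Omega : measurableType d}.
Variable N : R -> Omega -> \bar R.
Hypothesis cN : counting_process N.
Variable P : probability Omega R.

(** The common consequence of (ii) and (iv) from which (i) is recovered. *)
Definition survival_of_sum : Prop := exists L : R -> \bar R,
  forall r (w : nat -> R), (forall i, 0 <= w i) ->
    P [set o | forall i, (i < r)%N -> w i < interarrival N i o] = L (\sum_(i < r) w i).

Lemma assertion_iv_survival : assertion_iv P N -> survival_of_sum.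
Proof.
move=> [U [U1 mppU]]; exists (laplace U) => r w w0.
apply: (survival_of_grid cN) => // n [|k s].
  (* [MPP_U] speaks of at least one increment; for the empty word both sides are 1, because U has
     mass 1 on the positive half-line. *)
  rewrite (_ : cell_event _ _ _ = setT); last by apply/seteqP; split.
  rewrite probability_setT (eq_integral (cst 1%E)).
    by rewrite integral_cst ?mul1e//; exact: measurable_itv.
  by move=> x _; rewrite /cell_pmf big_nil.
pose delta : R := (n.+1%:R)^-1; set s' := k :: s.
have := mppU (size s') (fun j => j%:R * delta) (nth 0%N s') isT (mul0r _).
move=> -> //; last by move=> j _; rewrite ltr_pM2r ?ltr_nat// /delta invr_gt0.
apply: eq_integral => x _; rewrite /cell_pmf (big_nth 0%N) big_mkord; congr _%:E.
by apply: eq_bigr => j _; rewrite -mulrBl -natrB// subSnn mul1r.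
Qed.

(** The formula in (ii) covers lower rectangles with positive bounds. These determine the law of W,
    which is therefore its law under the mixture of the [Py], and survival events are computed
    there. *)
Lemma assertion_ii_survival : assertion_ii P N -> survival_of_sum.
Proof.
move=> [dY [Y [Py [nu [alpha [YE [malpha [alpha0 [iid PE]]]]]]]]].
have mPy E : measurable E -> measurable_fun setT (Py ^~ E).
  move=> mE _ B mB; rewrite setTI YE; apply: sub_gen_smallest.
  by exists E, B.
have {}iid : {ae nu, forall y, iid_exp N (Py y) (alpha y)}.
  apply: filterS iid => y [ind marg]; split => // r q.
  have := ind (index_iota 0 r) (fun i => ratr (q i)) (iota_uniq _ _).
  rewrite big_mkord => H.
  transitivity (Py y [set w | forall i, i \in index_iota 0 r ->
      ((interarrival N i w)%:E <= (ratr (q i))%:E)%E]).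
    congr (Py y _); apply/seteqP; split => w /= Hw i.
      by rewrite mem_index_iota lee_fin; exact: Hw.
    by move=> ir; have := Hw i; rewrite mem_index_iota lee_fin; exact.
  rewrite H; apply: eq_bigr => i _; rewrite -(marg i); last exact: measurable_itv.
  by congr (Py y _); apply/seteqP; split => w /=; rewrite in_itv.
pose M := mixture_prob nu mPy.
have PM A : measurable A -> distribution P (interarrival_mfun cN) A =
    distribution M (interarrival_mfun cN) A.
  apply: seq_space_measure_unique => r q.
  pose E := [set o | forall k, (k < r)%N -> interarrival N k o <= ratr (q k)].
  change (P E = M E).
  have [r0|r0] := posnP r.
    have -> : E = setT by apply/seteqP; split => // o _ k; rewrite r0.
    by rewrite !probability_setT.
  have [q0|/existsNP[k /not_implyP[kr /negP]]] :=
      pselect (forall k, (k < r)%N -> 0 < (ratr (q k) : R)).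
    rewrite PE//; apply: ae_eq_integral => //.
    - apply: (@measurable_prod_prob _ _ _ _ _ _
        (fun k => [set o | interarrival N k o <= ratr (q k)])) => // k.
      exact: measurable_le_interarrival.
    - exact: mPy _ (measurable_interarrival_rect cN r (fun k => ratr (q k))).
    by apply: filterS iid => y iid _; rewrite (iid_exp_prod cN r (fun k => ratr (q k)) iid).
  (* A nonpositive bound makes the rectangle empty. *)
  rewrite -leNgt => qk.
  have -> : E = set0.
    apply/seteqP; split => // o /(_ k kr) Wk.
    by have := interarrival_gt0 cN k o; rewrite ltNge (le_trans Wk).
  by rewrite !measure0.
exists (fun x => \int[nu]_y (expR (- (alpha y * x)))%:E)%E => r w w0.
pose S : set (seq_space R) := [set x | forall i, (i < r)%N -> w i < x i].
have mS : measurable S.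
  rewrite (_ : S = \bigcap_(i in [set i | (i < r)%N])
      ((fun x : seq_space R => x i) @^-1` `]w i, +oo[%classic)).
    apply: fin_bigcap_measurable; first exact: finite_II.
    move=> i _; rewrite -[X in measurable X]setTI.
    by apply: (measurable_coord i measurableT); exact: measurable_itv.
  apply/seteqP; split => x /= H i; first by move=> /H /=; rewrite in_itv/= andbT.
  by move=> /(H i); rewrite /= in_itv/= andbT.
transitivity (M [set o | forall i, (i < r)%N -> w i < interarrival N i o]); first exact: PM mS.
rewrite /M mixture_probE; apply: ae_eq_integral => //.
- exact: mPy _ (measurable_survival cN r w).
- apply/measurable_EFinP; apply: measurableT_comp => //.
  by apply: measurable_funN; exact: measurable_funM.
apply: filterS iid => y iid _.
pose B i : set R := `]w i, +oo[%classic.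
transitivity (Py y [set o | forall i, (i < r)%N -> B i (interarrival N i o)]).
  by congr (Py y _); apply/seteqP; split => o /= H i /H; rewrite /B /= in_itv/= andbT.
rewrite (iid_exp_rect cN iid); last by move=> i; exact: measurable_itv.
rewrite big_distrr/= -sumrN expR_sum -prodEFin; apply: eq_bigr => i _.
by rewrite -(expo_lawE (alpha0 y)) expo_law_oy max_r.
Qed.

End survival_sum.

(** Cauchy's functional equation on the positive rationals: the m-th power of G (n/m) is the n-th
    power of G 1. If G 1 were 0, all G (1/n) would vanish and ]0, +oo[ would have no mass; if G 1
    were 1, all G n would be 1 and no mass would remain on the line. *)
Lemma multiplicative_tail_exp (R : realType) (mu : probability R R)
    (G := fun q : rat => 1 - fine (mu `]-oo, ratr q]%classic)) :
  mu `]0, +oo[%classic = 1%E ->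
  (forall p q, 0 < p -> 0 < q -> G p * G q = G (p + q)) ->
  0 < G 1 < 1 /\
  forall q, fine (mu `]-oo, ratr q]%classic) = exp_cdf (- ln (G 1)) (ratr q).
Proof.
move=> pos mult.
have mufin q : mu `]-oo, ratr q]%classic \is a fin_num.
  by apply: fin_num_measure; exact: measurable_itv.
have Gfine q : mu `]-oo, ratr q]%classic = (1 - G q)%:E by rewrite /G subKr fineK.
have Goo q : mu `]ratr q, +oo[%classic = (G q)%:E.
  rewrite -setCitvl probability_setC; last exact: measurable_itv.
  by rewrite [X in (1 - X)%E]Gfine -EFinB subKr.
have G0 q : 0 <= G q by rewrite -lee_fin -Goo.
have G1 q : G q <= 1.
  by rewrite /G lerBlDr lerDl fine_ge0.
have GX q n : 0 < q -> G (n.+1%:R * q) = G q ^+ n.+1.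
  move=> q0; elim: n => [|n IH]; first by rewrite mul1r.
  by rewrite exprS -IH mult ?mulr_gt0// -[n.+2%:R]natr1 mulrDl mul1r addrC.
have bigcup0 (A : nat -> set R) : (forall n, measurable (A n)) ->
    (forall n, mu (A n) = 0%E) -> mu (\bigcup_n A n) = 0%E.
  move=> mA A0; have mU : measurable (\bigcup_n A n) by exact: bigcupT_measurable.
  apply: (negligibleP mu mU).1; apply: negligible_bigcup => n.
  exact: (negligibleP mu (mA n)).2 (A0 n).
have G1_gt0 : 0 < G 1.
  rewrite lt_neqAle G0 andbT; apply/eqP => G10.
  have Gn0 n : G (n.+1%:R^-1) = 0.
    have /GX : 0 < (n.+1%:R^-1 : rat) by rewrite invr_gt0.
    move=> /(_ n); rewrite divff ?pnatr_eq0// -G10 => /esym/eqP.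
    by rewrite expf_eq0/= => /eqP.
  have : mu (\bigcup_n `](ratr (n.+1%:R^-1 : rat) : R), +oo[%classic) = 0%E.
    by apply: bigcup0 => n; [exact: measurable_itv|rewrite Goo Gn0].
  rewrite (_ : \bigcup_n _ = `]0, +oo[%classic) ?pos; first by move=> [] /eqP; rewrite oner_eq0.
  apply/seteqP; split => x /=.
    move=> [n _]; rewrite /= !in_itv/= !andbT; apply: lt_trans.
    by rewrite ltr0q invr_gt0.
  rewrite in_itv/= andbT => x0; exists (Num.truncn x^-1) => //=.
  rewrite in_itv/= andbT fmorphV rmorph_nat.
  by rewrite invf_plt ?posrE//; exact: truncnS_gt.
have G1_lt1 : G 1 < 1.
  rewrite lt_neqAle G1 andbT; apply/eqP => G11.
  have Gn1 n : G (n.+1%:R) = 1 by rewrite -[n.+1%:R]mulr1 GX// G11 expr1n.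
  have : mu (\bigcup_n `]-oo, (ratr (n.+1%:R : rat) : R)]%classic) = 0%E.
    by apply: bigcup0 => n; [exact: measurable_itv|rewrite Gfine Gn1 subrr].
  rewrite (_ : \bigcup_n _ = setT) ?probability_setT; first by move=> [] /eqP; rewrite oner_eq0.
  apply/seteqP; split => // x _; exists (Num.truncn `|x|) => //=.
  rewrite in_itv/= ratr_nat (le_trans (ler_norm _))//.
  by apply: ltW; exact: truncnS_gt.
split => [|q]; first by rewrite G1_gt0.
rewrite /exp_cdf; have [q0|q0] := ltP 0 q; last first.
  rewrite (_ : fine _ = 0).
    case: ifPn => // q0'; have -> : q = 0 by apply/eqP; rewrite eq_le q0 -(ler0q R).
    by rewrite rmorph0 mulr0 oppr0 expR0 subrr.
  suff -> : mu `]-oo, ratr q]%classic = 0%E by [].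
  apply/eqP; rewrite -measure_le0; apply: (@le_trans _ _ (mu (~` `]0, +oo[%classic))).
    apply: le_measure; rewrite ?inE; [exact: measurable_itv|apply: measurableC; exact: measurable_itv|].
    move=> x /=; rewrite !in_itv/= andbT => xq; apply/negP; rewrite -leNgt (le_trans xq)//.
    by rewrite -(rmorph0 (ratr : rat -> R)) ler_rat.
  by rewrite probability_setC ?pos ?subee//; exact: measurable_itv.
rewrite ltW ?ltr0q// -[LHS](subKr 1); congr (1 - _); rewrite -/(G q).
have [n nE] : exists n, numq q = n.+1%:Z.
  have : 0 < numq q by rewrite numq_gt0.
  by case: (numq q) => [[//|n]|//] _; exists n.
have [m mE] : exists m, denq q = m.+1%:Z.
  have := denq_gt0 q; by case: (denq q) => [[//|m]|//] _; exists m.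
have qE : q = n.+1%:R / m.+1%:R by rewrite -[LHS]divq_num_den nE mE.
have pow : G q ^+ m.+1 = G 1 ^+ n.+1.
  by rewrite -!GX// mulr1; congr G; rewrite qE mulrCA mulfV ?pnatr_eq0// mulr1.
have Gq0 : 0 < G q.
  rewrite lt_neqAle G0 andbT; apply/eqP => Gq; move: pow; rewrite -Gq expr0n/= => /esym/eqP.
  by rewrite expf_eq0/= gt_eqF.
rewrite -[LHS]lnK ?posrE//; congr expR.
have := congr1 (@ln R) pow; rewrite !lnXn// => lnE.
rewrite [in RHS]qE rmorphM/= fmorphV !rmorph_nat mulNr opprK.
apply: (mulIf (x := m.+1%:R)); first by rewrite pnatr_eq0.
by rewrite mulr_natr lnE mulrA mulfVK ?pnatr_eq0// mulr_natr.
Qed.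

(** * Conditionally i.i.d. interarrival times are conditionally exponential *)

Section conditionally_iid.
Context {R : realType} {d : measure_display} {Omega : measurableType d}.
Variable N : R -> Omega -> \bar R.
Hypothesis cN : counting_process N.
Variables (P : probability Omega R) (Th : {RV P >-> R}).
Variables (h : R -> R) (K : R -> probability R R).
Hypothesis mrpN : eMRP P N Th h K.

Definition cond_cdf (u : R) (w : Omega) : R := fine (K (h (Th w)) `]-oo, u]%classic).

Definition cond_tail (u : R) (w : Omega) : R := 1 - cond_cdf u w.

Let measurable_W n : measurable_fun setT (fun w => (interarrival N n w)%:E).
Proof. by apply/measurable_EFinP; exact: measurable_interarrival. Qed.

Let le_eventE n (u : R) :
  [set w | ((interarrival N n w)%:E <= u%:E)%E] = interarrival N n @^-1` `]-oo, u]%classic.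
Proof. by apply/seteqP; split => w /=; rewrite in_itv/= lee_fin. Qed.

Lemma cond_cdfP n u :
  is_cond_prob P Th [set w | ((interarrival N n w)%:E <= u%:E)%E] (cond_cdf u).
Proof. by case: mrpN => _ [_ H]; rewrite le_eventE; exact: H (measurable_itv _). Qed.

Lemma cond_cdf_prod (s : seq nat) (u : nat -> R) : uniq s ->
  is_cond_prob P Th [set w | forall i, i \in s -> ((interarrival N i w)%:E <= (u i)%:E)%E]
    (fun w => \prod_(i <- s) cond_cdf (u i) w).
Proof.
move=> us; have [_ [ind _]] := mrpN.
by apply: (cond_indep_prod ind us measurable_W) => i; exact: cond_cdfP.
Qed.

Lemma cond_prob_setT : is_cond_prob P Th setT (fun=> 1).
Proof.
have := @cond_probP _ _ _ P Th setT (cst 1) (measurable_cst _); apply.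
  exact: finite_measure_integrable_cst.
by move=> C mC; rewrite (integral_cst _ mC 1) mul1e setTI.
Qed.

Lemma cond_tail_prod (s : seq nat) (u : nat -> R) : uniq s ->
  is_cond_prob P Th [set w | forall i, i \in s -> u i < interarrival N i w]
    (fun w => \prod_(i <- s) cond_tail (u i) w).
Proof.
move=> us; pose below i := [set w | ((interarrival N i w)%:E <= (u i)%:E)%E].
pose Rel E x := measurable E /\ is_cond_prob P Th E x.
have [] := @prod_setD Omega Omega nat R Rel (fun=> setT) below (fun _ _ => 1)
  (fun i => cond_cdf (u i)) _ _ _ s us.
- move=> X Y x y YX [mX Xx] [mY Yy]; split; first exact: measurableD.
  exact: cond_probD.
- by [].
- move=> f {us}s us; pose s' := [seq i <- s | ~~ f i].
  have us' : uniq s' by exact: filter_uniq.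
  have := cond_cdf_prod u us'.
  have mE := measurable_all_le_event s' u measurable_W.
  have -> : [set w | forall i, i \in s -> (if f i then setT else below i) w] =
      [set w | forall i, i \in s' -> ((interarrival N i w)%:E <= (u i)%:E)%E].
    apply/seteqP; split => w /= H i.
      by rewrite mem_filter => /andP[/negbTE fi /H]; rewrite fi.
    by move=> si; case: ifPn => // fi; apply: H; rewrite mem_filter fi.
  have -> : (fun w => \prod_(i <- s) (if f i then 1 else cond_cdf (u i) w)) =
      (fun w => \prod_(i <- s') cond_cdf (u i) w).
    apply/funext => w; rewrite [RHS]big_filter [RHS]big_mkcond/=.
    by apply: eq_bigr => i _; case: (f i).
  by [].
move=> _; congr is_cond_prob; apply/seteqP; split => w /= H i /H.
  by move=> [_ /negP]; rewrite -ltNge lte_fin.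
by move=> uW; split => //; apply/negP; rewrite -ltNge lte_fin.
Qed.

Let seq_tail_prod (us : seq R) :
  is_cond_prob P Th [set w | forall i, (i < size us)%N -> nth 0 us i < interarrival N i w]
    (fun w => \prod_(u <- us) cond_tail u w).
Proof.
have := cond_tail_prod (nth 0 us) (iota_uniq 0 (size us)).
congr is_cond_prob; last by apply/funext => w; rewrite [RHS](big_nth 0) /index_iota subn0.
by apply/seteqP; split => w /= H i; have := H i; rewrite mem_iota leq0n add0n /=; apply.
Qed.

(* The mean square of the difference is a combination of probabilities of events
   {W_i > w_i} with the same total time 2 (u + v), with coefficients 1, -2, 1. *)
Lemma cond_cdf_mult u v : survival_of_sum N P -> 0 <= u -> 0 <= v ->
  {ae P, forall w, cond_tail u w * cond_tail v w = cond_tail (u + v) w}.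
Proof.
move=> [L HL] u0 v0.
pose F (us : seq R) w := \prod_(u <- us) cond_tail u w.
have FL (us : seq R) : all (fun u => 0 <= u) us ->
    (\int[P]_w (F us w)%:E)%E = L (\sum_(u <- us) u).
  move=> us0; have [_ [_ /(_ setT measurableT)]] := seq_tail_prod us.
  rewrite preimage_setT setIT => ->; rewrite HL => [|i]; last first.
    by case: (ltnP i (size us)) => si; [exact: (all_nthP 0 us0)|rewrite nth_default].
  by rewrite [in RHS](big_nth 0) big_mkord.
have iF us : P.-integrable setT (EFin \o F us) by case: (seq_tail_prod us) => _ [].
have u4 : all (fun u => 0 <= u) [:: u; v; u; v] by rewrite /= u0 v0.
have u3 : all (fun u => 0 <= u) [:: u; v; u + v] by rewrite /= u0 v0 addr_ge0.
have u2 : all (fun u => 0 <= u) [:: u + v; u + v] by rewrite /= addr_ge0.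
pose D w := cond_tail u w * cond_tail v w - cond_tail (u + v) w.
have DE : (fun w => (D w ^+ 2)%:E) =
    (fun w => ((F [:: u; v; u; v] w)%:E - (F [:: u; v; u + v] w)%:E) +
              ((F [:: u + v; u + v] w)%:E - (F [:: u; v; u + v] w)%:E))%E.
  apply/funext => w; rewrite -!EFinB -EFinD; congr _%:E.
  by rewrite /F /D !big_cons !big_nil; ring.
have mD : measurable_fun setT D.
  have mG := sigma_measurable_fun (proj1 (seq_tail_prod [:: _])).
  have mg x : measurable_fun setT (cond_tail x).
    by have := mG x; congr measurable_fun; apply/funext => w; rewrite big_seq1.
  by apply: measurable_funB => //; exact: measurable_funM.
have D0 : (\int[P]_w `|(D w ^+ 2)%:E| = 0)%E.
  under eq_integral do rewrite gee0_abs ?lee_fin ?sqr_ge0//.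
  rewrite DE integralD//; [|exact: (integrableB measurableT (iF _) (iF _))..].
  have fin3 : (\int[P]_w (F [:: u; v; u + v] w)%:E)%E \is a fin_num.
    exact: (integrable_fin_num measurableT (iF _)).
  have E4 : (\int[P]_w (F [:: u; v; u; v] w)%:E = \int[P]_w (F [:: u; v; u + v] w)%:E)%E.
    by rewrite !FL//; congr L; rewrite !big_cons big_nil; ring.
  have E2 : (\int[P]_w (F [:: u + v; u + v] w)%:E = \int[P]_w (F [:: u; v; u + v] w)%:E)%E.
    by rewrite !FL//; congr L; rewrite !big_cons big_nil; ring.
  rewrite (integralB measurableT (iF [:: u; v; u; v]) (iF [:: u; v; u + v])).
  rewrite (integralB measurableT (iF [:: u + v; u + v]) (iF [:: u; v; u + v])).
  by rewrite [X in (X - _ + _)%E]E4 [X in (_ + (X - _))%E]E2 subee// adde0.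
have mD2 : measurable_fun setT (fun w => (D w ^+ 2)%:E).
  by apply/measurable_EFinP; exact: measurable_funX.
have := (ae_eq_integral_abs P measurableT mD2).1 D0.
by apply: filterS => w /(_ I) [] /eqP; rewrite sqrf_eq0 subr_eq0 => /eqP.
Qed.

Hypothesis HL : survival_of_sum N P.

Let pos_ae : {ae P, forall w, K (h (Th w)) `]0, +oo[%classic = 1%E}.
Proof.
have [_ [_ H]] := mrpN.
have W0 : interarrival N 0 @^-1` `]0, +oo[%classic = setT.
  by apply/seteqP; split => // w _; rewrite /= in_itv/= interarrival_gt0.
have := H 0%N `]0, +oo[%classic (measurable_itv _); rewrite W0 => H0.
apply: filterS (cond_prob_unique H0 cond_prob_setT) => w K1.
by rewrite -[LHS]fineK ?K1// fin_num_measure//; exact: measurable_itv.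
Qed.

Let mult_ae : {ae P, forall w, forall p q : rat, 0 < p -> 0 < q ->
  cond_tail (ratr p) w * cond_tail (ratr q) w = cond_tail (ratr (p + q)) w}.
Proof.
(* A pair of rationals is coded by the first two entries of a list, to quantify over countably many
   pairs at once. *)
have key : {ae P, forall w, forall s : seq rat, 0 < nth 0 s 0 -> 0 < nth 0 s 1 ->
    cond_tail (ratr (nth 0 s 0)) w * cond_tail (ratr (nth 0 s 1)) w =
    cond_tail (ratr (nth 0 s 0 + nth 0 s 1)) w}.
  apply: ae_forall_seq_rat => s.
  have [p0|p0] := ltP 0 (nth 0 s 0); last by apply: aeW.
  have [q0|q0] := ltP 0 (nth 0 s 1); last by apply: aeW.
  have := cond_cdf_mult (u := ratr (nth 0 s 0)) (v := ratr (nth 0 s 1)) HL _ _.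
  rewrite -rmorphD/= !ler0q => /(_ (ltW p0) (ltW q0)).
  by apply: filterS => w ->.
by apply: filterS key => w H p q; exact: (H [:: p; q]).
Qed.

(** The value 1 outside the event where the tail lies strictly between 0 and 1 keeps the rate
    positive for every outcome. *)
Definition exp_rate (w : Omega) : R :=
  if 0 < cond_tail 1 w < 1 then - ln (cond_tail 1 w) else 1.

Lemma exp_rate_gt0 w : 0 < exp_rate w.
Proof.
by rewrite /exp_rate; case: ifPn => [/andP[t0 t1]|_]; rewrite ?oppr_gt0 ?ln_lt0 ?t0 ?ltr01.
Qed.

Lemma sigma_measurable_exp_rate : sigma_measurable Th exp_rate.
Proof.
have mt : measurable_fun setT (cond_tail 1 : g_sigma_algebra_preimageType Th -> R).
  apply/sigma_measurableP; have [mt _] := cond_prob_setT.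
  by apply: sigma_measurableB mt _; case: (cond_cdfP 0 1).
apply/sigma_measurableP; apply: measurable_fun_ifT => //.
  by apply: measurable_and; apply: measurable_fun_ltr.
by apply: measurable_funN; apply: measurableT_comp => //; exact: measurable_ln.
Qed.

Lemma cond_cdf_exp : {ae P, forall w, forall q : rat,
  cond_cdf (ratr q) w = exp_cdf (exp_rate w) (ratr q)}.
Proof.
apply: filterS2 pos_ae mult_ae => w pos mult q.
have ratr1 : ratr 1 = 1 :> R by rewrite rmorph1.
have [] := multiplicative_tail_exp pos mult.
rewrite ratr1 => t01 E.
transitivity (exp_cdf (- ln (cond_tail 1 w)) (ratr q)); first exact: E.
by rewrite /exp_rate ifT.
Qed.

Let rate : {RV P >-> R} := mfun_Sub (mem_set (sigma_measurable_fun sigma_measurable_exp_rate)).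

(** A version given [Th] that is a function of the rate is a version given the rate, because events
    about the rate are events about [Th]. *)
Lemma exp_rate_cond_prob s :
  is_cond_prob P rate (rat_rect N s) (exp_rect s \o rate).
Proof.
have mr : sigma_measurable rate (exp_rect s \o rate).
  exact: sigma_measurable_comp (measurable_exp_rect s).
have mTh : sigma_measurable Th (exp_rect s \o exp_rate).
  move=> B mB; apply: (sigma_measurable_exp_rate (B := exp_rect s @^-1` B)).
  by rewrite -[X in measurable X]setTI; exact: measurable_exp_rect.
have cp : is_cond_prob P Th (rat_rect N s) (exp_rect s \o exp_rate).
  have := cond_cdf_prod (fun i => ratr (nth 0 s i)) (iota_uniq 0 (size s)).
  move=> /(cond_prob_ae_eq (g' := exp_rect s \o exp_rate)) H.
  have -> : rat_rect N s = [set w | forall i, i \in iota 0 (size s) ->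
      ((interarrival N i w)%:E <= (ratr (nth 0%R s i))%:E)%E].
    by apply/seteqP; split => w /= Hw i; have := Hw i; rewrite mem_iota leq0n add0n lee_fin.
  apply: H => //; apply: filterS cond_cdf_exp => w Hw /=.
  rewrite /exp_rect -(big_mkord xpredT (fun i => exp_cdf _ (ratr (nth 0 s i)))).
  by rewrite /index_iota subn0; apply: eq_bigr => i _.
have [_ [ir rE]] := cp.
split; first exact: mr.
split; first exact: ir.
move=> C mC; have [C' mC' CE] := sigma_measurable_exp_rate mC.
have -> : rate @^-1` C = Th @^-1` C' by rewrite -[LHS]CE setTI.
exact: rE.
Qed.

Lemma eMRP_exp_disintegrated : perfect P -> countably_generated (Omega := Omega) ->
  exists (X : {RV P >-> R}) (Qt : R -> probability Omega R),
    disintegrates P X Qt /\ {ae distribution P X, forall x, iid_exp N (Qt x) x}.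
Proof.
move=> perfP cgO; have [Qt HQ] := disintegration_exists rate perfP cgO.
exists rate, Qt; split => //.
have rects : {ae distribution P rate, forall x, forall s,
    Qt x (rat_rect N s) = (exp_rect s x)%:E}.
  apply: ae_forall_seq_rat => s.
  apply: (disintegrates_ae HQ); [exact: measurable_rat_rect|exact: measurable_exp_rect|].
  exact: exp_rate_cond_prob.
have pos : {ae distribution P rate, forall x, 0 < x}.
  exists (~` `]0, +oo[%classic); split.
  - by apply: measurableC; exact: measurable_itv.
  - change (P (rate @^-1` (~` `]0, +oo[%classic)) = 0%E).
    rewrite (_ : _ @^-1` _ = set0) ?measure0//; apply/seteqP; split => // w /=.
    by rewrite in_itv/= andbT; apply; exact: exp_rate_gt0.
  - by move=> x /= x0; rewrite in_itv/= andbT.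
by apply: filterS2 pos rects => x x0 H; apply/iid_expP.
Qed.

End conditionally_iid.

Section perfect_space.
Context {R : realType} {d : measure_display} {Omega : measurableType d}.
Variables (P : probability Omega R) (N : R -> Omega -> \bar R).
Hypotheses (cN : counting_process N) (perfP : perfect P).
Hypothesis cgO : countably_generated (Omega := Omega).

Lemma assertion_i_exp_disintegrated : assertion_i P N ->
  exists (Th : {RV P >-> R}) (Qt : R -> probability Omega R),
    disintegrates P Th Qt /\ {ae distribution P Th, forall x, iid_exp N (Qt x) x}.
Proof.
move=> [Th mppN]; have [Qt HQ] := disintegration_exists Th perfP cgO.
by exists Th, Qt; split => //; exact: MPP_disintegration_iid_exp.
Qed.

Lemma assertion_i_iii : assertion_i P N -> assertion_iii P N.
Proof.
by move=> /assertion_i_exp_disintegrated[Th [Qt [HQ iidQ]]]; exact: exp_disintegrated_iii HQ iidQ.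
Qed.

Lemma assertion_i_ii : assertion_i P N -> assertion_ii P N.
Proof.
by move=> /assertion_i_exp_disintegrated[Th [Qt [HQ iidQ]]]; exact: exp_disintegrated_ii HQ iidQ.
Qed.

(** The structural parameter obtained is the exponential rate, in general different from the [Th] of
    the Standing Assumption. *)
Lemma survival_assertion_i : standing_B P N -> survival_of_sum N P -> assertion_i P N.
Proof.
move=> [Th [D [h [K [Pt [_ [_ [_ [_ [mrpN _]]]]]]]]]] HL.
have [X [Qt [HQ iidQ]]] := eMRP_exp_disintegrated cN mrpN HL perfP cgO.
by apply: (assertion_iii_i cN); exact: exp_disintegrated_iii HQ iidQ.
Qed.

End perfect_space.

Theorem theorem1 (R : realType) (d : measure_display) (Omega : measurableType d)
    (P : probability Omega R) (N : R -> Omega -> \bar R) :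
  counting_process N ->
  (assertion_iii P N -> assertion_i P N) /\
  (assertion_i P N -> assertion_iv P N) /\
  (perfect P -> countably_generated (Omega := Omega) ->
     (assertion_i P N <-> assertion_iii P N) /\
     (assertion_i P N -> assertion_ii P N)) /\
  (perfect P -> countably_generated (Omega := Omega) -> standing_B P N ->
     (assertion_i P N <-> assertion_ii P N) /\
     (assertion_i P N <-> assertion_iii P N) /\
     (assertion_i P N <-> assertion_iv P N)).
Proof.
move=> cN; split; first exact: assertion_iii_i.
split; first exact: assertion_i_iv.
split=> perfP cgO.
  by split; [split; [exact: assertion_i_iii|exact: assertion_iii_i]|exact: assertion_i_ii].
move=> HB; split; [split|split; split].
- exact: assertion_i_ii.
- by move=> /(assertion_ii_survival cN); exact: survival_assertion_i.
- exact: assertion_i_iii.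
- exact: assertion_iii_i.
- exact: assertion_i_iv.
- by move=> /(assertion_iv_survival cN); exact: survival_assertion_i.
Qed.
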